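(* Let $M$ be an $n_1\times n_2$ matrix of rank $r$ sampled from the random orthogonal model, and put $n=\max(n_1,n_2)$. Suppose we observe the $m$ entries of $M$ indexed by a set $\Omega$ of cardinality $m$ sampled uniformly at random among all subsets of $\{1,\dots,n_1\}\times\{1,\dots,n_2\}$ of cardinality $m$. Then there are numerical constants $C$ and $c$ such that if $$m\ge C\,n^{5/4}\,r\log n,$$ the minimizer of the problem $$\text{minimize } \|X\|_* \quad\text{subject to } X_{ij}=M_{ij},\ (i,j)\in\Omega$$ is unique and equal to $M$ with probability at least $1-c\,n^{-3}$. In addition, if $r\le n^{1/5}$, then the same conclusion holds with probability at least $1-c\,n^{-3}$ provided that $m\ge C\,n^{6/5}\,r\log n$.
   Context: $\|X\|_*$ denotes the nuclear norm (sum of singular values). Random orthogonal model: $M=\sum_{k=1}^r\sigma_k u_kv_k^*$ with arbitrary singular values $\sigma_k>0$, where the family $\{u_k\}_{1\le k\le r}$ is selected uniformly at random among all families of $r$ orthonormal vectors in $\mathbb{R}^{n_1}$, and similarly $\{v_k\}_{1\le k\le r}$ uniformly at random among all families of $r$ orthonormal vectors in $\mathbb{R}^{n_2}$; the two families may or may not be independent of each other. The probability is over both the random matrix and the random set $\Omega$. *)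

(* Defs.v *)
From HB Require Import structures.
From mathcomp Require Import all_boot all_order all_algebra.
From mathcomp Require Import all_classical all_reals all_analysis.
Set Implicit Arguments. Unset Strict Implicit. Unset Printing Implicit Defensive.
Import Order.TTheory GRing.Theory Num.Theory.
Local Open Scope ring_scope.
Local Open Scope classical_set_scope.

Section Defs.
Variable R : realType.

Definition orthomx (n : nat) (Q : 'M[R]_n) : Prop := Q^T *m Q = 1%:M.

Definition orthonormal_cols (n r : nat) (A : 'M[R]_(n, r)) : Prop :=
  A^T *m A = 1%:M.

Definition is_svd (m n : nat) (X : 'M[R]_(m, n)) (U : 'M[R]_m)
    (D : 'M[R]_(m, n)) (V : 'M[R]_n) : Prop :=
  [/\ orthomx U, orthomx V,
      (forall (i : 'I_m) (j : 'I_n), nat_of_ord i <> nat_of_ord j -> D i j = 0),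
      (forall i j, 0 <= D i j) & X = U *m D *m V^T].

(** Nuclear norm: the sum of the singular values, i.e. the sum of the
    diagonal entries of D in any SVD X = U D V^T. *)
Definition nucnorm (m n : nat) (X : 'M[R]_(m, n)) : R :=
  [get s | exists U D V, is_svd X U D V /\ s = \sum_i \sum_j D i j].

Definition mx_borel (m n : nat) (A : set 'M[R]_(m, n)) : Prop :=
  <<s [set E | exists (i : 'I_m) (j : 'I_n) (B : set R),
                  measurable B /\ E = [set X : 'M[R]_(m, n) | B (X i j)]] >> A.

(** The law of the random matrix U (with orthonormal columns) is the
    uniform (Haar) distribution on the Stiefel manifold of r-frames in R^n:
    U is measurable and its law is invariant under every orthogonal
    transformation of R^n. *)
Definition uniform_frame (d : measure_display) (T : measurableType d)
    (P : probability T R) (n r : nat) (U : T -> 'M[R]_(n, r)) : Prop :=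
  [/\ (forall t, orthonormal_cols (U t)),
      (forall A, mx_borel A -> measurable (U @^-1` A)) &
      (forall (Q : 'M[R]_n) A, orthomx Q -> mx_borel A ->
         P (U @^-1` A) = P ((fun t => Q *m U t) @^-1` A))].

Definition agrees_on (m n : nat) (Om : {set 'I_m * 'I_n}) (X M : 'M[R]_(m, n)) :=
  forall i j, (i, j) \in Om -> X i j = M i j.

Definition exact_recovery (m n : nat) (Om : {set 'I_m * 'I_n}) (M : 'M[R]_(m, n)) :=
  forall X, agrees_on Om X M -> X <> M -> nucnorm M < nucnorm X.

Definition rom_matrix (n1 n2 r : nat) (sigma : 'I_r -> R)
    (U : 'M[R]_(n1, r)) (V : 'M[R]_(n2, r)) : 'M[R]_(n1, n2) :=
  \sum_(k < r) sigma k *: (col k U *m (col k V)^T).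

(** Probability of exact recovery, Omega uniform among m-subsets and independent
    of (U,V): there is, for each m-subset S, a measurable event F S on which
    recovery from S succeeds, and the averaged probability is >= p. *)
Definition recovery_prob_ge (d : measure_display) (T : measurableType d)
    (P : probability T R) (n1 n2 r : nat) (sigma : 'I_r -> R)
    (U : T -> 'M[R]_(n1, r)) (V : T -> 'M[R]_(n2, r)) (m : nat) (p : R) : Prop :=
  exists F : {set 'I_n1 * 'I_n2} -> set T,
    (forall S, measurable (F S)) /\
    (forall (S : {set 'I_n1 * 'I_n2}) t, #|S| = m -> F S t -> exact_recovery S (rom_matrix sigma (U t) (V t))) /\
    p <= (\sum_(S : {set 'I_n1 * 'I_n2} | #|S| == m) fine (P (F S)))
           / ('C(n1 * n2, m))%:R.

End Defs.

(* Main.v *)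
Require Import Defs.
From HB Require Import structures.
From mathcomp Require Import all_boot all_order all_algebra all_fingroup.
From mathcomp Require Import all_classical all_reals all_analysis measurable_realfun.
From mathcomp Require Import complex.
From mathcomp Require Import ring lra zify.
Import Order.TTheory GRing.Theory Num.Theory.
Local Open Scope ring_scope.
Local Open Scope classical_set_scope.

(** Golfing with a bounded number of steps and moments of bounded order. Write
    [n = max(n1, n2) = h^20] and let [T] be the tangent space of the rank-[r]
    matrices at [M], with orthogonal projection [PT]. The required number of
    samples exceeds [n r] by the polynomial factor [h^4] (already in the [6/5]
    regime, whatever [r] is), so every concentration estimate may lose a small
    power of [n].

    - Rotating a uniform frame so that one of its rows becomes a random-sign
      average of all rows shows that, outside an event of probability
      [O(n^-3)], the squared row norms of [U] and [V] are at most [h^2 r / n1]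
      and [h^2 r / n2]. The two frames are never compared, so they may be
      dependent.
    - Uniform [m]-subsets are replaced by [k = 220] batches of i.i.d. uniform
      positions: recovery is monotone in the observed set, and averaging over all
      permutations of the positions makes the resulting superset uniform.
    - Starting from [Z = U V^T], iterate [Z := Z - PT (R_w Z)] with a fresh batch
      [w], where [R_w] is the rescaled sampling operator. Each step divides
      [|Z|_F^2] by [h], preserves the bounds on the entries, rows and columns of
      [Z], and keeps [R_w Z - Z] small in operator norm, with failure probability
      at most a large negative power of [h]. All these are moment estimates, for
      vectors and for symmetric matrices, obtained from exchangeable pairs; the
      joint incoherence of [U V^T] is not needed because rows and columns are
      tracked as well as entries.
    - The sum of the [R_w Z] is an approximate dual certificate supported on the
      samples. Running the same iteration from every [PT e_ij] shows in addition
      that a matrix vanishing on the samples is controlled by its component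
      orthogonal to [T]; this replaces the usual bound on the restriction of the
      sampling operator to [T], and both facts together give exact recovery. *)

Set Implicit Arguments. Unset Strict Implicit. Unset Printing Implicit Defensive.

(** * The Frobenius inner product *)

Section Frobenius.
Variable R : rcfType.

Definition ip (m n : nat) (A B : 'M[R]_(m, n)) : R := \sum_i \sum_j A i j * B i j.
Definition sqn (m n : nat) (A : 'M[R]_(m, n)) : R := ip A A.

Lemma ip_tr m n (A B : 'M[R]_(m, n)) : ip A B = \tr (A^T *m B).
Proof.
rewrite /ip exchange_big /=; apply: eq_bigr => j _.
by rewrite mxE; apply: eq_bigr => i _; rewrite mxE.
Qed.

Section Bilinear.
Variables m n : nat.
Implicit Types A B C : 'M[R]_(m, n).

Lemma ipC A B : ip A B = ip B A.
Proof. by apply: eq_bigr => i _; apply: eq_bigr => j _; rewrite mulrC. Qed.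

Lemma ipDl A B C : ip (A + B) C = ip A C + ip B C.
Proof. by rewrite !ip_tr linearD mulmxDl linearD. Qed.
Lemma ipZl a A B : ip (a *: A) B = a * ip A B.
Proof. by rewrite !ip_tr linearZ -scalemxAl linearZ. Qed.
Lemma ipNl A B : ip (- A) B = - ip A B.
Proof. by rewrite -scaleN1r ipZl mulN1r. Qed.
Lemma ipBl A B C : ip (A - B) C = ip A C - ip B C.
Proof. by rewrite ipDl ipNl. Qed.
Lemma ip0l A : ip 0 A = 0.
Proof. by rewrite -(scale0r 0) ipZl mul0r. Qed.
Lemma ipDr A B C : ip C (A + B) = ip C A + ip C B.
Proof. by rewrite ipC ipDl !(ipC C). Qed.
Lemma ipZr a A B : ip B (a *: A) = a * ip B A.
Proof. by rewrite ipC ipZl ipC. Qed.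
Lemma ipNr A B : ip B (- A) = - ip B A.
Proof. by rewrite ipC ipNl ipC. Qed.
Lemma ipBr A B C : ip C (A - B) = ip C A - ip C B.
Proof. by rewrite ipDr ipNr. Qed.
Lemma ip0r A : ip A 0 = 0.
Proof. by rewrite ipC ip0l. Qed.
Lemma ip_suml (I : Type) (s : seq I) (P : pred I) (F : I -> 'M[R]_(m, n)) A :
  ip (\sum_(i <- s | P i) F i) A = \sum_(i <- s | P i) ip (F i) A.
Proof.
by elim/big_rec2: _ => [|i x y _ <-]; rewrite ?ip0l ?ipDl.
Qed.
Lemma ip_sumr (I : Type) (s : seq I) (P : pred I) (F : I -> 'M[R]_(m, n)) A :
  ip A (\sum_(i <- s | P i) F i) = \sum_(i <- s | P i) ip A (F i).
Proof. by rewrite ipC ip_suml; apply: eq_bigr => i _; rewrite ipC. Qed.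

Lemma sqn_ge0 A : 0 <= sqn A.
Proof. by do 2!apply: sumr_ge0 => ? _; rewrite -expr2 sqr_ge0. Qed.
Lemma sqnE A : sqn A = \sum_i \sum_j A i j ^+ 2.
Proof. by []. Qed.
Lemma sqn0 : sqn (0 : 'M[R]_(m, n)) = 0.
Proof. by rewrite /sqn ip0l. Qed.
Lemma sqnN A : sqn (- A) = sqn A.
Proof. by rewrite /sqn ipNl ipNr opprK. Qed.
Lemma sqnZ a A : sqn (a *: A) = a ^+ 2 * sqn A.
Proof. by rewrite /sqn ipZl ipZr mulrA expr2. Qed.
Lemma sqnD A B : sqn (A + B) = sqn A + 2 * ip A B + sqn B.
Proof. rewrite /sqn ipDl !ipDr (ipC B A); ring. Qed.
Lemma sqnB A B : sqn (A - B) = sqn A - 2 * ip A B + sqn B.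
Proof. by rewrite sqnD ipNr sqnN mulrN. Qed.
Lemma sqn_eq0 A : sqn A = 0 -> A = 0.
Proof.
move=> /eqP; rewrite psumr_eq0 => [/allP h|i _]; last first.
  by apply: sumr_ge0 => j _; rewrite -expr2 sqr_ge0.
apply/matrixP => i j; rewrite mxE; apply/eqP.
have /eqP/eqP := h i (mem_index_enum _).
rewrite psumr_eq0 => [/allP/(_ j (mem_index_enum _))|k _]; last by rewrite -expr2 sqr_ge0.
by rewrite mulf_eq0 orbb.
Qed.
Lemma sqnB_le A B : sqn (A - B) <= 2 * sqn A + 2 * sqn B.
Proof. have := sqn_ge0 (A + B); rewrite sqnD sqnB; lra. Qed.
Lemma cauchy_schwarz A B : ip A B ^+ 2 <= sqn A * sqn B.
Proof.
have [/sqn_eq0-> | nzB] := eqVneq (sqn B) 0; first by rewrite ip0r sqn0 expr0n mulr0.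
have pB : 0 < sqn B by rewrite lt_def nzB sqn_ge0.
have := sqn_ge0 (sqn B *: A - ip A B *: B).
rewrite sqnB !sqnZ ipZl ipZr => h.
have {h}: 0 <= sqn B * (sqn A * sqn B - ip A B ^+ 2) by move: h; nra.
by rewrite pmulr_rge0 // subr_ge0.
Qed.

Definition nf A := Num.sqrt (sqn A).
Lemma nf_ge0 A : 0 <= nf A. Proof. exact: sqrtr_ge0. Qed.
Lemma nf2 A : nf A ^+ 2 = sqn A. Proof. by rewrite sqr_sqrtr ?sqn_ge0. Qed.
Lemma nf0 : nf (0 : 'M[R]_(m, n)) = 0. Proof. by rewrite /nf sqn0 sqrtr0. Qed.
Lemma nfZ a A : nf (a *: A) = `|a| * nf A.
Proof. by rewrite /nf sqnZ sqrtrM ?sqr_ge0 // sqrtr_sqr. Qed.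
Lemma ip_le_nf A B : `|ip A B| <= nf A * nf B.
Proof.
rewrite -(ler_pXn2r (ltn0Sn 1)) ?nnegrE ?mulr_ge0 ?nf_ge0 //.
by rewrite real_normK ?num_real // exprMn !nf2 cauchy_schwarz.
Qed.
Lemma ler_nfD A B : nf (A + B) <= nf A + nf B.
Proof.
rewrite -(ler_pXn2r (ltn0Sn 1)) ?nnegrE ?addr_ge0 ?nf_ge0 //.
rewrite sqrrD !nf2 sqnD; have := le_trans (ler_norm _) (ip_le_nf A B); lra.
Qed.
Lemma ler_nf_sum (I : Type) (s : seq I) (P : pred I) (F : I -> 'M[R]_(m, n)) :
  nf (\sum_(i <- s | P i) F i) <= \sum_(i <- s | P i) nf (F i).
Proof.
elim/big_rec2: _ => [|i x y _ h]; first by rewrite nf0.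
by rewrite (le_trans (ler_nfD _ _)) ?lerD2l.
Qed.
Lemma nf_le A c : 0 <= c -> (nf A <= c) = (sqn A <= c ^+ 2).
Proof. by move=> c0; rewrite -nf2 ler_pXn2r ?nnegrE ?nf_ge0. Qed.

End Bilinear.

Lemma ip_trmx m n (A B : 'M[R]_(m, n)) : ip A^T B^T = ip A B.
Proof.
rewrite /ip exchange_big /=; apply: eq_bigr => i _; apply: eq_bigr => j _.
by rewrite !mxE.
Qed.
Lemma sqn_trmx m n (A : 'M[R]_(m, n)) : sqn A^T = sqn A.
Proof. exact: ip_trmx. Qed.
Lemma ip_mull m n p (A : 'M[R]_(m, n)) (B : 'M[R]_(n, p)) C : ip (A *m B) C = ip B (A^T *m C).
Proof. by rewrite !ip_tr trmx_mul mulmxA. Qed.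
Lemma ip_mulr m n p (A : 'M[R]_(m, n)) (B : 'M[R]_(n, p)) C : ip (A *m B) C = ip A (C *m B^T).
Proof. by rewrite -ip_trmx trmx_mul ip_mull -ip_trmx !trmx_mul !trmxK. Qed.
Lemma ip_delta m n (A : 'M[R]_(m, n)) i j : ip A (delta_mx i j) = A i j.
Proof.
rewrite /ip (bigD1 i) //= (bigD1 j) //= mxE !eqxx mulr1 [X in X + _]addrC.
rewrite big1 => [|k /negPf nk]; last by rewrite mxE nk andbF mulr0.
rewrite big1 ?add0r ?addr0 // => k /negPf nk.
by apply: big1 => l _; rewrite mxE nk mulr0.
Qed.
Lemma sqn_row m n (A : 'M[R]_(m, n)) : sqn A = \sum_i sqn (row i A).
Proof.
apply: eq_bigr => i _; rewrite /sqn /ip big_ord1.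
by apply: eq_bigr => j _; rewrite !mxE.
Qed.
Lemma sqn_rowE m n (A : 'M[R]_(m, n)) i : sqn (row i A) = \sum_j A i j ^+ 2.
Proof. by rewrite /sqn /ip big_ord1; apply: eq_bigr => j _; rewrite !mxE expr2. Qed.
Lemma sqn_colE m n (A : 'M[R]_(m, n)) j : sqn (col j A) = \sum_i A i j ^+ 2.
Proof. by rewrite -sqn_trmx tr_col sqn_rowE; apply: eq_bigr => i _; rewrite mxE. Qed.
Lemma sqn_row_le m n (A : 'M[R]_(m, n)) i : sqn (row i A) <= sqn A.
Proof. by rewrite [leRHS]sqn_row (bigD1 i) //= lerDl sumr_ge0 // => *; exact: sqn_ge0. Qed.
Lemma sqn_col_le m n (A : 'M[R]_(m, n)) j : sqn (col j A) <= sqn A.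
Proof. by rewrite -(sqn_trmx (col j A)) -(sqn_trmx A) tr_col sqn_row_le. Qed.
Lemma sqr_entry_le m n (A : 'M[R]_(m, n)) i j : A i j ^+ 2 <= sqn A.
Proof.
apply: le_trans (sqn_row_le A i).
by rewrite sqn_rowE (bigD1 j) //= lerDl sumr_ge0 // => *; rewrite sqr_ge0.
Qed.

End Frobenius.

(** * Moments of sums of independent samples *)

Section Resampling.
Variables (R : rcfType) (I : finType) (m : nat).
Notation sample := {ffun 'I_m -> I}.

Definition resample (w : sample) (s : 'I_m) (a : I) : sample :=
  [ffun t => if t == s then a else w t].

Lemma resample_eq w s a : resample w s a s = a.
Proof. by rewrite ffunE eqxx. Qed.

(** Sending [(w, a)] to [(resample w s a, w s)] is an involution of [sample * I]. This is the
    exchangeability of a sample and its resampled copy. *)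
Lemma sum_resample (V : nmodType) (F : sample -> I -> V) s :
  \sum_(w : sample) \sum_a F w a = \sum_(w : sample) \sum_a F (resample w s a) (w s).
Proof.
rewrite !pair_big /=.
rewrite (reindex_inj (h := fun x : sample * I => (resample x.1 s x.2, x.1 s))) //=.
apply: (can_inj (g := fun x : sample * I => (resample x.1 s x.2, x.1 s))).
move=> [w a] /=; rewrite resample_eq; congr (_, _).
by apply/ffunP => t; rewrite !ffunE; case: eqP => [->|].
Qed.

Section Core.
Variables (d1 d2 : nat).
Notation mx := 'M[R]_(d1, d2).
Variables (A : 'I_m -> I -> mx).
Notation N := (#|I|%:R : R).

(** Centred sum of independent terms: its average over all [w] is zero. *)
Definition csum (w : sample) : mx := \sum_s (A s (w s) - N^-1 *: \sum_a A s a).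

Lemma csum_resample w s a : csum w - csum (resample w s a) = A s (w s) - A s a.
Proof.
rewrite /csum (bigD1 s) //= [X in _ - X](bigD1 s) //= resample_eq.
rewrite [X in _ - (_ + X)](eq_bigr (fun t => A t (w t) - N^-1 *: \sum_a A t a)).
  by rewrite opprD addrACA subrr addr0 opprB addrA subrK.
by move=> t /negPf nt; rewrite ffunE nt.
Qed.

(** The abstraction serves two cases: [f X = sqn X ^+ q *: X] for vectors, and
    [f X = X ^+ (2 * q).+1] on symmetric matrices, with [P] the symmetry. In both, [psi] is
    quadratic in its first argument and measures the local slope of [f]. *)
Variables (f : mx -> mx) (psi : mx -> mx -> R) (K : R) (P : pred mx).
Hypothesis K_ge0 : 0 <= K.
Hypothesis card_gt0 : (0 < #|I|)%N.
Hypothesis PA : forall s a, P (A s a).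
Hypothesis Pcsum : forall w, P (csum w).
Hypothesis f_lip : forall X Y, P X -> P Y ->
  ip (X - Y) (f X - f Y) <= K * (psi (X - Y) X + psi (X - Y) Y).
Hypothesis psi_sub : forall G H X, P G -> P H -> P X ->
  psi (G - H) X <= 2 * psi G X + 2 * psi H X.

(* Exchangeable pair: resampling the coordinate [s] symmetrises
   <A_s - E A_s, f X> into (1/2) <X - X', f X - f X'>. *)
Lemma exchangeable_pair_bound :
  \sum_(w : sample) ip (csum w) (f (csum w)) <=
  2 * K * \sum_(w : sample) \sum_s (psi (A s (w s)) (csum w) + N^-1 * \sum_a psi (A s a) (csum w)).
Proof.
have N0 : 0 < N by rewrite ltr0n.
have -> : \sum_(w : sample) ip (csum w) (f (csum w)) =
    \sum_s N^-1 * \sum_(w : sample) \sum_a ip (A s (w s) - A s a) (f (csum w)).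
  transitivity (\sum_(w : sample) \sum_s N^-1 * \sum_a ip (A s (w s) - A s a) (f (csum w))); last first.
    by rewrite exchange_big; apply: eq_bigr => s _; rewrite mulr_sumr.
  apply: eq_bigr => w _; rewrite {1}/csum ip_suml; apply: eq_bigr => s _.
  under [in RHS]eq_bigr do rewrite ipBl.
  rewrite sumrB sumr_const ipBl ipZl ip_suml mulrBr -[X in _ * X - _]mulr_natl.
  by rewrite mulrA mulVf ?mul1r ?gt_eqF.
rewrite mulrC [X in X * _]exchange_big /= mulr_suml; apply: ler_sum => s _.
have -> : \sum_(w : sample) (psi (A s (w s)) (csum w) + N^-1 * \sum_a psi (A s a) (csum w)) =
   N^-1 * \sum_(w : sample) \sum_a (psi (A s (w s)) (csum w) + psi (A s a) (csum w)).
  rewrite mulr_sumr; apply: eq_bigr => w _.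
  by rewrite big_split /= sumr_const mulrDr -[X in _ = _ * X + _]mulr_natl mulrA mulVf ?mul1r ?gt_eqF.
rewrite -mulrA ler_pM2l ?invr_gt0 //.
set L := (X in X <= _).
(* One copy of [L] is kept and the other rewritten by the resampling involution. Their sum pairs the
   increment of [csum] with the increment of [f], to which [f_lip] applies. *)
have eL : L + L <= (2 * K * \sum_(w : sample) \sum_a (psi (A s (w s)) (csum w) + psi (A s a) (csum w))) *+ 2.
  have -> : L + L = \sum_(w : sample) \sum_a
      ip (csum w - csum (resample w s a)) (f (csum w) - f (csum (resample w s a))).
    rewrite {2}/L (sum_resample _ s) /L -big_split; apply: eq_bigr => w _.
    rewrite -big_split; apply: eq_bigr => a _.
    by rewrite csum_resample resample_eq ipBr !ipBl /=; ring.
  apply: (@le_trans _ _ (\sum_(w : sample) \sum_a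
     (K * psi (A s (w s) - A s a) (csum w) + K * psi (A s (w s) - A s a) (csum (resample w s a))))).
    apply: ler_sum => w _; apply: ler_sum => a _.
    by rewrite -mulrDr -csum_resample f_lip.
  under eq_bigr do rewrite big_split; rewrite big_split /=.
  rewrite [X in _ + X](sum_resample _ s) mulr2n; apply: lerD.
    rewrite mulr_sumr; apply: ler_sum => w _; rewrite mulr_sumr; apply: ler_sum => a _.
    rewrite [2 * K]mulrC -mulrA ler_wpM2l // mulrDr; exact: psi_sub.
  rewrite mulr_sumr; apply: ler_sum => w _; rewrite mulr_sumr; apply: ler_sum => a _.
  rewrite resample_eq.
  have -> : resample (resample w s a) s (w s) = w.
    by apply/ffunP => t; rewrite !ffunE; case: eqP => [->|].
  rewrite [2 * K]mulrC -mulrA ler_wpM2l // mulrDr [leRHS]addrC; exact: psi_sub.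
by rewrite mulrC; move: eL; rewrite mulr2n; lra.
Qed.

End Core.
End Resampling.

Section Moments.
Variable R : rcfType.

(** By cases: the first term on the right dominates when [2 * K * d <= y], the second otherwise. The
    factor one half allows the moment to be absorbed on the left later. *)
Lemma young_pow (K d y : R) (q : nat) : 0 <= K -> 0 <= d -> 0 <= y ->
  K * d * y ^+ q <= y ^+ q.+1 / 2 + (2 * K * d) ^+ q.+1.
Proof.
move=> K0 d0 y0; have Kd0 : 0 <= K * d by rewrite mulr_ge0.
have [h|h] := leP (2 * (K * d)) y.
  apply: (@le_trans _ _ (y ^+ q.+1 / 2)); last first.
    by rewrite lerDl exprn_ge0 // -mulrA mulr_ge0.
  by rewrite exprS (mulrAC y) ler_wpM2r ?exprn_ge0 // ler_pdivlMr // mulrC.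
apply: (@le_trans _ _ ((2 * K * d) ^+ q.+1)); last first.
  by rewrite lerDr divr_ge0 // exprn_ge0.
rewrite -[2 * K * d]mulrA [leRHS]exprS; apply: ler_pM; rewrite ?exprn_ge0 //.
  by rewrite ler_peMl // ler1n.
by rewrite lerXn2r ?nnegrE // ?mulr_ge0 // ltW.
Qed.

Section SampleSums.
Variables (I : finType) (m : nat).
Notation sample := {ffun 'I_m -> I}.
Notation M := (#|{: sample}|%:R : R).
Notation N := (#|I|%:R : R).
Hypothesis card_gt0 : (0 < #|I|)%N.

(** Markov's inequality for the uniform distribution, as a count. The case [b = 0] is included:
    there the moment bound forces every [F w] to vanish. *)
Lemma markov_count (F : sample -> R) (p : nat) (C b t : R) :
  (forall w, 0 <= F w) -> 0 <= C -> 0 <= b -> 0 < t ->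
  \sum_(w : sample) F w ^+ p.+1 <= M * C * b ^+ p.+1 ->
  #|[pred w : sample | ~~ (F w <= t * b)]|%:R <= M * C * t ^- p.+1.
Proof.
move=> F0 C0 b0 t0 h.
have [b1|] := ltP 0 b; last first.
  move=> b1; have {b1 b0} bE : b = 0 by apply/eqP; rewrite eq_le b1 b0.
  have {}h : \sum_(w : sample) F w ^+ p.+1 <= 0 by rewrite bE expr0n mulr0 in h.
  have hF w : F w <= 0.
    have : F w ^+ p.+1 <= 0.
      apply: le_trans h; rewrite (bigD1 w) //= lerDl; apply: sumr_ge0 => *.
      exact: exprn_ge0.
    by apply: contraTT; rewrite -!ltNge; apply: exprn_gt0.
  rewrite bE mulr0 (eq_card0 (A := _)) ?mulr_ge0 ?invr_ge0 ?exprn_ge0 ?ler0n ?(ltW t0) //.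
  by move=> w; rewrite !inE hF.
have tb0 : 0 < (t * b) ^+ p.+1 by rewrite exprn_gt0 ?mulr_gt0.
rewrite -(ler_pM2r tb0) [X in _ <= _ * X]exprMn mulrA mulfVK ?gt_eqF ?exprn_gt0 //.
apply: le_trans h; rewrite -sum1_card natr_sum mulr_suml.
apply: (@le_trans _ _ (\sum_(w : sample | ~~ (F w <= t * b)) F w ^+ p.+1)).
  apply: ler_sum => w; rewrite inE -ltNge mul1r => hw.
  by rewrite lerXn2r ?nnegrE ?F0 ?mulr_ge0 ?(ltW t0) ?(ltW b1) ?(ltW hw).
rewrite [leRHS](bigID (fun w => ~~ (F w <= t * b))) /= lerDl.
by apply: sumr_ge0 => *; rewrite exprn_ge0.
Qed.

Section Scalar.
Variables (b : 'I_m -> I -> R) (B : R).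
Hypothesis b_ge0 : forall s a, 0 <= b s a.
Hypothesis b_le : forall s a, b s a <= B.
Let v := N^-1 * \sum_s \sum_a b s a.
Let S (w : sample) := \sum_s b s (w s).

(** Induction on [p] with [c] general. In one factor [S w], the term [b s (w s)] is decoupled from
    the remaining power by resampling coordinate [s], which raises the shift [c] by at most [B]. *)
Lemma scalar_moment p c : 0 <= c -> 0 <= B ->
  \sum_(w : sample) (S w + c) ^+ p <= M * (v + c + p%:R * B) ^+ p.
Proof.
move=> c0 B0.
have N0 : 0 < N by rewrite ltr0n.
have v0 : 0 <= v.
  by rewrite mulr_ge0 ?invr_ge0 ?(ltW N0) // sumr_ge0 // => s _; rewrite sumr_ge0.
have S0 w : 0 <= S w by rewrite sumr_ge0.
elim: p c c0 => [|p IH] c c0.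
  by rewrite expr0 mulr1 sumr_const.
have -> : \sum_(w : sample) (S w + c) ^+ p.+1 =
   \sum_s \sum_(w : sample) b s (w s) * (S w + c) ^+ p + c * \sum_(w : sample) (S w + c) ^+ p.
  rewrite exchange_big mulr_sumr -big_split; apply: eq_bigr => w _ /=.
  by rewrite exprS mulrDl; congr (_ + _); rewrite mulr_suml.
have step s : \sum_(w : sample) b s (w s) * (S w + c) ^+ p <=
     (N^-1 * \sum_a b s a) * (M * (v + c + p.+1%:R * B) ^+ p).
  have -> : \sum_(w : sample) b s (w s) * (S w + c) ^+ p =
    N^-1 * \sum_(w : sample) \sum_(a : I) b s (w s) * (S w + c) ^+ p.
    rewrite mulr_sumr; apply: eq_bigr => w _.
    by rewrite sumr_const -[X in _ = _ * X]mulr_natl mulrA mulVf ?mul1r ?gt_eqF.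
  rewrite -mulrA ler_pM2l ?invr_gt0 // (sum_resample _ s) exchange_big mulr_suml.
  apply: ler_sum => a _ /=; under eq_bigr do rewrite resample_eq.
  rewrite -mulr_sumr ler_wpM2l //.
  have := IH (c + B) (addr_ge0 c0 B0).
  have -> : v + (c + B) + p%:R * B = v + c + p.+1%:R * B by rewrite -(natr1 p); ring.
  apply: le_trans; apply: ler_sum => w _.
  rewrite lerXn2r ?nnegrE ?addr_ge0 // addrA addrAC lerD2r.
  rewrite /S (bigD1 s) //= resample_eq [X in _ <= X + _](bigD1 s) //=.
  rewrite [X in _ + X <= _](eq_bigr (fun t => b t (w t))); last first.
    by move=> t /negPf nt; rewrite ffunE nt.
  by have := b_le s a; have := b_ge0 s (w s); lra.
have le2 : \sum_(w : sample) (S w + c) ^+ p <= M * (v + c + p.+1%:R * B) ^+ p.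
  apply: le_trans (IH c c0) _; rewrite ler_wpM2l ?ler0n //.
  have pB k : 0 <= k%:R * B by rewrite mulr_ge0 ?ler0n.
  by rewrite lerXn2r ?nnegrE ?addr_ge0 // lerD2l ler_wpM2r // ler_nat.
apply: (@le_trans _ _ ((v + c) * (M * (v + c + p.+1%:R * B) ^+ p))).
  rewrite mulrDl; apply: lerD; last by rewrite ler_wpM2l.
  move: step; set X := M * _ => step.
  by rewrite /v mulr_sumr mulr_suml; apply: ler_sum.
rewrite exprS mulrCA ler_wpM2l ?ler0n // ler_wpM2r ?lerDl ?mulr_ge0 ?ler0n //.
by rewrite exprn_ge0 // !addr_ge0 // mulr_ge0 ?ler0n.
Qed.

Lemma scalar_moment_le p beta : v <= beta -> B <= beta ->
  \sum_(w : sample) (S w + v) ^+ p <= M * ((p + 2)%:R * beta) ^+ p.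
Proof.
move=> hv hB.
have N0 : 0 < N by rewrite ltr0n.
have v0 : 0 <= v.
  by rewrite mulr_ge0 ?invr_ge0 ?(ltW N0) // sumr_ge0 // => s _; rewrite sumr_ge0.
have beta0 := le_trans v0 hv.
have h B' : 0 <= B' -> B' <= beta -> v + v + p%:R * B' <= (p + 2)%:R * beta.
  move=> B'0 hB'; rewrite natrD.
  have := ler_wpM2l (ler0n R p) hB'; lra.
have [B0|nB] := leP 0 B.
  apply: le_trans (scalar_moment p v0 B0) _; rewrite ler_wpM2l ?ler0n //.
  have h0 k x : 0 <= x -> 0 <= (k%:R : R) * x by move=> *; rewrite mulr_ge0 ?ler0n.
  have h1 := h0 p B B0; have h2 := h0 (p + 2)%N beta beta0; have h3 := h B B0 hB.
  by rewrite lerXn2r ?nnegrE // !addr_ge0.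
(* A negative [B] contradicts [b_ge0] as soon as there is an index and a value, so every [S w] is an
   empty sum. *)
have F (s : 'I_m) : I -> False by move=> a; have := le_lt_trans (le_trans (b_ge0 s a) (b_le s a)) nB; rewrite ltxx.
have S0 (w : sample) : S w = 0 by rewrite /S big1 // => s _; case: (F s (w s)).
rewrite (eq_bigr (fun=> v ^+ p)) => [|w _]; last by rewrite S0 add0r.
rewrite sumr_const -[_ *+ _]mulr_natl ler_wpM2l ?ler0n //.
have h3 := h 0 (lexx _) beta0; rewrite mulr0 addr0 in h3.
have h2 : v <= (p + 2)%:R * beta by clear F; lra.
by rewrite lerXn2r ?nnegrE // (le_trans v0 h2).
Qed.

End Scalar.

Section Vector.
Variables (d1 d2 : nat) (A : 'I_m -> I -> 'M[R]_(d1, d2)).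

(** Polarisation writes the left side as half of [(a - b) * (a ^+ q - b ^+ q) + D * (a ^+ q + b ^+
    q)]. Cauchy-Schwarz for [X - Y] and [X + Y] gives [(a - b) ^+ 2 <= 2 * (a + b) * D], and the
    quotient of [a ^+ q - b ^+ q] by [a - b] is bounded monomial by monomial. *)
Lemma sqn_pow_lip (X Y : 'M[R]_(d1, d2)) q :
  ip (X - Y) (sqn X ^+ q *: X - sqn Y ^+ q *: Y) <=
  (2 * q.+1)%:R * (sqn (X - Y) * sqn X ^+ q + sqn (X - Y) * sqn Y ^+ q).
Proof.
set a := sqn X; set b := sqn Y; set D := sqn (X - Y).
have a0 : 0 <= a := sqn_ge0 _; have b0 : 0 <= b := sqn_ge0 _.
have D0 : 0 <= D := sqn_ge0 _.
have -> : ip (X - Y) (a ^+ q *: X - b ^+ q *: Y) =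
    ((a - b) * (a ^+ q - b ^+ q) + D * (a ^+ q + b ^+ q)) / 2.
  have -> : D = a - 2 * ip X Y + b by rewrite /D sqnB.
  rewrite ipBl !ipBr !ipZr (ipC Y X) -/a -/b.
  by rewrite -[ip X X]/a -[ip Y Y]/b; field.
have hab : (a - b) ^+ 2 <= 2 * (a + b) * D.
  have := cauchy_schwarz (X - Y) (X + Y).
  have -> : ip (X - Y) (X + Y) = a - b.
    by rewrite ipBl !ipDr (ipC Y X) -/a -/b -[ip X X]/a -[ip Y Y]/b; ring.
  have : sqn (X + Y) <= 2 * (a + b).
    have := sqnB_le X (- Y); rewrite opprK sqnN -/a -/b; lra.
  rewrite -/D => h1 h2; apply: (le_trans h2).
  by rewrite mulrC ler_wpM2r.
have powle i j : a ^+ i * b ^+ j <= a ^+ (i + j) + b ^+ (i + j).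
  have [h|h] := leP a b.
    rewrite exprD [leLHS]mulrC [X in _ <= _ + X]exprD.
    apply: (@le_trans _ _ (b ^+ i * b ^+ j)).
      by rewrite mulrC ler_wpM2r ?exprn_ge0 // lerXn2r.
    by rewrite lerDr mulr_ge0 ?exprn_ge0.
  rewrite exprD; apply: (@le_trans _ _ (a ^+ i * a ^+ j)).
    by rewrite ler_wpM2l ?exprn_ge0 // lerXn2r ?ltW.
  by rewrite lerDl ?exprn_ge0.
have key : (a - b) * (a ^+ q - b ^+ q) <= 4 * q%:R * D * (a ^+ q + b ^+ q).
  case: q => [|q]; first by rewrite !expr0 subrr !(mulr0, mul0r).
  rewrite subrXX mulrA -expr2.
  set Q := \sum_(i < q.+1) _.
  have Q0 : 0 <= Q by apply: sumr_ge0 => i _; rewrite mulr_ge0 ?exprn_ge0.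
  apply: (@le_trans _ _ (2 * (a + b) * D * Q)); first by rewrite ler_wpM2r.
  have : (a + b) * Q <= 2 * q.+1%:R * (a ^+ q.+1 + b ^+ q.+1).
    have -> : 2 * q.+1%:R * (a ^+ q.+1 + b ^+ q.+1) =
       \sum_(i < q.+1) (2 * (a ^+ q.+1 + b ^+ q.+1)).
      by rewrite sumr_const card_ord -mulr_natr; ring.
    rewrite mulr_sumr; apply: ler_sum => i _.
    have iq : (i <= q)%N by rewrite -ltnS.
    have e1 : ((q.+1.-1 - i).+1 + i = q.+1)%N by rewrite /=; lia.
    have e2 : ((q.+1.-1 - i) + i.+1 = q.+1)%N by rewrite /=; lia.
    rewrite mulrDl mulrA -exprS mulrCA -exprS.
    have := powle (q.+1.-1 - i).+1 i; have := powle (q.+1.-1 - i)%N i.+1.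
    rewrite e1 e2; lra.
  by move=> h; have := ler_wpM2l D0 h; lra.
have h3 : 0 <= D * (a ^+ q + b ^+ q).
  by apply: mulr_ge0 => //; apply: addr_ge0; apply: exprn_ge0.
have -> : (2 * q.+1)%:R * (D * a ^+ q + D * b ^+ q) =
    2 * q%:R * D * (a ^+ q + b ^+ q) + 2 * (D * (a ^+ q + b ^+ q)).
  by rewrite natrM -(natr1 q); ring.
lra.
Qed.

(** The factor [8 * p] is the slope constant [2 * p] of [sqn_pow_lip], doubled by the exchangeable
    pair and again by Young. The factor [p + 2] comes from [scalar_moment_le], and the leading [2]
    from absorbing half of the moment. *)
Definition vec_const (p : nat) : R := 2 * ((8 * p * (p + 2))%:R) ^+ p.

(** A Rosenthal-type inequality. The exchangeable pair bounds the moment by the average of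
    [(S w + v) * sqn (csum A w) ^+ q]. Young's inequality absorbs the power of [csum], leaving a
    moment of the nonnegative sum [S w + v]. *)
Lemma vector_moment q beta :
  (forall s a, sqn (A s a) <= beta) ->
  N^-1 * \sum_s \sum_a sqn (A s a) <= beta ->
  \sum_(w : sample) sqn (csum A w) ^+ q.+1 <= M * vec_const q.+1 * beta ^+ q.+1.
Proof.
move=> hB hv.
set v := N^-1 * _ in hv.
set S := fun w : sample => \sum_s sqn (A s (w s)).
have N0 : 0 < N by rewrite ltr0n.
have v0 : 0 <= v.
  rewrite mulr_ge0 ?invr_ge0 ?(ltW N0) // sumr_ge0 // => s _.
  by rewrite sumr_ge0 // => a _; rewrite sqn_ge0.
have S0 w : 0 <= S w by rewrite sumr_ge0 // => s _; rewrite sqn_ge0.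
have psub (G H X : 'M[R]_(d1, d2)) : xpredT G -> xpredT H -> xpredT X ->
    sqn (G - H) * sqn X ^+ q <= 2 * (sqn G * sqn X ^+ q) + 2 * (sqn H * sqn X ^+ q).
  move=> _ _ _; rewrite !mulrA -mulrDl ler_wpM2r ?exprn_ge0 ?sqn_ge0 //.
  exact: sqnB_le.
have := @exchangeable_pair_bound R I m d1 d2 A (fun X => sqn X ^+ q *: X)
  (fun H X => sqn H * sqn X ^+ q) (2 * q.+1)%:R xpredT (ler0n _ _) card_gt0
  (fun _ _ => isT) (fun _ => isT) (fun X Y _ _ => sqn_pow_lip X Y q) psub.
rewrite (eq_bigr (fun w => sqn (csum A w) ^+ q.+1)); last by move=> w _; rewrite ipZr exprS mulrC.
set L := (X in X <= _) => h.
have : L <= \sum_(w : sample) (sqn (csum A w) ^+ q.+1 / 2 +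
    (2 * (2 * (2 * q.+1)%:R) * (S w + v)) ^+ q.+1).
  apply: le_trans h _; rewrite mulr_sumr; apply: ler_sum => w _.
  have -> : \sum_s (sqn (A s (w s)) * sqn (csum A w) ^+ q +
      N^-1 * (\sum_a sqn (A s a) * sqn (csum A w) ^+ q)) = (S w + v) * sqn (csum A w) ^+ q.
    rewrite big_split /= mulrDl; congr (_ + _); first by rewrite mulr_suml.
    rewrite -mulr_sumr /v -mulrA; congr (_ * _); rewrite mulr_suml.
    by apply: eq_bigr => s _; rewrite mulr_suml.
  by rewrite mulrA young_pow ?mulr_ge0 ?ler0n ?addr_ge0 ?sqn_ge0.
rewrite big_split /= -mulr_suml -/L.
under [X in _ <= _ + X]eq_bigr do rewrite exprMn.
rewrite -mulr_sumr => h2.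
have := @scalar_moment_le (fun s a => sqn (A s a)) beta (fun _ _ => sqn_ge0 _) hB q.+1 beta hv (lexx _).
move=> h3.
have c0 : 0 <= (2 * (2 * (2 * q.+1)%:R : R)) ^+ q.+1 by rewrite exprn_ge0 ?mulr_ge0 ?ler0n.
have := ler_wpM2l c0 h3 => {}h3.
have -> : M * vec_const q.+1 * beta ^+ q.+1 =
  2 * ((2 * (2 * (2 * q.+1)%:R)) ^+ q.+1 * (M * ((q.+1 + 2)%:R * beta) ^+ q.+1)).
  rewrite /vec_const !natrM !exprMn.
  have -> : (8 : R) ^+ q.+1 = 2 ^+ q.+1 * 2 ^+ q.+1 * 2 ^+ q.+1 by rewrite -!exprMn; congr (_ ^+ _); ring.
  ring.
lra.
Qed.

End Vector.
End SampleSums.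
End Moments.

(** * Real spectral theorem and singular values *)

Section Spectral.
Variable R : rcfType.

(** The complexified matrix has an eigenvector [x + i y] with eigenvalue [a + i b]. Comparing
    [ip (x *m A) y] with [ip x (y *m A)] gives [b = 0], so whichever of [x] and [y] is nonzero is a
    real eigenvector. *)
Lemma symmetric_eigenvector n (A : 'M[R]_n.+1) : A^T = A ->
  exists a (v : 'rV[R]_n.+1), v != 0 /\ v *m A = a *: v.
Proof.
move=> symA.
pose AC := map_mx (real_complex R) A.
have [l] : exists l, root (char_poly AC) l.
  by apply/closed_rootP; rewrite size_char_poly.
rewrite -eigenvalue_root_char => /eigenvalueP[v hv nzv].
pose x := map_mx (@complex.Re R) v; pose y := map_mx (@complex.Im R) v.
case: l hv => a b hv.
have hx : x *m A = a *: x - b *: y.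
  apply/rowP => j; have /(congr1 (@complex.Re R)) := congr1 (fun w : 'rV_n.+1 => w 0 j) hv.
  rewrite !mxE raddf_sum /= => h.
  have -> : a * complex.Re (v 0 j) - b * complex.Im (v 0 j) =
    complex.Re ((a +i* b)%C * v 0 j) by case: (v 0 j).
  rewrite -h; apply: eq_bigr => i _; rewrite !mxE.
  by case: (v 0 i) => ? ? /=; rewrite mulr0 subr0.
have hy : y *m A = b *: x + a *: y.
  apply/rowP => j; have /(congr1 (@complex.Im R)) := congr1 (fun w : 'rV_n.+1 => w 0 j) hv.
  rewrite !mxE raddf_sum /= => h.
  have -> : b * complex.Re (v 0 j) + a * complex.Im (v 0 j) =
    complex.Im ((a +i* b)%C * v 0 j) by case: (v 0 j) => ? ? /=; rewrite addrC.
  rewrite -h; apply: eq_bigr => i _; rewrite !mxE.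
  by case: (v 0 i) => ? ? /=; rewrite mulr0 add0r.
have nz : ~ (x = 0 /\ y = 0).
  case=> x0 y0; move/eqP: nzv; apply; apply/rowP => j; rewrite mxE.
  have := congr1 (fun w : 'rV_n.+1 => w 0 j) x0.
  have := congr1 (fun w : 'rV_n.+1 => w 0 j) y0.
  by rewrite !mxE; case: (v 0 j) => ? ? /= -> ->.
have b0 : b = 0.
  have : ip (x *m A) y = ip x (y *m A) by rewrite ip_mulr symA.
  rewrite hx hy ipBl ipDr !ipZl !ipZr => h.
  have {}h : b * (sqn x + sqn y) = 0 by rewrite /sqn; lra.
  move/eqP: h; rewrite mulf_eq0 => /orP[/eqP //|].
  rewrite paddr_eq0 ?sqn_ge0 // => /andP[/eqP/sqn_eq0 x0 /eqP/sqn_eq0 y0].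
  by case: nz.
move: hx hy; rewrite b0 !scale0r subr0 add0r => hx hy.
have [x0|nx] := eqVneq x 0; last by exists a, x.
exists a, y; split => //; apply/eqP => y0; exact: nz.
Qed.

(** The reflection exchanging [u] and the [k]-th basis vector. It divides by the squared norm of
    their difference, so the case of equality is treated apart. *)
Lemma householder n (k : 'I_n) (u : 'cV[R]_n) : sqn u = 1 ->
  exists Q : 'M[R]_n, Q^T *m Q = 1%:M /\ col k Q = u.
Proof.
move=> u1; pose e : 'cV[R]_n := delta_mx k 0.
have [ue|ne] := eqVneq u e.
  exists 1%:M; split; first by rewrite trmx1 mulmx1.
  by rewrite ue; apply/colP => i; rewrite !mxE eqxx andbT.
pose w := u - e.
have nw : sqn w != 0.
  by apply: contraNneq ne => /sqn_eq0/eqP; rewrite subr_eq0.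
have eT (z : 'cV[R]_n) : w^T *m z = (ip w z)%:M.
  by apply/matrixP => i j; rewrite !ord1 [RHS]mxE eqxx mulr1n ip_tr /mxtrace big_ord1.
have se : sqn e = 1 by rewrite /sqn ip_delta mxE !eqxx.
have hwe : ip w e = - sqn w / 2.
  by rewrite /sqn /w ipBr !ipBl (ipC e u) -!/(sqn _) u1 se; field.
exists (1%:M - (2 / sqn w) *: (w *m w^T)); split; last first.
  rewrite colE mulmxBl mul1mx -scalemxAl -mulmxA eT.
  rewrite mul_mx_scalar scalerA hwe.
  have -> : 2 / sqn w * (- sqn w / 2) = -1 by field.
  by rewrite scaleN1r opprK addrC subrK.
have -> : (1%:M - (2 / sqn w) *: (w *m w^T))^T = 1%:M - (2 / sqn w) *: (w *m w^T).
  by rewrite [LHS]linearB /= trmx1 linearZ /= trmx_mul trmxK.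
rewrite mulmxBl mul1mx mulmxBr mulmx1.
rewrite -scalemxAl -scalemxAr scalerA -mulmxA (mulmxA w^T) eT mul_scalar_mx -scalemxAr scalerA.
rewrite -[ip w w]/(sqn w).
have -> : 2 / sqn w * (2 / sqn w) * sqn w = 2 / sqn w + 2 / sqn w by field.
by rewrite scalerDl opprB addrK subrK.
Qed.

(** Deflation: a reflection taking the first basis vector to a unit eigenvector makes the conjugated
    matrix block diagonal, and induction applies to the lower block. *)
Lemma spectral_symmetric n (A : 'M[R]_n) : A^T = A ->
  exists (E : 'M[R]_n) (d : 'rV[R]_n),
    E^T *m E = 1%:M /\ A = E *m diag_mx d *m E^T.
Proof.
elim: n A => [|n IH] A symA.
  by exists 1%:M, 0; split; apply/matrixP => -[].
have [a [v [nzv hv]]] := symmetric_eigenvector symA.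
have sv : 0 < sqn v.
  by rewrite lt_def sqn_ge0 andbT; apply: contraNneq nzv => /sqn_eq0 ->.
pose u := ((Num.sqrt (sqn v))^-1 *: v)^T.
have su : sqn u = 1.
  by rewrite sqn_trmx sqnZ exprVn sqr_sqrtr ?sqn_ge0 // mulVf // gt_eqF.
have hu : A *m u = a *: u.
  have hvT : A *m v^T = a *: v^T by rewrite -linearZ /= -hv trmx_mul symA.
  by rewrite /u linearZ /= -scalemxAr hvT !scalerA mulrC.
have [Q [oQ cQ]] := householder 0 su.
have oQ' : Q *m Q^T = 1%:M by apply: mulmx1C.
have [B defB] : exists B : 'M[R]_(1 + n), B = Q^T *m A *m Q by exists (Q^T *m A *m Q).
have symB : B^T = B by rewrite defB !trmx_mul trmxK symA mulmxA.
have colB : col 0 B = a *: delta_mx 0 0.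
  rewrite defB -mulmxA colE -mulmxA -mulmxA -colE cQ hu -scalemxAr -cQ colE mulmxA oQ mul1mx //.
have dl0 : dlsubmx B = 0.
  apply/matrixP => i j; rewrite !ord1 mxE [RHS]mxE.
  have := congr1 (fun z : 'cV_(1 + n) => z (rshift 1 i) 0) colB; rewrite /= !mxE /= => h.
  have -> : lshift n 0 = 0 :> 'I_(1 + n) by apply: val_inj.
  by rewrite h /= mulr0.
have ur0 : ursubmx B = 0.
  by rewrite -[B]symB -trmx_dlsub dl0 trmx0.
have symD : (drsubmx B)^T = drsubmx B by rewrite trmx_drsub symB.
have [E [d [oE hE]]] := IH _ symD.
have ul : ulsubmx B = (B 0 0)%:M.
  by apply/matrixP => i j; rewrite !ord1 !mxE eqxx mulr1n; congr (B _ _); apply: val_inj.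
pose E1 : 'M[R]_(1 + n) := block_mx 1%:M 0 0 E.
have oE1 : E1^T *m E1 = 1%:M.
  rewrite /E1 tr_block_mx mulmx_block !trmx0 trmx1 !mulmx0 !mul0mx !mul1mx oE.
  by rewrite !addr0 !add0r -scalar_mx_block.
have hB : B = E1 *m diag_mx (row_mx (B 0 0)%:M d) *m E1^T.
  rewrite -[LHS]submxK dl0 ur0 ul hE /E1 diag_mx_row tr_block_mx !mulmx_block.
  rewrite !trmx0 trmx1 !mulmx0 !mul0mx !mul1mx !add0r !addr0 !mul0mx mulmx1.
  congr (block_mx _ _ _ _).
  by apply/matrixP => i j; rewrite !ord1 !mxE !eqxx.
exists (Q *m E1), (row_mx (B 0 0)%:M d); split.
  by rewrite trmx_mul mulmxA -(mulmxA _ Q^T) oQ mulmx1.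
rewrite trmx_mul mulmxA -(mulmxA Q) -(mulmxA Q) -hB defB.
by rewrite !mulmxA oQ' mul1mx -mulmxA oQ' mulmx1.
Qed.

End Spectral.

(** * Existence of the singular value decomposition *)

Section SVD.
Variable R : rcfType.

(** Deflation from both sides. A unit eigenvector [v] of [X^T *m X] with eigenvalue [s ^+ 2 > 0] and
    [u = s^-1 *: (X *m v)] satisfy [X *m v = s *: u] and [X^T *m u = s *: v], so two reflections
    split off the block [s]. *)
Lemma svd_exists m n (X : 'M[R]_(m, n)) :
  exists (U : 'M[R]_m) (D : 'M[R]_(m, n)) (V : 'M[R]_n),
  [/\ U^T *m U = 1%:M, V^T *m V = 1%:M,
     (forall (i : 'I_m) (j : 'I_n), nat_of_ord i <> nat_of_ord j -> D i j = 0),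
     (forall i j, 0 <= D i j) & X = U *m D *m V^T].
Proof.
have zero_svd m' n' : exists (U : 'M[R]_m') (D : 'M[R]_(m', n')) (V : 'M[R]_n'),
  [/\ U^T *m U = 1%:M, V^T *m V = 1%:M,
     (forall (i : 'I_m') (j : 'I_n'), nat_of_ord i <> nat_of_ord j -> D i j = 0),
     (forall i j, 0 <= D i j) & 0 = U *m D *m V^T].
  exists 1%:M, 0, 1%:M; rewrite !trmx1 !mulmx1 mulmx0.
  by split => // i j *; rewrite mxE.
elim: m n X => [|m IH] [|n] X.
- have -> : X = 0 by apply/matrixP => -[]. exact: zero_svd.
- have -> : X = 0 by apply/matrixP => -[]. exact: zero_svd.
- have -> : X = 0 by apply/matrixP => i []. exact: zero_svd.
have [->|nzX] := eqVneq X 0; first exact: zero_svd.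
have [|E [d [oE hE]]] := @spectral_symmetric R _ (X^T *m X); first by rewrite trmx_mul trmxK.
have oE' : E *m E^T = 1%:M by apply: mulmx1C.
have hcol j : (X^T *m X) *m col j E = d 0 j *: col j E.
  rewrite {1}hE -mulmxA colE (mulmxA E^T) oE mul1mx -mulmxA.
  rewrite (_ : diag_mx d *m delta_mx j 0 = d 0 j *: (delta_mx j 0 : 'cV_n.+1)) ?scalemxAr //.
  apply/matrixP => i k; rewrite !ord1 mul_diag_mx !mxE.
  by case: eqP => [->|]; rewrite ?mulr0.
have scol j : sqn (col j E) = 1.
  have := congr1 (fun M : 'M[R]_(n.+1) => M j j) oE; rewrite !mxE eqxx mulr1n => <-.
  by rewrite sqn_colE; apply: eq_bigr => i _; rewrite mxE expr2.
have hd j : d 0 j = sqn (X *m col j E).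
  by rewrite /sqn ip_mull mulmxA hcol ipZr -/(sqn _) scol mulr1.
(* The eigenvalues of [X^T *m X] sum to [sqn X], which is nonzero. *)
have [j nzj] : exists j, d 0 j != 0.
  apply/existsP; rewrite -negb_forall; apply: contra nzX => /forallP h.
  have d0 : d = 0 by apply/rowP => j; rewrite mxE; apply/eqP; exact: h.
  apply/eqP/sqn_eq0; rewrite /sqn ip_tr hE d0.
  by rewrite (_ : diag_mx 0 = 0) ?mulmx0 ?mul0mx ?mxtrace0 // linear0.
have dj0 : 0 < d 0 j by rewrite lt_def nzj hd sqn_ge0.
pose s := Num.sqrt (d 0 j); have s0 : 0 < s by rewrite sqrtr_gt0.
have s2 : s ^+ 2 = d 0 j by rewrite sqr_sqrtr ?ltW.
pose v := col j E; pose u := s^-1 *: (X *m v).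
have su : sqn u = 1 by rewrite sqnZ -hd exprVn s2 mulVf.
have hu : X *m v = s *: u by rewrite scalerA divff ?gt_eqF // scale1r.
have hv : X^T *m u = s *: v.
  by rewrite /u -scalemxAr mulmxA hcol scalerA -s2 expr2 mulKf ?gt_eqF.
have [Q1 [oQ1 cQ1]] := householder 0 su.
have [Q2 [oQ2 cQ2]] := householder 0 (scol j).
have oQ1' : Q1 *m Q1^T = 1%:M by apply: mulmx1C.
have oQ2' : Q2 *m Q2^T = 1%:M by apply: mulmx1C.
have [B defB] : exists B : 'M[R]_(1 + m, 1 + n), B = Q1^T *m X *m Q2.
  by exists (Q1^T *m X *m Q2).
have colB : col 0 B = s *: delta_mx 0 0.
  rewrite defB -mulmxA colE -mulmxA -mulmxA -colE cQ2 hu -scalemxAr -cQ1 colE mulmxA oQ1 mul1mx //.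
have rowB : col 0 B^T = s *: delta_mx 0 0.
  rewrite defB !trmx_mul trmxK colE -mulmxA -mulmxA -colE cQ1 hv -scalemxAr /v -cQ2 colE mulmxA oQ2 mul1mx //.
have dl0 : dlsubmx B = 0.
  apply/matrixP => i k; rewrite !ord1 mxE [RHS]mxE.
  have := congr1 (fun z : 'cV_(1 + m) => z (rshift 1 i) 0) colB; rewrite /= !mxE /= => h.
  have -> : lshift n 0 = 0 :> 'I_(1 + n) by apply: val_inj.
  by rewrite h /= mulr0.
have ur0 : ursubmx B = 0.
  apply/matrixP => i k; rewrite !ord1 mxE [RHS]mxE.
  have := congr1 (fun z : 'cV_(1 + n) => z (rshift 1 k) 0) rowB; rewrite /= !mxE /= => h.
  have -> : lshift m 0 = 0 :> 'I_(1 + m) by apply: val_inj.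
  by rewrite h /= mulr0.
have ul : ulsubmx B = s%:M.
  apply/matrixP => i k; rewrite !ord1 [RHS]mxE eqxx mulr1n.
  have := congr1 (fun z : 'cV_(1 + m) => z 0 0) colB; rewrite /= !mxE /= mulr1 => <-.
  by congr (B _ _); apply: val_inj.
have [U [D [V [oU oV dD D0 hB']]]] := IH _ (drsubmx B).
have orth1 k (W : 'M[R]_k) : W^T *m W = 1%:M ->
    (block_mx (1%:M : 'M[R]_1) 0 0 W)^T *m block_mx (1%:M : 'M[R]_1) 0 0 W = 1%:M.
  move=> oW; rewrite tr_block_mx mulmx_block !trmx0 trmx1 !mulmx0 !mul0mx !mul1mx oW.
  by rewrite !addr0 !add0r -scalar_mx_block.
pose U1 : 'M[R]_(1 + m) := block_mx 1%:M 0 0 U.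
pose V1 : 'M[R]_(1 + n) := block_mx 1%:M 0 0 V.
pose D1 : 'M[R]_(1 + m, 1 + n) := block_mx s%:M 0 0 D.
have hB : B = U1 *m D1 *m V1^T.
  rewrite -[LHS]submxK dl0 ur0 ul hB' /U1 /V1 /D1 tr_block_mx !mulmx_block.
  by rewrite !trmx0 trmx1 !mulmx0 !mul0mx !mul1mx !add0r !addr0 !mul0mx mulmx1.
exists (Q1 *m U1), D1, (Q2 *m V1); split.
- by rewrite trmx_mul mulmxA -(mulmxA _ Q1^T) oQ1 mulmx1 orth1.
- by rewrite trmx_mul mulmxA -(mulmxA _ Q2^T) oQ2 mulmx1 orth1.
- move=> i k; case: (@split_ordP 1 m i) => i' ->; case: (@split_ordP 1 n k) => k' -> ik.
  + by case: ik; rewrite !ord1.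
  + exact: etrans (block_mxEur _ _ _ _ _ _) (mxE _ _ _ _).
  + exact: etrans (block_mxEdl _ _ _ _ _ _) (mxE _ _ _ _).
  apply: etrans (block_mxEdr _ _ _ _ _ _) _.
  by apply: dD => e; apply: ik; rewrite /= e.
- move=> i k; case: (@split_ordP 1 m i) => i' ->; case: (@split_ordP 1 n k) => k' ->.
  + have -> : D1 (lshift m i') (lshift n k') = s.
      by rewrite /D1 block_mxEul !ord1 mxE eqxx mulr1n.
    exact: ltW.
  + by rewrite (etrans (block_mxEur _ _ _ _ _ _) (mxE _ _ _ _) : D1 _ _ = 0).
  + by rewrite (etrans (block_mxEdl _ _ _ _ _ _) (mxE _ _ _ _) : D1 _ _ = 0).
  by rewrite (block_mxEdr _ _ _ _ _ _ : D1 _ _ = _).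
rewrite trmx_mul mulmxA -(mulmxA Q1) -(mulmxA Q1) -hB defB.
by rewrite !mulmxA oQ1' mul1mx -mulmxA oQ2' mulmx1.
Qed.

End SVD.

(** * Powers and traces of symmetric matrices *)

Section MatrixPowers.
Variable R : rcfType.

Lemma spectral_pow n (E : 'M[R]_n) d k : E^T *m E = 1%:M ->
  (E *m diag_mx d *m E^T) ^+ k = E *m diag_mx (\row_j d 0 j ^+ k) *m E^T.
Proof.
move=> oE; have oE' : E *m E^T = 1%:M by apply: mulmx1C.
elim: k => [|k IH].
  rewrite expr0 (_ : diag_mx _ = 1%:M) ?mulmx1 ?oE' //.
  by apply/matrixP => i j; rewrite !mxE expr0.
rewrite exprS IH -[LHS]/(_ *m _) !mulmxA -(mulmxA _ E^T) oE mulmx1 -(mulmxA E).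
congr (_ *m _ *m _).
by apply/matrixP => i j; rewrite mul_mx_diag !mxE; case: eqP => [->|_]; rewrite ?mulr1n ?exprS // !mulr0n mul0r.
Qed.

Lemma trmx_exp n (A : 'M[R]_n) k : A^T = A -> (A ^+ k)^T = A ^+ k.
Proof.
move=> sA; elim: k => [|k IH]; first by rewrite !expr0 trmx1.
by rewrite {1}exprSr -[_ * A]/(_ *m A) trmx_mul sA IH exprS.
Qed.

Lemma tr_mul_spectral n (E Q : 'M[R]_n) (a b : 'rV[R]_n) :
  \tr ((E *m diag_mx a *m E^T) *m (Q *m diag_mx b *m Q^T)) =
  \sum_k \sum_l a 0 k * b 0 l * (E^T *m Q) k l ^+ 2.
Proof.
set W := E^T *m Q.
have -> : \tr ((E *m diag_mx a *m E^T) *m (Q *m diag_mx b *m Q^T)) =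
   \tr (diag_mx a *m (W *m diag_mx b *m W^T)).
  rewrite -!mulmxA mxtrace_mulC -!mulmxA /W trmx_mul trmxK !mulmxA //.
rewrite /mxtrace; apply: eq_bigr => k _.
rewrite mul_diag_mx mxE mxE mulr_sumr; apply: eq_bigr => l _.
by rewrite mul_mx_diag !mxE; ring.
Qed.

Lemma sum_sqr_orth n (W : 'M[R]_n) k : W *m W^T = 1%:M -> \sum_l W k l ^+ 2 = 1.
Proof.
move=> h; have := congr1 (fun M : 'M[R]_n => M k k) h; rewrite !mxE eqxx mulr1n => <-.
by apply: eq_bigr => i _; rewrite mxE expr2.
Qed.

(** Factoring out [a - b] leaves [(2 * q).+1] monomials of even degree [2 * q], each at most
    [a ^+ (2 * q) + b ^+ (2 * q)]. *)
Lemma odd_pow_lip (a b : R) q :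
  (a - b) * (a ^+ (2 * q).+1 - b ^+ (2 * q).+1) <=
  (2 * q).+1%:R * ((a - b) ^+ 2 * a ^+ (2 * q) + (a - b) ^+ 2 * b ^+ (2 * q)).
Proof.
rewrite subrXX mulrA -expr2 -mulrDr mulrCA; apply: ler_wpM2l; first exact: sqr_ge0.
have -> : (2 * q).+1%:R * (a ^+ (2 * q) + b ^+ (2 * q)) =
   \sum_(i < (2 * q).+1) (a ^+ (2 * q) + b ^+ (2 * q)).
  by rewrite mulr_natl sumr_const card_ord.
apply: ler_sum => i _.
have ev (x : R) : x ^+ (2 * q) = `|x| ^+ (2 * q) by rewrite -normrX ger0_norm // exprM exprn_ge0 ?sqr_ge0.
rewrite (ev a) (ev b); apply: le_trans (ler_norm _) _; rewrite normrM !normrX.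
have iq : ((2 * q).+1.-1 - i + i = 2 * q)%N by have := ltn_ord i; rewrite /=; lia.
have eb (x : R) : x ^+ (2 * q) = x ^+ ((2 * q).+1.-1 - i) * x ^+ i by rewrite -exprD iq.
have [h|h] := leP `|a| `|b|.
  apply: (@le_trans _ _ (`|b| ^+ (2 * q))); last by rewrite lerDr exprn_ge0.
  by rewrite [leRHS]eb ler_wpM2r ?exprn_ge0 // lerXn2r ?nnegrE.
apply: (@le_trans _ _ (`|a| ^+ (2 * q))); last by rewrite lerDl exprn_ge0.
by rewrite [leRHS]eb ler_wpM2l ?exprn_ge0 // lerXn2r ?nnegrE // ltW.
Qed.

(* In eigenbases of [A] and [B] all the traces become sums weighted by the squared
   overlaps of the eigenvectors, which reduces the claim to [odd_pow_lip]. *)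
Lemma matrix_pow_lip n (A B : 'M[R]_n) q : A^T = A -> B^T = B ->
  ip (A - B) (A ^+ (2 * q).+1 - B ^+ (2 * q).+1) <=
  (2 * q).+1%:R * (sqn ((A - B) *m A ^+ q) + sqn ((A - B) *m B ^+ q)).
Proof.
move=> sA sB.
have [E [a [oE hA]]] := spectral_symmetric sA.
have [Q [b [oQ hB]]] := spectral_symmetric sB.
have oE' : E *m E^T = 1%:M by apply: mulmx1C.
have oQ' : Q *m Q^T = 1%:M by apply: mulmx1C.
pose W := E^T *m Q.
pose T i j := \sum_k \sum_l a 0 k ^+ i * b 0 l ^+ j * W k l ^+ 2.
have hT i j : \tr (A ^+ i *m B ^+ j) = T i j.
  rewrite hA hB !spectral_pow // tr_mul_spectral; apply: eq_bigr => k _.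
  by apply: eq_bigr => l _; rewrite !mxE.
have hT' i j : \tr (B ^+ j *m A ^+ i) = T i j by rewrite mxtrace_mulC.
have hT0 i : \tr (A ^+ i) = T i 0 by rewrite -hT expr0 mulmx1.
have h0T i : \tr (B ^+ i) = T 0 i by rewrite -hT expr0 mul1mx.
have e1 : ip (A - B) (A ^+ (2 * q).+1 - B ^+ (2 * q).+1) =
    T (2 * q).+2 0 - T 1 (2 * q).+1 - T (2 * q).+1 1 + T 0 (2 * q).+2.
  have <- : \tr (A *m A ^+ (2 * q).+1) = T (2 * q).+2 0 by rewrite -hT0 [in RHS]exprS.
  have <- : \tr (A *m B ^+ (2 * q).+1) = T 1 (2 * q).+1 by rewrite -hT expr1.
  have <- : \tr (B *m A ^+ (2 * q).+1) = T (2 * q).+1 1 by rewrite -hT' expr1.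
  have <- : \tr (B *m B ^+ (2 * q).+1) = T 0 (2 * q).+2 by rewrite -h0T [in RHS]exprS.
  by rewrite ipBl !ipBr !ip_tr sA sB; ring.
have pw (X : 'M[R]_n) i j : X ^+ i *m X ^+ j = X ^+ (i + j) by rewrite exprD.
have sq (X Y : 'M[R]_n) : X^T = X -> Y^T = Y -> sqn ((X - Y) *m X ^+ q) =
   \tr (X ^+ (2 * q).+2) - 2 * \tr (X ^+ (2 * q).+1 *m Y ^+ 1) + \tr (X ^+ (2 * q) *m Y ^+ 2).
  move=> sX sY; rewrite /sqn ip_mulr trmx_exp // -mulmxA pw addnn -mul2n ip_tr.
  rewrite linearB /= sX sY.
  have -> : (X - Y) *m ((X - Y) *m X ^+ (2 * q)) =
     X ^+ (2 * q).+2 - X *m (Y *m X ^+ (2 * q)) - Y ^+ 1 *m X ^+ (2 * q).+1 + Y ^+ 2 *m X ^+ (2 * q).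
    rewrite [in RHS]exprS [in RHS]exprS expr1 expr2.
    rewrite -![X * _]/(X *m _) -![Y * _]/(Y *m _) !mulmxBl !mulmxBr -mulmxA opprB addrA.
    by rewrite [RHS]addrAC [RHS]addrC addrC -!addrA; congr (_ + _); rewrite addrCA.
  rewrite linearD /= !linearB /= [\tr (X *m (Y *m _))]mxtrace_mulC -mulmxA.
  have -> : X ^+ (2 * q) *m X = X ^+ (2 * q).+1 by rewrite exprSr.
  rewrite expr1 !(mxtrace_mulC Y) (mxtrace_mulC (Y ^+ 2)). 
  by move: (\tr (X ^+ _.+2)) (\tr (_ *m Y)) (\tr (_ *m Y ^+ 2)) => t1 t2 t3; ring.
have e2 : sqn ((A - B) *m A ^+ q) = T (2 * q).+2 0 - 2 * T (2 * q).+1 1 + T (2 * q)%N 2.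
  by rewrite sq // !hT hT0.
have e3 : sqn ((A - B) *m B ^+ q) = T 0 (2 * q).+2 - 2 * T 1 (2 * q).+1 + T 2 (2 * q)%N.
  by rewrite -sqnN -mulNmx opprB sq // !hT' h0T.
rewrite e1 e2 e3 /T.
have -> : \sum_k \sum_l a 0 k ^+ (2 * q).+2 * b 0 l ^+ 0 * W k l ^+ 2 -
  \sum_k \sum_l a 0 k ^+ 1 * b 0 l ^+ (2 * q).+1 * W k l ^+ 2 -
  \sum_k \sum_l a 0 k ^+ (2 * q).+1 * b 0 l ^+ 1 * W k l ^+ 2 +
  \sum_k \sum_l a 0 k ^+ 0 * b 0 l ^+ (2 * q).+2 * W k l ^+ 2 =
  \sum_k \sum_l (a 0 k - b 0 l) * (a 0 k ^+ (2 * q).+1 - b 0 l ^+ (2 * q).+1) * W k l ^+ 2.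
  rewrite -!sumrB -big_split; apply: eq_bigr => k _ /=.
  rewrite -!sumrB -big_split; apply: eq_bigr => l _ /=.
  by rewrite !expr0 !expr1 ![_ ^+ (2 * q).+2]exprS; ring.
have -> : \sum_k \sum_l a 0 k ^+ (2 * q).+2 * b 0 l ^+ 0 * W k l ^+ 2 -
  2 * (\sum_k \sum_l a 0 k ^+ (2 * q).+1 * b 0 l ^+ 1 * W k l ^+ 2) +
  \sum_k \sum_l a 0 k ^+ (2 * q) * b 0 l ^+ 2 * W k l ^+ 2 +
  (\sum_k \sum_l a 0 k ^+ 0 * b 0 l ^+ (2 * q).+2 * W k l ^+ 2 -
  2 * (\sum_k \sum_l a 0 k ^+ 1 * b 0 l ^+ (2 * q).+1 * W k l ^+ 2) +
  \sum_k \sum_l a 0 k ^+ 2 * b 0 l ^+ (2 * q) * W k l ^+ 2) =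
  \sum_k \sum_l ((a 0 k - b 0 l) ^+ 2 * a 0 k ^+ (2 * q) + (a 0 k - b 0 l) ^+ 2 * b 0 l ^+ (2 * q)) * W k l ^+ 2.
  rewrite !mulr_sumr -!sumrB -!big_split; apply: eq_bigr => k _ /=.
  rewrite !mulr_sumr -!sumrB -!big_split; apply: eq_bigr => l _ /=.
  by rewrite !expr0 !expr1 ![_ ^+ (2 * q).+2]exprS ![_ ^+ (2 * q).+1]exprS; ring.
rewrite mulr_sumr; apply: ler_sum => k _; rewrite mulr_sumr; apply: ler_sum => l _.
by rewrite mulrA ler_wpM2r ?sqr_ge0 // odd_pow_lip.
Qed.

(** All eigenvalues contribute nonnegative even powers to the trace, so each of them separately is
    at most [tau]. *)
Lemma trace_pow_bound n (X : 'M[R]_n) q (tau : R) : X^T = X -> 0 <= tau ->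
  \tr (X ^+ (2 * q.+1)) <= tau ^+ (2 * q.+1) -> forall z : 'cV[R]_n, ip z (X *m z) <= tau * sqn z.
Proof.
move=> sX tau0 h z.
have [E [x [oE hX]]] := spectral_symmetric sX.
have oE' : E *m E^T = 1%:M by apply: mulmx1C.
have ev j : 0 <= x 0 j ^+ (2 * q.+1) by rewrite exprM exprn_ge0 ?sqr_ge0.
have hx j : x 0 j <= tau.
  have {}h : x 0 j ^+ (2 * q.+1) <= tau ^+ (2 * q.+1).
    apply: le_trans h; rewrite hX spectral_pow // mxtrace_mulC mulmxA oE mul1mx.
    rewrite mxtrace_diag (bigD1 j) //= mxE lerDl; apply: sumr_ge0 => i _.
    by rewrite mxE ev.
  have [x0|x0] := leP (x 0 j) 0; first exact: le_trans x0 tau0.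
  by rewrite -(ler_pXn2r (n := 2 * q.+1)) ?nnegrE ?muln_gt0 // ltW.
pose y := E^T *m z.
have -> : sqn z = sqn y by rewrite /sqn /y ip_mull trmxK mulmxA oE' mul1mx.
have -> : ip z (X *m z) = ip y (diag_mx x *m y).
  by rewrite hX /y ip_mull trmxK !mulmxA.
rewrite /sqn -ipZr /ip; apply: ler_sum => i _; apply: ler_sum => j _.
rewrite mul_diag_mx !mxE [x 0 i * _]mulrC [tau * _]mulrC !mulrA ler_wpM2l //.
by rewrite -expr2 sqr_ge0.
Qed.

End MatrixPowers.

(** * Moments of sums of independent symmetric matrices *)

Section MatrixMoment.
Variable R : rcfType.

(** In an eigenbasis [E], the trace and the squared row norms are both sums against the weights
    [E i j ^+ 2]. These sum to one over [j], so [young_pow] can be applied to each pair [(i, j)]. *)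
Lemma young_spectral n (X : 'M[R]_n) (K : R) (g : 'I_n -> R) q : X^T = X -> 0 <= K ->
  (forall i, 0 <= g i) ->
  K * \sum_i g i * sqn (row i (X ^+ q)) <=
  \tr (X ^+ (2 * q.+1)) / 2 + \sum_i (2 * K * g i) ^+ q.+1.
Proof.
move=> sX K0 g0.
have [E [x [oE hX]]] := spectral_symmetric sX.
have oE' : E *m E^T = 1%:M by apply: mulmx1C.
have hrow i : sqn (row i (X ^+ q)) = \sum_j E i j ^+ 2 * (x 0 j ^+ 2) ^+ q.
  have -> : sqn (row i (X ^+ q)) = (X ^+ q *m X ^+ q) i i.
    rewrite sqn_rowE mxE; apply: eq_bigr => j _.
    by rewrite -{3}(trmx_exp q sX) [_^T j i]mxE expr2.
  rewrite -[_ *m _]/(_ * _) -exprD addnn -mul2n hX spectral_pow // mxE.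
  by apply: eq_bigr => j _; rewrite mul_mx_diag !mxE -exprM; ring.
have htr : \tr (X ^+ (2 * q.+1)) = \sum_i \sum_j E i j ^+ 2 * (x 0 j ^+ 2) ^+ q.+1.
  rewrite hX spectral_pow // mxtrace_mulC mulmxA oE mul1mx mxtrace_diag exchange_big.
  apply: eq_bigr => j _; rewrite -mulr_suml mxE -exprM.
  have := @sum_sqr_orth R _ E^T j; rewrite trmxK => /(_ oE).
  by under eq_bigr do rewrite mxE; move=> ->; rewrite mul1r.
rewrite htr mulr_suml mulr_sumr -big_split; apply: ler_sum => i _ /=.
have -> : (2 * K * g i) ^+ q.+1 = \sum_j E i j ^+ 2 * (2 * K * g i) ^+ q.+1.
  by rewrite -mulr_suml sum_sqr_orth // mul1r.
rewrite hrow mulr_suml -big_split.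
rewrite mulrA mulr_sumr; apply: ler_sum => j _ /=.
rewrite mulrCA -[X in _ <= X + _]mulrA -mulrDr ler_wpM2l ?sqr_ge0 //.
exact: young_pow (sqr_ge0 _).
Qed.

Variables (I : finType) (m d : nat) (A : 'I_m -> I -> 'M[R]_d) (e : 'I_m -> I -> 'I_d -> R).
Notation sample := {ffun 'I_m -> I}.
Notation M := (#|{: sample}|%:R : R).
Notation N := (#|I|%:R : R).
Hypothesis card_gt0 : (0 < #|I|)%N.
Hypothesis symA : forall s a, (A s a)^T = A s a.
Hypothesis e_ge0 : forall s a i, 0 <= e s a i.
(* [A s a ^+ 2] is diagonal with entries [e s a]. *)
Hypothesis sqA : forall s a (Y : 'M[R]_d), sqn (A s a *m Y) = \sum_i e s a i * sqn (row i Y).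

(** As [vec_const], with a factor [d] because Young's inequality is summed over the [d]
    coordinates. *)
Definition mat_const (p d : nat) : R := 2 * d%:R * ((8 * p * (p + 2))%:R) ^+ p.

Lemma csum_sym w : (csum A w)^T = csum A w.
Proof.
rewrite /csum linear_sum; apply: eq_bigr => s _.
rewrite linearB linearZ linear_sum /= symA; congr (_ - _ *: _).
by apply: eq_bigr.
Qed.

(** The argument of [vector_moment] for trace moments. As the summands have diagonal squares, the
    variance term splits into one scalar sum [S i w] per coordinate, each controlled by
    [scalar_moment_le]. *)
Lemma matrix_moment q beta :
  (forall s a i, e s a i <= beta) ->
  (forall i, N^-1 * \sum_s \sum_a e s a i <= beta) ->
  \sum_(w : sample) \tr (csum A w ^+ (2 * q.+1)) <= M * mat_const q.+1 d * beta ^+ q.+1.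
Proof.
move=> hB hv.
have N0 : 0 < N by rewrite ltr0n.
pose v i := N^-1 * \sum_s \sum_a e s a i.
pose S i := fun w : sample => \sum_s e s (w s) i.
pose K : R := (2 * q).+1%:R.
have v0 i : 0 <= v i.
  rewrite mulr_ge0 ?invr_ge0 ?(ltW N0) // sumr_ge0 // => s _.
  by rewrite sumr_ge0.
have S0 i w : 0 <= S i w by rewrite sumr_ge0.
have psub (G H X : 'M[R]_d) : G^T == G -> H^T == H -> X^T == X ->
    sqn ((G - H) *m X ^+ q) <= 2 * sqn (G *m X ^+ q) + 2 * sqn (H *m X ^+ q).
  by move=> *; rewrite mulmxBl sqnB_le.
have flip (X Y : 'M[R]_d) : X^T == X -> Y^T == Y ->
   ip (X - Y) (X ^+ (2 * q).+1 - Y ^+ (2 * q).+1) <=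
   K * (sqn ((X - Y) *m X ^+ q) + sqn ((X - Y) *m Y ^+ q)).
  by move=> /eqP sX /eqP sY; apply: matrix_pow_lip.
have := @exchangeable_pair_bound R I m d d A (fun X => X ^+ (2 * q).+1)
  (fun H X => sqn (H *m X ^+ q)) K (fun X => X^T == X) (ler0n _ _) card_gt0
  (fun s a => introT eqP (symA s a)) (fun w => introT eqP (csum_sym w)) flip psub.
rewrite (eq_bigr (fun w => \tr (csum A w ^+ (2 * q.+1)))); last first.
  by move=> w _; rewrite ip_tr csum_sym -[_ *m _]/(_ * _) -exprS mulnS.
set L := (X in X <= _) => h.
have {h} : L <= \sum_(w : sample) (\tr (csum A w ^+ (2 * q.+1)) / 2 +
    \sum_i (2 * (2 * K) * (S i w + v i)) ^+ q.+1).
  apply: le_trans h _; rewrite mulr_sumr; apply: ler_sum => w _.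
  have -> : \sum_s (sqn (A s (w s) *m csum A w ^+ q) +
      N^-1 * (\sum_a sqn (A s a *m csum A w ^+ q))) =
      \sum_i (S i w + v i) * sqn (row i (csum A w ^+ q)).
    rewrite big_split /=; under [RHS]eq_bigr do rewrite mulrDl.
    rewrite big_split /=; congr (_ + _).
      under eq_bigr do rewrite sqA.
      by rewrite exchange_big; apply: eq_bigr => i _; rewrite mulr_suml.
    rewrite -mulr_sumr; under [RHS]eq_bigr do rewrite -mulrA.
    rewrite -mulr_sumr; congr (_ * _).
    under eq_bigr do under eq_bigr do rewrite sqA.
    under eq_bigr do rewrite exchange_big; rewrite exchange_big /=.
    by apply: eq_bigr => i _; rewrite mulr_suml; apply: eq_bigr => s _; rewrite mulr_suml.
  apply: young_spectral; rewrite ?csum_sym ?mulr_ge0 ?ler0n // => i.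
  by rewrite addr_ge0.
rewrite big_split /= -mulr_suml -/L exchange_big /=.
set Q := (X in L / 2 + X) => h2.
have h3 : Q <= d%:R * ((2 * (2 * K)) ^+ q.+1 * (M * ((q.+1 + 2)%:R * beta) ^+ q.+1)).
  rewrite -[d in d%:R]card_ord mulr_natl -sumr_const; apply: ler_sum => i _.
  under eq_bigr do rewrite exprMn.
  rewrite -mulr_sumr ler_wpM2l ?exprn_ge0 ?mulr_ge0 ?ler0n //.
  by apply: (@scalar_moment_le _ _ _ card_gt0 (fun s a => e s a i) beta).
have [d0|d0] := posnP d.
  move: h3; rewrite d0 mul0r /mat_const mulr0 mul0r mulr0 mul0r => h3.
  by clear -h2 h3; lra.
have beta0 : 0 <= beta by apply: le_trans (v0 (Ordinal d0)) (hv _).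
have h4 : (2 * (2 * K)) ^+ q.+1 * (M * ((q.+1 + 2)%:R * beta) ^+ q.+1) <=
   M * (8 * q.+1 * (q.+1 + 2))%:R ^+ q.+1 * beta ^+ q.+1.
  have -> : (2 * (2 * K)) ^+ q.+1 * (M * ((q.+1 + 2)%:R * beta) ^+ q.+1) =
     M * (2 * (2 * K) * (q.+1 + 2)%:R) ^+ q.+1 * beta ^+ q.+1 by rewrite !exprMn; ring.
  rewrite ler_wpM2r ?exprn_ge0 // ler_wpM2l ?ler0n // lerXn2r ?nnegrE ?mulr_ge0 ?ler0n //.
  rewrite [leRHS]natrM ler_wpM2r ?ler0n // /K -!natrM ler_nat; lia.
have h5 := ler_wpM2l (ler0n R d) h4.
have h6 := le_trans h3 h5.
rewrite /mat_const; clear -h2 h6.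
move: h6; set Z := _ ^+ q.+1; set B := beta ^+ _ => h6.
have -> : M * (2 * d%:R * Z) * B = 2 * (d%:R * (M * Z * B)) by ring.
lra.
Qed.

End MatrixMoment.

(** * One golfing step *)

Section DeltaProducts.
Variable R : pzRingType.

Lemma mulmx_delta m n p (P : 'M[R]_(m, n)) i (j : 'I_p) a b :
  (P *m delta_mx i j) a b = P a i * (j == b)%:R.
Proof.
rewrite mxE (bigD1 i) //= big1 ?addr0 => [|l /negPf nl].
  by rewrite mxE eqxx eq_sym.
by rewrite mxE nl mulr0.
Qed.

Lemma delta_mulmx m n p (Q : 'M[R]_(n, p)) (i : 'I_m) j a b :
  (delta_mx i j *m Q) a b = (a == i)%:R * Q j b.
Proof.
rewrite mxE (bigD1 j) //= big1 ?addr0 => [|l /negPf nl].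
  by rewrite mxE eqxx andbT.
by rewrite mxE nl andbF mul0r.
Qed.

Lemma mulmx_delta_mulmx m n p q (P : 'M[R]_(m, n)) (Q : 'M[R]_(p, q)) i j a b :
  (P *m delta_mx i j *m Q) a b = P a i * Q j b.
Proof.
rewrite mxE (bigD1 j) //= big1 ?addr0 => [|l /negPf nl].
  by rewrite mulmx_delta eqxx mulr1.
by rewrite mulmx_delta eq_sym nl mulr0 mul0r.
Qed.

End DeltaProducts.

(** * The projection onto the tangent space *)

Section TangentSpace.
Variables (R : rcfType) (n1 n2 r : nat).

Definition tanproj (U : 'M[R]_(n1, r)) (V : 'M[R]_(n2, r)) (X : 'M[R]_(n1, n2)) : 'M[R]_(n1, n2) :=
  U *m U^T *m X + X *m (V *m V^T) - U *m U^T *m X *m (V *m V^T).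

Variables (U : 'M[R]_(n1, r)) (V : 'M[R]_(n2, r)).
Notation PT := (tanproj U V).

Lemma tanproj_is_linear : linear PT.
Proof.
move=> a X Y; rewrite /tanproj !mulmxDr !mulmxDl -!scalemxAr -!scalemxAl.
by rewrite scalerBr scalerDr opprD [RHS]addrACA; congr (_ + _); rewrite addrACA.
Qed.
HB.instance Definition _ := GRing.isLinear.Build R _ _ *:%R PT tanproj_is_linear.

Hypotheses (oU : U^T *m U = 1%:M) (oV : V^T *m V = 1%:M).

Let PU := U *m U^T.
Let PV := V *m V^T.

Lemma proj_idem n (W : 'M[R]_(n, r)) : W^T *m W = 1%:M -> (W *m W^T) *m (W *m W^T) = W *m W^T.
Proof. by move=> oW; rewrite mulmxA -(mulmxA W) oW mulmx1. Qed.

Lemma proj_sym n (W : 'M[R]_(n, r)) : (W *m W^T)^T = W *m W^T.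
Proof. by rewrite trmx_mul trmxK. Qed.

Lemma tanproj_perp X : X - PT X = (1%:M - PU) *m X *m (1%:M - PV).
Proof.
rewrite mulmxBr mulmx1 mulmxBl mul1mx mulmxBl /tanproj -/PU -/PV.
by rewrite -[X in _ - X = _]addrA opprD addrA.
Qed.

Lemma tanproj_selfadj X Y : ip (PT X) Y = ip X (PT Y).
Proof.
rewrite /tanproj !ipBl !ipDl !ipBr !ipDr -/PU -/PV.
rewrite !(ip_mulr _ PV) !(ip_mull PU) !proj_sym.
by rewrite -[PU *m Y *m PV]mulmxA.
Qed.

Lemma tanproj_UX (A : 'M[R]_(r, n2)) : PT (U *m A) = U *m A.
Proof.
by rewrite /tanproj !mulmxA -(mulmxA U) oU mulmx1 addrK.
Qed.

Lemma tanproj_XV (A : 'M[R]_(n1, r)) : PT (A *m V^T) = A *m V^T.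
Proof.
rewrite /tanproj -!(mulmxA A) -!mulmxA (mulmxA V^T) oV mul1mx.
by rewrite addrAC subrr add0r.
Qed.

Lemma tanproj_idem X : PT (PT X) = PT X.
Proof.
have -> : PT X = U *m (U^T *m X) + (X *m V - U *m (U^T *m X *m V)) *m V^T.
  by rewrite /tanproj -addrA mulmxBl !mulmxA.
by rewrite linearD /= tanproj_UX tanproj_XV.
Qed.

Lemma proj_diag n (W : 'M[R]_(n, r)) i : (W *m W^T) i i = sqn (row i W).
Proof. by rewrite sqn_rowE mxE; apply: eq_bigr => k _; rewrite !mxE expr2. Qed.

Lemma proj_sqr_sum n (W : 'M[R]_(n, r)) i : W^T *m W = 1%:M ->
  \sum_k (W *m W^T) i k ^+ 2 = sqn (row i W).
Proof.
move=> oW; rewrite -proj_diag -[in RHS](proj_idem oW) [RHS]mxE; apply: eq_bigr => k _.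
by rewrite expr2; congr (_ * _); rewrite -[in LHS](proj_sym W) [LHS]mxE.
Qed.

(** Row [i] of the projected basis matrix is [PU i i'] times the part of [e_j'] orthogonal to the
    range of [V], plus, when [i = i'], the part of [e_j'] in that range. The two parts are
    orthogonal, so their squared norms add. *)
Lemma row_proj_delta i i' j' :
  sqn (row i (PT (delta_mx i' j'))) =
  PU i i' ^+ 2 * (1 - sqn (row j' V)) + (i == i')%:R * sqn (row j' V).
Proof.
have PVd j : \sum_k PV j k ^+ 2 = PV j j by rewrite proj_sqr_sum // proj_diag.
have E k : PT (delta_mx i' j') i k = PU i i' * ((j' == k)%:R - PV j' k) + (i == i')%:R * PV j' k.
  have -> : PT (delta_mx i' j') i k =
     (PU *m delta_mx i' j') i k + (delta_mx i' j' *m PV) i k - (PU *m delta_mx i' j' *m PV) i k.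
    by rewrite /tanproj !mxE.
  by rewrite mulmx_delta delta_mulmx mulmx_delta_mulmx; ring.
rewrite sqn_rowE; under eq_bigr do rewrite E.
rewrite -proj_diag -/PV -PVd.
have -> : PU i i' ^+ 2 * (1 - \sum_k PV j' k ^+ 2) = PU i i' ^+ 2 * \sum_k ((j' == k)%:R - PV j' k) ^+ 2.
  congr (_ * _).
  have -> : \sum_k ((j' == k)%:R - PV j' k) ^+ 2 =
     \sum_k ((j' == k)%:R * (1 - 2 * PV j' k) + PV j' k ^+ 2).
    apply: eq_bigr => k _; case: eqP => _ /=; ring.
  rewrite big_split /= [X in _ = X + _](bigD1 j') //= [X in _ = _ + X + _]big1 => [|k /negPf nk].
    by rewrite eqxx PVd /=; ring.
  by rewrite eq_sym nk mul0r.

have cross : \sum_k ((j' == k)%:R - PV j' k) * PV j' k = 0.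
  under eq_bigr do rewrite mulrBl -expr2.
  rewrite sumrB PVd (bigD1 j') //= eqxx mul1r big1 ?addr0 ?subrr // => k /negPf nk.
  by rewrite eq_sym nk mul0r.
case: (i == i'); rewrite ?mul0r ?mul1r ?addr0.
  have -> : \sum_k (PU i i' * ((j' == k)%:R - PV j' k) + 1 * PV j' k) ^+ 2 =
     PU i i' ^+ 2 * \sum_k ((j' == k)%:R - PV j' k) ^+ 2 +
     2 * PU i i' * (\sum_k ((j' == k)%:R - PV j' k) * PV j' k) + \sum_k PV j' k ^+ 2.
    rewrite !mulr_sumr -!big_split; apply: eq_bigr => k _ /=.
    by move: (j' == k)%:R (PU i i') (PV j' k) => x y z; ring.
  by rewrite cross mulr0 addr0.
by under eq_bigr do rewrite mul0r addr0 exprMn; rewrite mulr_sumr.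
Qed.

End TangentSpace.

(** * Symmetric dilation and operator norm *)

Section Dilation.
Variables (R : rcfType) (n1 n2 : nat).

Definition dil (E : 'M[R]_(n1, n2)) : 'M[R]_(n1 + n2) := block_mx 0 E E^T 0.

Lemma dil_is_linear : linear dil.
Proof.
by move=> a X Y; rewrite /dil scale_block_mx add_block_mx !scaler0 !addr0 linearP.
Qed.
HB.instance Definition _ := GRing.isLinear.Build R _ _ *:%R dil dil_is_linear.

Lemma dil_sym E : (dil E)^T = dil E.
Proof. by rewrite /dil tr_block_mx !trmx0 trmxK. Qed.

(** The diagonal of the square of [dil (delta_mx i j)]: the projection onto coordinate [i] of the
    first block and coordinate [j] of the second. *)
Definition dil_weight (i : 'I_n1) (j : 'I_n2) (k : 'I_(n1 + n2)) : R :=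
  match fintype.split k with inl i' => (i' == i)%:R | inr j' => (j' == j)%:R end.

Lemma dil_weight_l i j i' : dil_weight i j (lshift n2 i') = (i' == i)%:R.
Proof. by rewrite /dil_weight (unsplitK (inl _)). Qed.

Lemma dil_weight_r i j j' : dil_weight i j (rshift n1 j') = (j' == j)%:R.
Proof. by rewrite /dil_weight (unsplitK (inr _)). Qed.

Lemma dil_weight_ge0 i j k : 0 <= dil_weight i j k.
Proof. by rewrite /dil_weight; case: fintype.split => ?; rewrite ler0n. Qed.

Lemma dil_weight_le1 i j k : dil_weight i j k <= 1.
Proof. by rewrite /dil_weight; case: fintype.split => ?; case: eqP; rewrite ?ler01. Qed.

Lemma sqn_dil_delta i j d (Y : 'M[R]_(n1 + n2, d)) :
  sqn (dil (delta_mx i j) *m Y) = \sum_k dil_weight i j k * sqn (row k Y).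
Proof.
rewrite -[Y]vsubmxK; set Y1 := usubmx Y; set Y2 := dsubmx Y.
rewrite /dil mul_block_col !mul0mx add0r addr0 trmx_delta.
have sqn_delta (m n p : nat) (k : 'I_m) (l : 'I_n) (Z : 'M[R]_(n, p)) :
    sqn (delta_mx k l *m Z) = sqn (row l Z).
  rewrite sqn_row (bigD1 k) //= big1 ?addr0 => [|k' /negPf nk].
    rewrite !sqn_rowE; apply: eq_bigr => b _; by rewrite delta_mulmx eqxx mul1r.
  by rewrite sqn_rowE big1 // => b _; rewrite delta_mulmx nk mul0r expr0n.
rewrite sqn_row !big_split_ord /=.
under eq_bigr do rewrite rowKu; under [X in _ + X = _]eq_bigr do rewrite rowKd.
rewrite -!sqn_row !sqn_delta addrC; congr (_ + _).
  rewrite (bigD1 j) //= big1 ?addr0 => [|j' /negPf nj].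
    by rewrite dil_weight_r eqxx mul1r rowKd.
  by rewrite dil_weight_r nj mul0r.
rewrite (bigD1 i) //= big1 ?addr0 => [|i' /negPf ni].
  by rewrite dil_weight_l eqxx mul1r rowKu.
by rewrite dil_weight_l ni mul0r.
Qed.

Lemma tr_even_ge0 n (X : 'M[R]_n) k : X^T = X -> 0 <= \tr (X ^+ (2 * k)).
Proof.
move=> sX; rewrite mul2n -addnn exprD -{1}(trmx_exp k sX) -[_ * _]/(_ *m _) -ip_tr.
exact: sqn_ge0.
Qed.

(* [opn_le W c]: the operator norm of [W] is at most [c] (for [c >= 0]). *)
Definition opn_le (W : 'M[R]_(n1, n2)) (c : R) :=
  forall (x : 'cV[R]_n1) (y : 'cV[R]_n2), 2 * ip x (W *m y) <= c * (sqn x + sqn y).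

(** The quadratic form of [dil W] at [col_mx x y] is [2 * ip x (W *m y)]. *)
Lemma dil_opn (W : 'M[R]_(n1, n2)) q tau : 0 <= tau ->
  \tr (dil W ^+ (2 * q.+1)) <= tau ^+ (2 * q.+1) -> opn_le W tau.
Proof.
move=> tau0 h x y.
have := trace_pow_bound (dil_sym W) tau0 h (col_mx x y).
rewrite /dil mul_block_col !mul0mx add0r addr0.
have ipcol (a c : 'cV[R]_n1) (b e : 'cV[R]_n2) : ip (col_mx a b) (col_mx c e) = ip a c + ip b e.
  rewrite /ip big_split_ord /=; congr (_ + _); apply: eq_bigr => i _; rewrite !big_ord1.
    by rewrite !col_mxEu.
  by rewrite !col_mxEd.
rewrite {1}/sqn !ipcol -!/(sqn _) (ipC y) ip_mull trmxK; lra.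
Qed.

End Dilation.

(** * Concentration of the rescaled sampling operator *)

Section GolfingStep.
Variables (R : rcfType) (n1 n2 m0 : nat).
Notation I := ('I_n1 * 'I_n2)%type.
Notation batch := {ffun 'I_m0 -> I}.
Notation M := (#|{: batch}|%:R : R).
Hypotheses (n1_gt0 : (0 < n1)%N) (n2_gt0 : (0 < n2)%N) (m0_gt0 : (0 < m0)%N).

Definition gam : R := (n1 * n2)%:R / m0%:R.

(** Repeated positions count with multiplicity, so that the [m0] terms are independent; the factor
    [gam] makes the average over [w] equal to [Z]. *)
Definition samp (w : batch) (Z : 'M[R]_(n1, n2)) : 'M[R]_(n1, n2) :=
  \sum_s (gam * Z (w s).1 (w s).2) *: delta_mx (w s).1 (w s).2.

Lemma gam_gt0 : 0 < gam.
Proof. by rewrite divr_gt0 // ltr0n ?muln_gt0 ?n1_gt0. Qed.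

Lemma cardI : (#|{: I}| = n1 * n2)%N.
Proof. by rewrite card_prod !card_ord. Qed.

Lemma cardI_gt0 : (0 < #|{: I}|)%N.
Proof. by rewrite cardI muln_gt0 n1_gt0. Qed.

Lemma sum_pair (F : I -> R) : \sum_a F a = \sum_i \sum_j F (i, j).
Proof. by rewrite pair_big /=; apply: eq_bigr => -[]. Qed.

Definition summand (Z : 'M[R]_(n1, n2)) (s : 'I_m0) (a : I) : 'M[R]_(n1, n2) :=
  (gam * Z a.1 a.2) *: delta_mx a.1 a.2.

Lemma csum_summand Z w : csum (summand Z) w = samp w Z - Z.
Proof.
rewrite /csum sumrB; congr (_ - _).
have hs s : \sum_(a : I) summand Z s a = gam *: Z.
  rewrite [in RHS](matrix_sum_delta Z) pair_big scaler_sumr.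
  by apply: eq_bigr => a _; rewrite /summand scalerA.
rewrite (eq_bigr (fun=> (#|{: I}|%:R)^-1 *: (gam *: Z))) => [|s _]; last by rewrite hs.
rewrite sumr_const card_ord cardI scalerA -[_ *+ _]scaler_nat scalerA /gam.
have H : (n1 * n2)%:R != 0 :> R by rewrite pnatr_eq0 -lt0n muln_gt0 n1_gt0.
have H0 : m0%:R != 0 :> R by rewrite pnatr_eq0 -lt0n.
rewrite (_ : m0%:R * _ = 1) ?scale1r //.
by move: (_ %:R) (m0%:R : R) H H0 => x y x0 y0; field; apply/andP.
Qed.

Lemma csum_linear d1 d2 (L : {linear 'M[R]_(n1, n2) -> 'M[R]_(d1, d2)})
  (A : 'I_m0 -> I -> 'M[R]_(n1, n2)) (w : batch) :
  csum (fun s a => L (A s a)) w = L (csum A w).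
Proof.
rewrite /csum linear_sum; apply: eq_bigr => s _.
rewrite [RHS]linearB; congr (_ - _).
by rewrite [RHS]linearZ; congr (_ *: _); rewrite [RHS]linear_sum.
Qed.

(** [L] is the quantity under observation: the tangent projection, possibly followed by taking an
    entry, a row or a column. The two hypotheses bound the size of one summand and the total
    variance. *)
Lemma vec_step d1 d2 (L : {linear 'M[R]_(n1, n2) -> 'M[R]_(d1, d2)}) (Z : 'M[R]_(n1, n2)) (beta t : R) (q : nat) :
  0 < t ->
  (forall i j, gam ^+ 2 * (Z i j ^+ 2 * sqn (L (delta_mx i j))) <= beta) ->
  gam * (\sum_i \sum_j Z i j ^+ 2 * sqn (L (delta_mx i j))) <= beta ->
  #|[pred w : batch | ~~ (sqn (L (samp w Z - Z)) <= t * beta)]|%:R <=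
  M * vec_const R q.+1 * t ^- q.+1.
Proof.
move=> t0 h1 h2.
have sqL s a : sqn (L (summand Z s a)) = gam ^+ 2 * (Z a.1 a.2 ^+ 2 * sqn (L (delta_mx a.1 a.2))).
  by rewrite linearZ /= sqnZ exprMn mulrA.
have beta0 : 0 <= beta.
  apply: le_trans (h1 (Ordinal n1_gt0) (Ordinal n2_gt0)).
  by rewrite mulr_ge0 ?sqr_ge0 // mulr_ge0 ?sqr_ge0 ?sqn_ge0.
have m0n : m0%:R != 0 :> R by rewrite pnatr_eq0 -lt0n.
have Nn : (n1 * n2)%:R != 0 :> R by rewrite pnatr_eq0 -lt0n muln_gt0 n1_gt0.
apply: (@markov_count _ _ _ (fun w => sqn (L (samp w Z - Z))) q (vec_const R q.+1) beta t) => //.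
- by move=> w; rewrite sqn_ge0.
- by rewrite /vec_const mulr_ge0 ?exprn_ge0 ?ler0n.
have := @vector_moment R I m0 cardI_gt0 _ _ (fun s a => L (summand Z s a)) q beta.
rewrite (eq_bigr (fun w => sqn (L (samp w Z - Z)) ^+ q.+1)); last first.
  by move=> w _; rewrite csum_linear csum_summand.
apply; first by move=> s a; rewrite sqL.
apply: le_trans h2; rewrite le_eqVlt; apply/orP; left; apply/eqP.
under eq_bigr do under eq_bigr do rewrite sqL.
rewrite sumr_const card_ord -mulr_sumr (sum_pair (fun a => Z a.1 a.2 ^+ 2 * sqn (L (delta_mx a.1 a.2)))) /=.
rewrite cardI -[_ *+ m0]mulr_natr /gam; move: (\sum_i _) => S.
by field; rewrite !pnatr_eq0 -!lt0n m0_gt0 n2_gt0.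
Qed.

(** By [sqn_dil_delta], the variance of the dilated sum is diagonal: its entry at a row index is
    [gam] times the squared norm of that row of [Z], and likewise for columns. This is why the
    iteration tracks row and column norms. *)
Lemma op_step (Z : 'M[R]_(n1, n2)) (beta tau : R) (q : nat) : 0 < tau ->
  (forall i j, gam ^+ 2 * Z i j ^+ 2 <= beta) ->
  (forall i, gam * sqn (row i Z) <= beta) ->
  (forall j, gam * sqn (col j Z) <= beta) ->
  #|[pred w : batch | ~~ (\tr (dil (samp w Z - Z) ^+ (2 * q.+1)) <= tau ^+ (2 * q.+1))]|%:R <=
  M * mat_const R q.+1 (n1 + n2) * (beta / tau ^+ 2) ^+ q.+1.
Proof.
move=> tau0 h1 h2 h3.
pose e (s : 'I_m0) (a : I) k := (gam * Z a.1 a.2) ^+ 2 * dil_weight R a.1 a.2 k.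
have e0 s a k : 0 <= e s a k by rewrite mulr_ge0 ?sqr_ge0 ?dil_weight_ge0.
have m0n : m0%:R != 0 :> R by rewrite pnatr_eq0 -lt0n.
have Nn : (n1 * n2)%:R != 0 :> R by rewrite pnatr_eq0 -lt0n muln_gt0 n1_gt0.
have sqA s a (Y : 'M[R]_(n1 + n2)) : sqn (dil (summand Z s a) *m Y) = \sum_k e s a k * sqn (row k Y).
  rewrite linearZ /= -scalemxAl sqnZ sqn_dil_delta mulr_sumr.
  by apply: eq_bigr => k _; rewrite mulrA.
have hB s a k : e s a k <= beta.
  apply: le_trans (h1 a.1 a.2); rewrite -exprMn ler_piMr ?sqr_ge0 //.
  exact: dil_weight_le1.
have hv k : (#|{: I}|%:R)^-1 * (\sum_s \sum_a e s a k) <= beta.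
  have -> : (#|{: I}|%:R)^-1 * (\sum_s \sum_a e s a k) =
     gam * (\sum_i \sum_j Z i j ^+ 2 * dil_weight R i j k).
    rewrite (eq_bigr (fun=> \sum_(a : I) (gam * Z a.1 a.2) ^+ 2 * dil_weight R a.1 a.2 k)) // sumr_const card_ord cardI -[_ *+ m0]mulr_natr sum_pair.
    rewrite (eq_bigr (fun i => gam ^+ 2 * \sum_j Z i j ^+ 2 * dil_weight R i j k)); last first.
      by move=> i _; rewrite mulr_sumr; apply: eq_bigr => j _; rewrite /e exprMn mulrA.
    by rewrite -mulr_sumr /gam; move: (\sum_i _) => S; field; rewrite !pnatr_eq0 -!lt0n m0_gt0 n2_gt0.
  case: (split_ordP k) => [i|j] ->.
    apply: le_trans (h2 i); rewrite (bigD1 i) //= [X in _ + X]big1 ?addr0 => [|i' /negPf ni].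
      rewrite le_eqVlt sqn_rowE; under eq_bigr do rewrite dil_weight_l eqxx mulr1.
      by rewrite eqxx.
    by rewrite big1 // => j _; rewrite dil_weight_l eq_sym ni mulr0.
  apply: le_trans (h3 j); rewrite sqn_colE le_eqVlt; apply/orP; left; apply/eqP.
  congr (_ * _); apply: eq_bigr => i _; rewrite (bigD1 j) //= [X in _ + X]big1 ?addr0 => [|j' /negPf nj].
    by rewrite dil_weight_r eqxx mulr1.
  by rewrite dil_weight_r eq_sym nj mulr0.
have := @matrix_moment R I m0 _ (fun s a => dil (summand Z s a)) e cardI_gt0
  (fun s a => dil_sym _) e0 sqA q beta hB hv.
(* Markov's inequality is applied with exponent one, the trace being already a high power. *)
rewrite (eq_bigr (fun w => \tr (dil (samp w Z - Z) ^+ (2 * q.+1)) ^+ 1)); last first.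
  by move=> w _; rewrite csum_linear csum_summand expr1.
set c := mat_const _ _ _.
have t0 : 0 < tau ^+ 2 by rewrite exprn_gt0.
have t1 : 0 < tau ^+ (2 * q.+1) by rewrite exprn_gt0.
have beta0 : 0 <= beta.
  by apply: le_trans (h1 (Ordinal n1_gt0) (Ordinal n2_gt0)); rewrite mulr_ge0 ?sqr_ge0.
have -> : M * c * beta ^+ q.+1 = M * (c * (beta / tau ^+ 2) ^+ q.+1) * (tau ^+ (2 * q.+1)) ^+ 1.
  by rewrite expr1 exprM expr_div_n; field; rewrite gt_eqF ?exprn_gt0.
move=> h.
have := @markov_count R I m0 (fun w => \tr (dil (samp w Z - Z) ^+ (2 * q.+1))) 0
  (c * (beta / tau ^+ 2) ^+ q.+1) (tau ^+ (2 * q.+1)) 1.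
rewrite mul1r invr1 mulr1 mulrA; apply => //.
- by move=> w; rewrite tr_even_ge0 // dil_sym.
- by rewrite mulr_ge0 ?exprn_ge0 ?divr_ge0 ?(ltW t0) // /c /mat_const mulr_ge0 ?exprn_ge0 ?mulr_ge0 ?ler0n.
- exact: ltW.
by move: h; rewrite (mulrA M c).
Qed.

End GolfingStep.

(** * Union bound along a sequence of batches *)

Section TupleCount.
Variable (R : rcfType) (T : finType).

Lemma sum_tuple_cons (W : nmodType) k (F : k.+1.-tuple T -> W) :
  \sum_t F t = \sum_x \sum_(t : k.-tuple T) F (cons_tuple x t).
Proof.
rewrite pair_big /= (reindex (fun p : T * k.-tuple T => cons_tuple p.1 p.2)) //=.
exists (fun t => (thead t, behead_tuple t)) => [[x t] _|t _] /=.
  by congr (_, _); apply: val_inj.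
by rewrite [RHS](tuple_eta t); apply: val_inj.
Qed.

Variables (S : Type) (golf_step : S -> T -> S) (ok : S -> T -> bool) (Inv : S -> Prop) (invb : S -> bool).
Hypothesis invP : forall Z w, Inv Z -> ok Z w -> invb (golf_step Z w) -> Inv (golf_step Z w).

Fixpoint golf (Z : S) (ws : seq T) : bool :=
  if ws is w :: ws' then ok Z w && golf (golf_step Z w) ws' else true.

(** The first batch is summed out: if it passes, induction applies to the state it produces; if not,
    all continuations are counted as failures. [golf] records only [ok], while the invariant is
    carried by the count. *)
Lemma golf_count (eta : R) k Z : 0 <= eta -> Inv Z ->
  (forall Z, Inv Z -> #|[pred w | ~~ (ok Z w && invb (golf_step Z w))]|%:R <= #|T|%:R * eta) ->
  #|[pred t : k.-tuple T | ~~ golf Z t]|%:R <= #|{: k.-tuple T}|%:R * (k%:R * eta).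
Proof.
move=> eta0 hZ h; elim: k Z hZ => [|k IH] Z hZ.
  rewrite mul0r mulr0 eq_card0 // => t; rewrite !inE tuple0 //.
rewrite -sum1_card big_mkcond sum_tuple_cons natr_sum.
have M0 : 0 <= #|{: k.-tuple T}|%:R :> R by rewrite ler0n.
apply: (@le_trans _ _ (\sum_(w : T) (#|{: k.-tuple T}|%:R * (k%:R * eta) +
    (~~ (ok Z w && invb (golf_step Z w)))%:R * #|{: k.-tuple T}|%:R))).
  apply: ler_sum => w _.
  case: (boolP (ok Z w && invb (golf_step Z w))) => [/andP[h1 h2]|h1].
    rewrite mul0r addr0; apply: le_trans (IH (golf_step Z w) (invP hZ h1 h2)).
    by rewrite -big_mkcond sum1_card ler_nat subset_leq_card //; apply/fintype.subsetP => t; rewrite !inE /= h1.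
  rewrite mul1r; apply: (@le_trans _ _ #|{: k.-tuple T}|%:R).
    by rewrite -big_mkcond sum1_card ler_nat; apply: max_card.
  by rewrite lerDr mulr_ge0 // mulr_ge0 ?ler0n.
rewrite big_split sumr_const -mulr_suml /=.
rewrite -natr_sum -big_mkcond sum1_card.
have := h Z hZ => {}h.
have e : #|{: k.+1.-tuple T}|%:R = #|T|%:R * #|{: k.-tuple T}|%:R :> R.
  by rewrite !card_tuple expnS natrM.
have := ler_wpM2r M0 h; rewrite e -[X in X + _ <= _]mulr_natr -(natr1 k).
move: (#|[pred w | _]|%:R) => x hx. 
have -> : #|T|%:R * #|{: k.-tuple T}|%:R * ((k%:R + 1) * eta) =
  #|{: k.-tuple T}|%:R * (k%:R * eta) * #|T|%:R + #|T|%:R * eta * #|{: k.-tuple T}|%:R by ring.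
by rewrite lerD2l.
Qed.

End TupleCount.

Section RowVariance.
Variable R : rcfType.

Lemma tanproj_trmx n1 n2 r (U : 'M[R]_(n1, r)) (V : 'M[R]_(n2, r)) X :
  (tanproj U V X)^T = tanproj V U X^T.
Proof.
rewrite /tanproj linearB /= linearD /= !trmx_mul !trmxK -!mulmxA.
by congr (_ - _); rewrite addrC.
Qed.

(** By [row_proj_delta] each row [i'] of [Z] gets weight at most [P i i' ^+ 2], plus [nu2] if
    [i' = i]. The first weights sum to [sqn (row i U)], so uniform bounds on the rows of [Z]
    suffice. *)
Lemma row_variance n1 n2 r (U : 'M[R]_(n1, r)) (V : 'M[R]_(n2, r)) nu1 nu2 (Z : 'M[R]_(n1, n2)) i :
  U^T *m U = 1%:M -> V^T *m V = 1%:M -> 0 <= nu1 -> 0 <= nu2 ->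
  (forall i, sqn (row i U) <= nu1) -> (forall j, sqn (row j V) <= nu2) ->
  (forall i, sqn (row i Z) <= nu1) ->
  \sum_i' \sum_j' Z i' j' ^+ 2 * sqn (row i (tanproj U V (delta_mx i' j'))) <= (nu1 + nu2) * nu1.
Proof.
move=> oU oV nu1_ge0 nu2_ge0 hU hV Zrow; set P := U *m U^T.
apply: (@le_trans _ _ (\sum_i' (P i i' ^+ 2 + (i == i')%:R * nu2) * sqn (row i' Z))).
  apply: ler_sum => i' _; rewrite [sqn (row i' Z)]sqn_rowE mulr_sumr; apply: ler_sum => j' _.
  rewrite mulrC ler_wpM2r ?sqr_ge0 // row_proj_delta // lerD //.
    by rewrite ler_piMr ?sqr_ge0 // gerBl sqn_ge0.
  by rewrite ler_wpM2l ?ler0n.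
under eq_bigr do rewrite mulrDl; rewrite big_split /= mulrDl; apply: lerD.
  apply: (@le_trans _ _ (\sum_i' P i i' ^+ 2 * nu1)).
    by apply: ler_sum => i' _; rewrite ler_wpM2l ?sqr_ge0.
  by rewrite -mulr_suml ler_wpM2r // proj_sqr_sum.
rewrite (bigD1 i) //= big1 ?addr0 => [|i' /negPf ni]; last by rewrite eq_sym ni !mul0r.
by rewrite eqxx mul1r ler_wpM2l.
Qed.

End RowVariance.

Section Counting.
Variable T : finType.

Lemma card_negb_and (a b : pred T) :
  (#|[pred w | ~~ (a w && b w)]| <= #|[pred w | ~~ a w]| + #|[pred w | ~~ b w]|)%N.
Proof.
rewrite -!sum1_card (big_mkcond (mem [pred w | ~~ a w])) (big_mkcond (mem [pred w | ~~ b w])).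
rewrite -big_split big_mkcond; apply: leq_sum => w _ /=; rewrite !inE.
by case: (a w); case: (b w).
Qed.

Lemma card_negb_forall (J : finType) (b : J -> pred T) :
  (#|[pred w | ~~ [forall j, b j w]]| <= \sum_j #|[pred w | ~~ b j w]|)%N.
Proof.
rewrite -sum1_card big_mkcond.
under [X in (_ <= X)%N]eq_bigr do rewrite -sum1_card big_mkcond.
rewrite exchange_big; apply: leq_sum => w _ /=; rewrite inE.
case: ifP => // /forallPn[j hj].
by rewrite (bigD1 j) //= inE hj.
Qed.

End Counting.

(** * The golfing iteration and its invariants *)

Section Golfing.
Variables (R : rcfType) (n1 n2 r m0 : nat).
Variables (U : 'M[R]_(n1, r)) (V : 'M[R]_(n2, r)) (nu1 nu2 h tau : R) (q : nat).
Notation I := ('I_n1 * 'I_n2)%type.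
Notation batch := {ffun 'I_m0 -> I}.
Notation M := (#|{: batch}|%:R : R).
Notation PT := (tanproj U V).
Notation gam := (gam R n1 n2 m0).
Notation mx := 'M[R]_(n1, n2).
Hypotheses (n1_gt0 : (0 < n1)%N) (n2_gt0 : (0 < n2)%N) (m0_gt0 : (0 < m0)%N).
Hypotheses (oU : U^T *m U = 1%:M) (oV : V^T *m V = 1%:M).
Hypotheses (hU : forall i, sqn (row i U) <= nu1) (hV : forall j, sqn (row j V) <= nu2).
Hypotheses (h_ge1 : 1 <= h) (h_theta : gam * (nu1 + nu2) <= h ^- 2) (tau_gt0 : 0 < tau).

Let nu := nu1 + nu2.
Let theta := gam * nu.
Let P := U *m U^T.

Definition golf_step (Z : mx) (w : batch) : mx := Z - PT (samp w Z).

Let h_gt0 : 0 < h. Proof. exact: lt_le_trans ltr01 h_ge1. Qed.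
Let nu1_ge0 : 0 <= nu1. Proof. exact: le_trans (sqn_ge0 _) (hU (Ordinal n1_gt0)). Qed.
Let nu2_ge0 : 0 <= nu2. Proof. exact: le_trans (sqn_ge0 _) (hV (Ordinal n2_gt0)). Qed.
Let nu_ge0 : 0 <= nu. Proof. exact: addr_ge0. Qed.
Let gam_ge0 : 0 <= gam. Proof. exact/ltW/gam_gt0. Qed.
Let theta_ge0 : 0 <= theta. Proof. exact: mulr_ge0. Qed.
Let theta_le1 : theta <= 1.
Proof. by apply: le_trans h_theta _; rewrite invf_le1 ?exprn_gt0 // exprn_ege1. Qed.
Let h_theta' : h * theta <= h^-1.
Proof.
by rewrite -ler_pdivlMl // -invfM -expr2.
Qed.
Let theta2 : theta ^+ 2 <= theta.
Proof. by rewrite expr2 ler_piMl. Qed.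

Lemma next_tan Z w : PT Z = Z -> golf_step Z w = - PT (samp w Z - Z).
Proof. by move=> hZ; rewrite [PT (_ - _)]linearB /= hZ opprB. Qed.

Lemma PT_next Z w : PT Z = Z -> PT (golf_step Z w) = golf_step Z w.
Proof. by move=> hZ; rewrite next_tan // linearN /= tanproj_idem. Qed.

(** As [PT] is a self-adjoint idempotent, the squared norm is the [(i, j)] entry of the projection,
    namely [x + y - x * y] with [x] and [y] the squared row norms of [U] and [V]. *)
Lemma sqn_PT_delta i j : sqn (PT (delta_mx i j)) <= nu.
Proof.
rewrite /sqn -tanproj_selfadj // tanproj_idem // ip_delta.
have -> : PT (delta_mx i j) i j = (P *m delta_mx i j) i j + (delta_mx i j *m (V *m V^T)) i j -
    (P *m delta_mx i j *m (V *m V^T)) i j by rewrite /tanproj !mxE.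
rewrite mulmx_delta delta_mulmx mulmx_delta_mulmx !eqxx mulr1 mul1r !proj_diag.
apply: (@le_trans _ _ (sqn (row i U) + sqn (row j V))); last exact: lerD.
by rewrite lerBlDr lerDl mulr_ge0 ?sqn_ge0.
Qed.

Lemma tan_entry_le Z i j : PT Z = Z -> Z i j ^+ 2 <= sqn Z * nu.
Proof.
move=> hZ; have -> : Z i j = ip Z (PT (delta_mx i j)) by rewrite -tanproj_selfadj // hZ ip_delta.
apply: le_trans (cauchy_schwarz _ _) _.
by rewrite ler_wpM2l ?sqn_ge0 // sqn_PT_delta.
Qed.

Lemma count_sub (A B : pred batch) (C : R) : (forall w, A w -> B w) ->
  #|B|%:R <= C -> #|A|%:R <= C.
Proof.
move=> AB; apply: le_trans; rewrite ler_nat subset_leq_card //.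
by apply/fintype.subsetP => w; exact: AB.
Qed.

Notation cv := (vec_const R q.+1 * h ^- q.+1).

(** The variance is at most [theta * sqn Z], with [theta <= h ^- 2]. Allowing [h] times the variance
    still contracts by [h^-1], and the event fails with probability [O(h ^- q.+1)]. The next three
    lemmas make the same trade. *)
Lemma frob_step Z : PT Z = Z ->
  #|[pred w : batch | ~~ (sqn (golf_step Z w) <= h^-1 * sqn Z)]|%:R <= M * cv.
Proof.
move=> hZ; rewrite mulrA.
have hb : gam * (\sum_i \sum_j Z i j ^+ 2 * sqn (PT (delta_mx i j))) <= theta * sqn Z.
  rewrite /theta -[X in _ <= X]mulrA ler_wpM2l // sqnE mulr_sumr; apply: ler_sum => i _.
  rewrite mulr_sumr; apply: ler_sum => j _.
  by rewrite mulrC ler_wpM2r ?sqr_ge0 // sqn_PT_delta.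
apply: count_sub (vec_step n1_gt0 n2_gt0 m0_gt0 (Z := Z) (L := PT) q h_gt0 _ hb).
  move=> w /=; apply: contra; rewrite next_tan // sqnN => /le_trans; apply.
  by rewrite mulrA ler_wpM2r ?sqn_ge0.
move=> i j; apply: (@le_trans _ _ (theta ^+ 2 * sqn Z)); last by rewrite ler_wpM2r ?sqn_ge0.
rewrite [theta ^+ 2]exprMn -[X in _ <= X]mulrA ler_wpM2l ?sqr_ge0 // [X in X <= _]mulrC [nu ^+ 2]expr2 -[X in _ <= X]mulrA.
apply: ler_pM; rewrite ?sqn_ge0 ?sqr_ge0 ?sqn_PT_delta //.
by rewrite mulrC tan_entry_le.
Qed.

Section Invariants.
Variable Z : mx.
Hypotheses (hZ : PT Z = Z) (Zent : forall i j, Z i j ^+ 2 <= nu1 * nu2).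
Hypotheses (Zrow : forall i, sqn (row i Z) <= nu1) (Zcol : forall j, sqn (col j Z) <= nu2).

(** By self-adjointness the variance weights are the squared entries of [PT (delta_mx i j)]. The
    invariant bounds the entries of [Z] uniformly, and the weights sum to at most [nu]. *)
Lemma entry_step i j :
  #|[pred w : batch | ~~ (golf_step Z w i j ^+ 2 <= nu1 * nu2)]|%:R <= M * cv.
Proof.
rewrite mulrA; pose L : {linear mx -> 'M[R]_(1, 1)} := row i \o col j \o PT.
have sqL X : sqn (L X) = PT X i j ^+ 2 by rewrite sqn_rowE big_ord1 mxE.
have hL i' j' : sqn (L (delta_mx i' j')) = PT (delta_mx i j) i' j' ^+ 2.
  by rewrite sqL -[in LHS]ip_delta tanproj_selfadj // ipC ip_delta.
have a0 : 0 <= nu1 * nu2 by rewrite mulr_ge0.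
have hb : gam * (\sum_i' \sum_j' Z i' j' ^+ 2 * sqn (L (delta_mx i' j'))) <= theta * (nu1 * nu2).
  apply: (@le_trans _ _ (gam * (nu1 * nu2 * sqn (PT (delta_mx i j))))).
    rewrite ler_wpM2l // sqnE mulr_sumr; apply: ler_sum => i' _.
    rewrite mulr_sumr; apply: ler_sum => j' _.
    by rewrite hL ler_wpM2r ?sqr_ge0.
  rewrite /theta -[X in _ <= X]mulrA ler_wpM2l // [X in _ <= X]mulrC ler_wpM2l //; exact: sqn_PT_delta.
apply: count_sub (vec_step n1_gt0 n2_gt0 m0_gt0 (Z := Z) (L := L) q h_gt0 _ hb).
  move=> w /=; apply: contra; rewrite next_tan // mxE sqrrN sqL => /le_trans; apply.
  rewrite mulrA ler_piMl // (le_trans h_theta') // invf_le1 //.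
move=> i' j'; apply: (@le_trans _ _ (theta ^+ 2 * (nu1 * nu2))); last by rewrite ler_wpM2r.
rewrite [theta ^+ 2]exprMn -[X in _ <= X]mulrA ler_wpM2l ?sqr_ge0 // mulrC.
apply: ler_pM; rewrite ?sqn_ge0 ?sqr_ge0 // hL.
apply: le_trans (tan_entry_le _ _ (tanproj_idem oU oV _)) _.
by rewrite expr2 ler_wpM2r // sqn_PT_delta.
Qed.

Lemma row_step i :
  #|[pred w : batch | ~~ (sqn (row i (golf_step Z w)) <= nu1)]|%:R <= M * cv.
Proof.
rewrite mulrA; pose L : {linear mx -> 'M[R]_(1, n2)} := row i \o PT.
have sqL X : sqn (L X) = sqn (row i (PT X)) by [].
have hb : gam * (\sum_i' \sum_j' Z i' j' ^+ 2 * sqn (L (delta_mx i' j'))) <= theta * nu1.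
  by rewrite /theta -[X in _ <= X]mulrA ler_wpM2l //; apply: row_variance.
apply: count_sub (vec_step n1_gt0 n2_gt0 m0_gt0 (Z := Z) (L := L) q h_gt0 _ hb).
  move=> w /=; apply: contra; rewrite next_tan // linearN /= sqnN => /le_trans; apply.
  by rewrite mulrA ler_piMl // (le_trans h_theta') // invf_le1.
move=> i' j'; apply: (@le_trans _ _ (theta ^+ 2 * nu1)); last by rewrite ler_wpM2r.
rewrite [theta ^+ 2]exprMn -[X in _ <= X]mulrA ler_wpM2l ?sqr_ge0 //.
apply: (@le_trans _ _ (nu1 * nu2 * nu)).
  apply: ler_pM; rewrite ?sqr_ge0 ?sqn_ge0 //.
  by apply: le_trans (sqn_row_le _ _) (sqn_PT_delta _ _).
rewrite -mulrA mulrC ler_wpM2r // expr2 ler_wpM2r // /nu lerDr //.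
Qed.

(** The variance bound is [row_variance] for the transpose, with [U] and [V] exchanged. *)
Lemma col_step j :
  #|[pred w : batch | ~~ (sqn (col j (golf_step Z w)) <= nu2)]|%:R <= M * cv.
Proof.
rewrite mulrA; pose L : {linear mx -> 'M[R]_(n1, 1)} := col j \o PT.
have hb : gam * (\sum_i' \sum_j' Z i' j' ^+ 2 * sqn (L (delta_mx i' j'))) <= theta * nu2.
  rewrite /theta -[X in _ <= X]mulrA ler_wpM2l // exchange_big /= /nu addrC.
  apply: le_trans (@row_variance R _ _ r V U nu2 nu1 Z^T j oV oU _ _ _ _ _) => //.
    rewrite le_eqVlt; apply/orP; left; apply/eqP; apply: eq_bigr => j' _; apply: eq_bigr => i' _.
    by rewrite -(trmx_delta _ i' j') -tanproj_trmx -tr_col sqn_trmx mxE.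
  by move=> j'; rewrite -tr_col sqn_trmx.
apply: count_sub (vec_step n1_gt0 n2_gt0 m0_gt0 (Z := Z) (L := L) q h_gt0 _ hb).
  move=> w /=; apply: contra; rewrite next_tan // linearN /= sqnN => /le_trans; apply.
  by rewrite mulrA ler_piMl // (le_trans h_theta') // invf_le1.
move=> i' j'; apply: (@le_trans _ _ (theta ^+ 2 * nu2)); last by rewrite ler_wpM2r.
rewrite [theta ^+ 2]exprMn -[X in _ <= X]mulrA ler_wpM2l ?sqr_ge0 //.
apply: (@le_trans _ _ (nu1 * nu2 * nu)).
  apply: ler_pM; rewrite ?sqr_ge0 ?sqn_ge0 //.
  by apply: le_trans (sqn_col_le _ _) (sqn_PT_delta _ _).
rewrite mulrAC ler_wpM2r // expr2 ler_wpM2r // /nu lerDl //.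
Qed.

Lemma trace_step :
  #|[pred w : batch | ~~ (\tr (dil (samp w Z - Z) ^+ (2 * q.+1)) <= tau ^+ (2 * q.+1))]|%:R <=
  M * (mat_const R q.+1 (n1 + n2) * (theta / tau ^+ 2) ^+ q.+1).
Proof.
rewrite mulrA; apply: op_step => // [i j|i|j].
- apply: le_trans theta2; rewrite [leRHS]exprMn ler_wpM2l ?sqr_ge0 //.
  apply: le_trans (Zent i j) _; rewrite expr2.
  by apply: ler_pM; rewrite // /nu ?lerDl ?lerDr.
- by rewrite ler_wpM2l // (le_trans (Zrow i)) // lerDl.
by rewrite ler_wpM2l // (le_trans (Zcol j)) // lerDr.
Qed.

End Invariants.

Definition invb (Z : mx) : bool :=
  [&& [forall i, forall j, Z i j ^+ 2 <= nu1 * nu2],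
      [forall i, sqn (row i Z) <= nu1] & [forall j, sqn (col j Z) <= nu2]].

Definition main_ok (Z : mx) (w : batch) : bool :=
  (\tr (dil (samp w Z - Z) ^+ (2 * q.+1)) <= tau ^+ (2 * q.+1)) &&
  (sqn (golf_step Z w) <= h^-1 * sqn Z).

Definition frob_ok (Z : mx) (w : batch) : bool := sqn (golf_step Z w) <= h^-1 * sqn Z.

(** Union bound for one step: the trace event, then one Frobenius, [n1 * n2] entry, [n1] row and
    [n2] column events. *)
Definition step_const : R := mat_const R q.+1 (n1 + n2) * (theta / tau ^+ 2) ^+ q.+1 +
  (1 + (n1 * n2 + n1 + n2))%:R * cv.

Lemma main_step Z : PT Z = Z /\ invb Z ->
  #|[pred w | ~~ (main_ok Z w && invb (golf_step Z w))]|%:R <= M * step_const.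
Proof.
move=> [hZ /and3P[/forallP Zent' /forallP Zrow /forallP Zcol]].
have Zent i j : Z i j ^+ 2 <= nu1 * nu2 by have /forallP := Zent' i; apply.
have hand (a b : pred batch) x y : #|[pred w | ~~ a w]|%:R <= M * x -> #|[pred w | ~~ b w]|%:R <= M * y ->
   #|[pred w | ~~ (a w && b w)]|%:R <= M * (x + y).
  move=> ha hb; apply: (@le_trans _ _ (#|[pred w | ~~ a w]| + #|[pred w | ~~ b w]|)%:R).
    by rewrite ler_nat card_negb_and.
  by rewrite natrD mulrDr lerD.
have hall k (b : 'I_k -> pred batch) x : (forall i, #|[pred w | ~~ b i w]|%:R <= M * x) ->
   #|[pred w | ~~ [forall i, b i w]]|%:R <= M * (k%:R * x).
  move=> hb; apply: (@le_trans _ _ (\sum_(i < k) #|[pred w | ~~ b i w]|)%:R).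
    by rewrite ler_nat card_negb_forall.
  rewrite natr_sum mulrCA mulr_natl -[X in _ *+ X]card_ord -sumr_const; exact: ler_sum.
have h1 := hand _ _ _ _ (hand _ _ _ _ (trace_step Zent Zrow Zcol) (frob_step hZ))
  (hand _ _ _ _ (hall _ _ _ (fun i => hall _ _ _ (fun j => entry_step hZ Zent i j)))
  (hand _ _ _ _ (hall _ _ _ (fun i => row_step hZ Zent Zrow i)) (hall _ _ _ (fun j => col_step hZ Zent Zcol j)))).
apply: le_trans h1 _; rewrite ler_wpM2l ?ler0n // le_eqVlt; apply/orP; left; apply/eqP.
by rewrite /step_const !natrD natrM; ring.
Qed.

Lemma sqn_frob_le Z w : frob_ok Z w -> sqn (golf_step Z w) <= sqn Z.
Proof. by move=> /le_trans; apply; rewrite ler_piMl ?sqn_ge0 // invf_le1. Qed.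

Lemma step_const_ge0 : 0 <= step_const.
Proof.
have cv0 : 0 <= cv by rewrite mulr_ge0 ?invr_ge0 ?exprn_ge0 ?(ltW h_gt0) // mulr_ge0 ?exprn_ge0 ?ler0n.
have tt0 : 0 <= theta / tau ^+ 2 by rewrite divr_ge0 ?exprn_ge0 ?(ltW tau_gt0).
apply: addr_ge0; last by rewrite mulr_ge0 ?ler0n.
by rewrite mulr_ge0 ?exprn_ge0 // /mat_const mulr_ge0 ?exprn_ge0 ?mulr_ge0 ?ler0n.
Qed.

Lemma main_golf_count k Z : PT Z = Z -> invb Z ->
  #|[pred t : k.-tuple batch | ~~ golf golf_step main_ok Z t]|%:R <=
  #|{: k.-tuple batch}|%:R * (k%:R * step_const).
Proof.
move=> hZ iZ; apply: (@golf_count R _ _ golf_step main_ok (fun Z => PT Z = Z /\ invb Z) invb) => //.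
- by move=> Y w [hY _] _ iY; rewrite PT_next.
- exact: step_const_ge0.
- by move=> Y hY; apply: main_step.
Qed.

Lemma frob_golf_count k Z : PT Z = Z ->
  #|[pred t : k.-tuple batch | ~~ golf golf_step frob_ok Z t]|%:R <=
  #|{: k.-tuple batch}|%:R * (k%:R * cv).
Proof.
move=> hZ; apply: (@golf_count R _ _ golf_step frob_ok (fun Z => PT Z = Z) xpredT) => //.
- by move=> Y w hY _ _; rewrite PT_next.
- by rewrite mulr_ge0 ?invr_ge0 ?exprn_ge0 ?(ltW h_gt0) // mulr_ge0 ?exprn_ge0 ?ler0n.
move=> Y hY; apply: count_sub (frob_step hY) => w /=.
by rewrite andbT.
Qed.

Lemma PT_UVt : PT (U *m V^T) = U *m V^T.
Proof. exact: tanproj_UX. Qed.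

Lemma invb_UVt : invb (U *m V^T).
Proof.
have hrow i : sqn (row i (U *m V^T)) = sqn (row i U).
  by rewrite row_mul /sqn ip_mulr trmxK -mulmxA oV mulmx1.
have hcol j : sqn (col j (U *m V^T)) = sqn (row j V).
  by rewrite -sqn_trmx tr_col trmx_mul trmxK row_mul /sqn ip_mulr trmxK -mulmxA oU mulmx1.
apply/and3P; split; apply/forallP => i; rewrite ?hrow ?hcol //.
apply/forallP => j.
have -> : (U *m V^T) i j = ip (row i U) (row j V).
  by rewrite mxE /ip big_ord1; apply: eq_bigr => k _; rewrite !mxE.
apply: le_trans (cauchy_schwarz _ _) _.
by apply: ler_pM; rewrite ?sqn_ge0.
Qed.

End Golfing.

(** * Exact recovery from the certificates *)

Section Certificate.
Variables (R : rcfType) (n1 n2 r m0 : nat).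
Variables (U : 'M[R]_(n1, r)) (V : 'M[R]_(n2, r)) (h tau : R) (q : nat).
Notation I := ('I_n1 * 'I_n2)%type.
Notation batch := {ffun 'I_m0 -> I}.
Notation PT := (tanproj U V).
Notation gam := (gam R n1 n2 m0).
Notation mx := 'M[R]_(n1, n2).
Notation nxt := (@golf_step R n1 n2 r m0 U V).
Notation frobok := (@frob_ok R n1 n2 r m0 U V h).
Notation mainok := (@main_ok R n1 n2 r m0 U V h tau q).
Hypotheses (n1_gt0 : (0 < n1)%N) (n2_gt0 : (0 < n2)%N) (m0_gt0 : (0 < m0)%N).
Hypotheses (oU : U^T *m U = 1%:M) (oV : V^T *m V = 1%:M).
Hypotheses (h_ge1 : 1 <= h) (tau_gt0 : 0 < tau).

(** The golfing certificate: the sum of the sampled iterates along the run. *)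
Fixpoint certif (Z : mx) (ws : seq batch) : mx :=
  if ws is w :: ws' then samp w Z + certif (nxt Z w) ws' else 0.

Lemma golf_frob Z ws : golf nxt mainok Z ws -> golf nxt frobok Z ws.
Proof.
by elim: ws Z => //= w ws IH Z /andP[/andP[_ h1] /IH ->]; rewrite andbT.
Qed.

Lemma certif_supp (S : {set I}) (ws : seq batch) Z i j :
  (forall w, w \in ws -> forall s, w s \in S) -> (i, j) \notin S -> certif Z ws i j = 0.
Proof.
move=> hS ij; elim: ws Z hS => [|w ws IH] Z hS /=; first by rewrite mxE.
rewrite mxE IH => [|w' w'ws]; last by apply: hS; rewrite inE w'ws orbT.
rewrite addr0 /samp summxE big1 // => s _; rewrite !mxE.
have hs : w s \in S by apply: hS; rewrite inE eqxx.
have [/andP[/eqP e1 /eqP e2]|] := boolP ((i == (w s).1) && (j == (w s).2)); last by rewrite mulr0.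
by move: ij; rewrite e1 e2 -surjective_pairing hs.
Qed.

(** The sum telescopes: [Z - PT (certif Z ws)] is the last iterate of the run. *)
Lemma certif_residual ws Z : golf nxt frobok Z ws ->
  sqn (Z - PT (certif Z ws)) <= h ^- size ws * sqn Z.
Proof.
have h0 : 0 < h by apply: lt_le_trans h_ge1.
elim: ws Z => [|w ws IH] Z /=; first by rewrite linear0 subr0 expr0 invr1 mul1r.
move=> /andP[h1 /IH h2].
rewrite [PT (_ + _)]linearD opprD addrA; apply: le_trans h2 _.
by rewrite exprSr invfM -mulrA ler_wpM2l // invr_ge0 exprn_ge0 // ltW.
Qed.

Lemma nf_delta i j : nf (delta_mx i j : mx) = 1.
Proof. by rewrite /nf /sqn ip_delta mxE !eqxx sqrtr1. Qed.

Lemma nf_samp (w : batch) (Z : mx) : nf (samp w Z) <= (n1 * n2)%:R * nf Z.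
Proof.
apply: le_trans (ler_nf_sum _ _ _) _.
have g0 := gam_gt0 R n1_gt0 n2_gt0 m0_gt0.
apply: (@le_trans _ _ (\sum_(s < m0) gam * nf Z)).
  apply: ler_sum => s _; rewrite nfZ nf_delta mulr1 normrM (gtr0_norm g0).
  rewrite ler_pM2l // -sqrtr_sqr /nf ler_wsqrtr //; exact: sqr_entry_le.
rewrite sumr_const card_ord -mulrnAl /gam -[X in X * _ <= _]mulr_natr mulfVK //.
by rewrite pnatr_eq0 -lt0n.
Qed.

(** A crude polynomial bound; it is compared later with a residual that is a much smaller negative
    power of [h]. *)
Lemma certif_nf ws Z : golf nxt frobok Z ws ->
  nf (certif Z ws) <= (size ws)%:R * ((n1 * n2)%:R * nf Z).
Proof.
elim: ws Z => [|w ws IH] Z /=; first by rewrite nf0 mul0r.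
move=> /andP[h1 /IH h2]; apply: le_trans (ler_nfD _ _) _.
rewrite -natr1 mulrDl mul1r addrC; apply: lerD; last exact: nf_samp.
apply: le_trans h2 _; rewrite ler_wpM2l ?ler0n // ler_wpM2l ?ler0n //.
by rewrite /nf ler_wsqrtr //; apply: sqn_frob_le h1.
Qed.

Lemma opn_leD (A B : mx) a b : opn_le A a -> opn_le B b -> opn_le (A + B) (a + b).
Proof.
move=> hA hB x y; have := hA x y; have := hB x y; rewrite mulmxDl ipDr; lra.
Qed.

Lemma proj_sqn n (W : 'M[R]_(n, r)) : W^T *m W = 1%:M -> forall x : 'cV[R]_n,
  sqn x = sqn (W^T *m x) + sqn ((1%:M - W *m W^T) *m x).
Proof.
move=> oW x; rewrite mulmxBl mul1mx sqnB -!mulmxA.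
have -> : ip x (W *m (W^T *m x)) = sqn (W^T *m x) by rewrite ipC ip_mull.
have -> : sqn (W *m (W^T *m x)) = sqn (W^T *m x).
  by rewrite /sqn ip_mull !mulmxA oW mul1mx.
ring.
Qed.

Lemma proj_perp_sym n (W : 'M[R]_(n, r)) : (1%:M - W *m W^T)^T = 1%:M - W *m W^T.
Proof. by rewrite linearB /= trmx1 proj_sym. Qed.

Lemma ip_perp (E : mx) (x : 'cV[R]_n1) (y : 'cV[R]_n2) :
  ip x ((E - PT E) *m y) = ip ((1%:M - U *m U^T) *m x) (E *m ((1%:M - V *m V^T) *m y)).
Proof. by rewrite tanproj_perp ip_mull proj_perp_sym !mulmxA. Qed.

Lemma opn_perp (E : mx) a : 0 <= a -> opn_le E a -> opn_le (E - PT E) a.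
Proof.
move=> a0 hE x y; rewrite ip_perp; apply: le_trans (hE _ _) _; rewrite ler_wpM2l //.
by rewrite (proj_sqn oU x) (proj_sqn oV y) lerD // lerDr sqn_ge0.
Qed.

(** As [PT Z = Z], the part of [samp w Z] orthogonal to the tangent space is that of the centred
    matrix [samp w Z - Z]. Each step therefore contributes at most [tau]. *)
Lemma certif_opn ws Z : PT Z = Z -> golf nxt mainok Z ws ->
  opn_le (certif Z ws - PT (certif Z ws)) ((size ws)%:R * tau).
Proof.
elim: ws Z => [|w ws IH] Z hZ /=.
  by move=> _ x y; rewrite linear0 subr0 mul0mx ip0r mulr0 mul0r mul0r.
move=> /andP[/andP[h1 _]] h2.
have {}h2 := IH _ (PT_next oU oV w hZ) h2.
rewrite -natr1 mulrDl mul1r [(size ws)%:R * _ + _]addrC [PT (_ + _)]linearD /=.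
have -> : samp w Z + certif (nxt Z w) ws - (PT (samp w Z) + PT (certif (nxt Z w) ws)) =
  (samp w Z - Z - PT (samp w Z - Z)) + (certif (nxt Z w) ws - PT (certif (nxt Z w) ws)).
  rewrite [PT (_ - _)]linearB /= hZ.
  have -> : samp w Z - Z - (PT (samp w Z) - Z) = samp w Z - PT (samp w Z).
    by rewrite opprB addrA subrK.
  by rewrite opprD addrACA.
by apply: opn_leD => //; apply: opn_perp (ltW tau_gt0) _; apply: dil_opn (ltW tau_gt0) h1.
Qed.

Lemma opn_nf (A : mx) : opn_le A (nf A).
Proof.
move=> x y.
have nfM : nf (A *m y) <= nf A * nf y.
  rewrite nf_le ?mulr_ge0 ?nf_ge0 // exprMn !nf2 sqn_row [leRHS](_ : _ = \sum_i sqn (row i A) * sqn y).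
    apply: ler_sum => i _; rewrite row_mul.
    have -> : sqn (row i A *m y) = ip (row i A) y^T ^+ 2.
      rewrite sqnE !big_ord1 mxE /ip big_ord1; congr (_ ^+ 2).
      by apply: eq_bigr => k _; rewrite !mxE.
    by rewrite -(sqn_trmx y) cauchy_schwarz.
  by rewrite -mulr_suml -sqn_row.
have h1 := le_trans (ler_norm _) (ip_le_nf x (A *m y)).
have h2 := ler_wpM2l (nf_ge0 x) nfM.
have h3 : nf A * (2 * (nf x * nf y)) <= nf A * (sqn x + sqn y).
  rewrite ler_wpM2l ?nf_ge0 // -!nf2; have := sqr_ge0 (nf x - nf y); rewrite sqrrB; lra.
lra.
Qed.

Section Recovery.
Variables (S : {set I}) (Y : mx) (eps eps1 K : R).
Hypotheses (Ysupp : forall i j, (i, j) \notin S -> Y i j = 0).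
Hypotheses (eps_ge0 : 0 <= eps) (eps1_ge0 : 0 <= eps1) (K_ge0 : 0 <= K).
Hypothesis Yres : nf (U *m V^T - PT Y) <= eps.
Hypothesis Yopn : opn_le (Y - PT Y) 2^-1.
Hypothesis local : forall a b, exists Y1 : mx,
  [/\ forall i j, (i, j) \notin S -> Y1 i j = 0,
      nf (PT (delta_mx a b) - PT Y1) <= eps1 & nf Y1 <= K].
Hypothesis eps1_small : (n1 * n2)%:R * eps1 <= 2^-1.
Hypothesis eps_small : eps * (2 * (n1 * n2)%:R * K) < 2^-1.

Lemma ip_tan_perp A B : ip (PT A) (B - PT B) = 0.
Proof. by rewrite tanproj_selfadj linearB /= tanproj_idem // subrr ip0r. Qed.

(* The entry of [PT D] at [(a, b)] is the inner product of [D] with [PT e_ab]; up to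
   [eps1] the latter is [PT Y1] with [Y1] supported on [S], hence orthogonal to [D]. *)
Lemma tan_le_perp (D : mx) : (forall i j, (i, j) \in S -> D i j = 0) ->
  nf (PT D) <= 2 * (n1 * n2)%:R * K * nf (D - PT D).
Proof.
move=> hD; set H := PT D; set Hp := D - H.
have ipS (Y1 : mx) : (forall i j, (i, j) \notin S -> Y1 i j = 0) -> ip Y1 D = 0.
  move=> hY; rewrite /ip big1 // => i _; rewrite big1 // => j _.
  case: (boolP ((i, j) \in S)) => ij; first by rewrite hD ?mulr0.
  by rewrite hY ?mul0r.
have ent a b : `|H a b| <= eps1 * nf H + K * nf Hp.
  have [Y1 [Y1S Y1r Y1n]] := local a b.
  have -> : H a b = ip (PT (delta_mx a b) - PT Y1) H - ip Y1 Hp.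
    have -> : ip Y1 Hp = - ip (PT Y1) H.
      rewrite /Hp ipBr ipS // sub0r tanproj_selfadj /H tanproj_idem //.
    by rewrite opprK ipBl addrNK tanproj_selfadj /H tanproj_idem // ipC ip_delta.
  apply: le_trans (ler_normB _ _) _; apply: lerD.
    by apply: le_trans (ip_le_nf _ _) _; rewrite ler_wpM2r ?nf_ge0.
  by apply: le_trans (ip_le_nf _ _) _; rewrite ler_wpM2r ?nf_ge0.
set c := eps1 * nf H + K * nf Hp in ent.
have c0 : 0 <= c by rewrite addr_ge0 // mulr_ge0 ?nf_ge0.
(* Crude: the square root of the number of entries is replaced by that number. *)
have hc : nf H <= (n1 * n2)%:R * c.
  rewrite nf_le ?mulr_ge0 ?ler0n // sqnE.
  apply: (@le_trans _ _ (\sum_(i < n1) \sum_(j < n2) c ^+ 2)).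
    apply: ler_sum => i _; apply: ler_sum => j _.
    by rewrite -[X in X <= _]real_normK ?num_real // lerXn2r ?nnegrE.
  rewrite !sumr_const !card_ord -mulrnA mulnC -[X in X <= _]mulr_natl exprMn ler_wpM2r ?sqr_ge0 //.
  by rewrite -natrX ler_nat expnS expn1 leq_pmulr // muln_gt0 n1_gt0.
(* By [eps1_small], at most half of [nf H] reappears on the right, where it is absorbed. *)
have e1 := ler_wpM2r (nf_ge0 H) eps1_small.
rewrite /c in hc; lra.
Qed.

(* The multiplier is [U V^T] plus the part orthogonal to [T] of [Y + c D], with [c]
   chosen so that the contribution of [D] has operator norm at most [1/2]. *)
Lemma dual_recovery (D : mx) : (forall i j, (i, j) \in S -> D i j = 0) -> D != 0 ->
  exists W, [/\ opn_le W 1, (forall A, PT A = A -> ip W A = ip (U *m V^T) A) & 0 < ip W D].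
Proof.
move=> hD nzD; set H := PT D; set Hp := D - H.
have hH := tan_le_perp hD.
have nHp : 0 < nf Hp.
  rewrite lt_def nf_ge0 andbT; apply: contraNneq nzD => Hp0.
  rewrite -/H -/Hp Hp0 mulr0 in hH.
  have nH0 : nf H = 0 by apply/eqP; rewrite eq_le hH nf_ge0.
  have H0 : H = 0 by apply: sqn_eq0; rewrite -nf2 nH0 expr0n.
  have : Hp = 0 by apply: sqn_eq0; rewrite -nf2 Hp0 expr0n.
  by rewrite /Hp H0 subr0 => ->.
pose G := Y + (2 * nf Hp)^-1 *: D.
have eQ : G - PT G = (Y - PT Y) + (2 * nf Hp)^-1 *: Hp.
  have -> : PT G = PT Y + (2 * nf Hp)^-1 *: H by rewrite /G addrC linearP addrC.
  by rewrite /G opprD addrACA -scalerBr.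
have QA A : PT A = A -> ip (G - PT G) A = 0.
  by move=> hA; rewrite ipC -hA ip_tan_perp.
have Qopn : opn_le (G - PT G) 1.
  have := opn_leD Yopn (opn_nf ((2 * nf Hp)^-1 *: Hp)).
  rewrite -eQ nfZ gtr0_norm ?invr_gt0 ?mulr_gt0 //.
  by have -> : 2^-1 + (2 * nf Hp)^-1 * nf Hp = 1 by field; rewrite gt_eqF.
exists (U *m V^T + (G - PT G)); split.
- move=> x y; rewrite mulmxDl ipDr mul1r (proj_sqn oU x) (proj_sqn oV y) mulrDr.
  set x1 := U^T *m x; set y1 := V^T *m y.
  set x2 := (1%:M - _) *m x; set y2 := (1%:M - _) *m y.
  have -> : ip x (U *m V^T *m y) = ip x1 y1.
    by rewrite -mulmxA ipC ip_mull ipC.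
  have -> : ip x ((G - PT G) *m y) = ip x2 ((G - PT G) *m y2).
    have PQ0 : PT (G - PT G) = 0 by rewrite [LHS]linearB /= tanproj_idem // subrr.
    by have := ip_perp (G - PT G) x y; rewrite PQ0 subr0.
  have h1 := Qopn x2 y2.
  have h2 : 2 * ip x1 y1 <= sqn x1 + sqn y1.
    have := sqn_ge0 (x1 - y1); rewrite sqnB; lra.
  rewrite mul1r in h1; lra.
- by move=> A hA; rewrite ipDl QA ?addr0.
have ipYD : ip Y D = 0.
  rewrite /ip big1 // => i _; rewrite big1 // => j _.
  case: (boolP ((i, j) \in S)) => ij; first by rewrite hD ?mulr0.
  by rewrite Ysupp ?mul0r.
have DE : D = H + Hp by rewrite addrC subrK.
(* Since [ip Y D = 0], the pairing of [Y - PT Y] with [Hp] is [- ip (PT Y) H], which turns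
   [U *m V^T] into the small residual [U *m V^T - PT Y]. By [tan_le_perp] and [eps_small], the
   residual term stays below [nf Hp / 2]. *)
have -> : ip (U *m V^T + (G - PT G)) D = ip (U *m V^T - PT Y) H + nf Hp / 2.
  have e1 : ip (U *m V^T) D = ip (U *m V^T) H.
    by rewrite /H -tanproj_selfadj PT_UVt.
  have e2 : ip (G - PT G) D = ip (Y - PT Y) Hp + nf Hp / 2.
    rewrite [in LHS]DE ipDr QA ?add0r; last by rewrite /H tanproj_idem.
    rewrite eQ ipDl ipZl -/(sqn Hp) -nf2; congr (_ + _); field.
    by rewrite gt_eqF.
  have e3 : ip (Y - PT Y) Hp = - ip (PT Y) H.
    rewrite ipBl ip_tan_perp subr0 /Hp ipBr ipYD sub0r; congr (- _).
    by rewrite tanproj_selfadj /H tanproj_idem.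
  by rewrite ipDl e1 e2 e3 [ip (U *m V^T - PT Y) H]ipBl addrA.
have h1 : `|ip (U *m V^T - PT Y) H| <= eps * nf H.
  by apply: le_trans (ip_le_nf _ _) _; rewrite ler_wpM2r ?nf_ge0.
have h2 := ler_wpM2l eps_ge0 hH.
have h3 : eps * (2 * (n1 * n2)%:R * K) * nf Hp < 2^-1 * nf Hp by rewrite ltr_pM2r.
move: h1 h2 h3; rewrite -/H -/Hp ler_norml => /andP[h1 _] h2 h3; lra.
Qed.

End Recovery.
End Certificate.

(** * From i.i.d. batches to uniform subsets *)

Section SubsetSampling.
Variables (R : rcfType) (I : finType).

(** Each set is listed before its complement, and elements at equal positions are matched. *)
Lemma perm_imset_card (S S' : {set I}) : #|S| = #|S'| -> exists p : {perm I}, p @: S = S'.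
Proof.
move=> eS.
have mem_split (A : {set I}) x : x \in enum A ++ enum (~: A).
  by rewrite mem_cat !mem_enum inE orbN.
have size_split (A : {set I}) : size (enum A ++ enum (~: A)) = #|I|.
  by rewrite size_cat -!cardE cardsC.
have uniq_split (A : {set I}) : uniq (enum A ++ enum (~: A)).
  rewrite cat_uniq !enum_uniq /= andbT; apply/hasPn => x.
  by rewrite !mem_enum inE.
pose s0 := enum S ++ enum (~: S); pose s1 := enum S' ++ enum (~: S').
have idx x : (index x s0 < size s1)%N by rewrite size_split -(size_split S) index_mem mem_split.
pose f x := nth x s1 (index x s0).
have injf : injective f.
  move=> x y; rewrite /f (set_nth_default y) // => /eqP.
  rewrite nth_uniq ?uniq_split // => /eqP e.
  by rewrite -(nth_index x (mem_split S x)) e nth_index ?mem_split.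
exists (perm injf); apply/eqP; rewrite eqEcard card_imset ?eS ?leqnn ?andbT; last exact: perm_inj.
apply/fintype.subsetP => _ /imsetP[x xS ->]; rewrite permE /f /s0 /s1 index_cat mem_enum xS.
have h : (index x (enum S) < size (enum S'))%N.
  by rewrite -cardE -eS cardE index_mem mem_enum.
by rewrite nth_cat h -mem_enum mem_nth.
Qed.

Lemma superset_card (A : {set I}) m : (#|A| <= m <= #|I|)%N ->
  exists2 S : {set I}, A \subset S & #|S| = m.
Proof.
move=> /andP[Am mI]; pose B := [set x in take (m - #|A|) (enum (~: A))].
have BA : B \subset ~: A.
  by apply/fintype.subsetP => x; rewrite inE => /mem_take; rewrite mem_enum.
exists (A :|: B); first exact: finset.subsetUl.
rewrite cardsU (_ : A :&: B = finset.set0) ?cards0 ?subn0; last first.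
  apply/setP => x; rewrite !inE; apply/negP => /andP[xA xB].
  by have := fintype.subsetP BA x; rewrite !inE xA xB => /(_ isT).
have -> : #|B| = (m - #|A|)%N.
  rewrite cardsE (card_uniqP _) ?take_uniq ?enum_uniq // size_takel //.
  by rewrite -cardE -(leq_add2l #|A|) cardsC subnKC.
by rewrite subnKC.
Qed.

Variables (T : finType) (act : {perm I} -> T -> T) (im : T -> {set I}) (g : pred T) (m : nat).
Hypothesis act_inj : forall p, injective (act p).
Hypothesis im_act : forall p t, im (act p t) = p @: im t.
Hypothesis im_card : forall t, (#|im t| <= m <= #|I|)%N.

Definition covers (S : {set I}) : bool := [exists t, g t && (im t \subset S)].

(* Averaging over all permutations of [I] turns any [m]-superset of [im t]
   into a uniform [m]-subset. *)
Lemma subset_sampling (eta : R) :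
  #|[pred t | ~~ g t]|%:R <= #|T|%:R * eta ->
  (0 < #|T|)%N ->
  #|[pred S : {set I} | (#|S| == m) && ~~ covers S]|%:R <= 'C(#|I|, m)%:R * eta.
Proof.
move=> hg T0.
pose bad (S : {set I}) := ~~ covers S.
pose F (S : {set I}) := #|[pred p : {perm I} | bad (p @: S)]|.
set B := #|_|.
have imM (p s : {perm I}) (S : {set I}) : p @: (s @: S) = (s * p)%g @: S.
  by rewrite -imset_comp; apply: eq_imset => x; rewrite permM.
(* Translation in the permutation group shows that the count depends only on the cardinality. *)
have F_const (S S' : {set I}) : #|S| = #|S'| -> F S = F S'.
  move=> /perm_imset_card[p <-]; rewrite /F -!sum1_card.
  rewrite (reindex_inj (mulgI p)) /=; apply: eq_bigl => s; rewrite !inE.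
  by rewrite imM.
have Fsum : (\sum_(S : {set I} | #|S| == m) F S = #|{perm I}| * B)%N.
  rewrite /F; under eq_bigr do rewrite -sum1_card big_mkcond.
  rewrite exchange_big /= -sum1_card big_distrl /=; apply: eq_bigr => p _.
  rewrite mul1n -big_mkcondr /= /B -sum1_card [in RHS](reindex_inj (imset_inj (@perm_inj _ p))).
  by apply: eq_bigl => S; rewrite !inE card_imset //; apply: perm_inj.
have FC (S : {set I}) : #|S| = m -> ('C(#|I|, m) * F S = #|{perm I}| * B)%N.
  move=> Sm; rewrite -Fsum (eq_bigr (fun=> F S)) => [|S' /eqP S'm]; last first.
    by apply: F_const; rewrite S'm.
  rewrite sum_nat_const -card_draws; congr (_ * _)%N.
  by apply: eq_card => A; rewrite !inE.
have hsup t : exists S : {set I}, (im t \subset S) && (#|S| == m).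
  by have [S h1 h2] := superset_card (im_card t); exists S; rewrite h1 h2 eqxx.
pose sup t := xchoose (hsup t).
have supP t : (im t \subset sup t) && (#|sup t| == m) := xchooseP (hsup t).
(* For fixed [p], if [p @: sup t] is bad then [act p t] fails [g]; injectivity of [act p] bounds the
   number of such [t]. *)
have key : (\sum_t F (sup t) <= #|{perm I}| * #|[pred t | ~~ g t]|)%N.
  rewrite /F; under eq_bigr do rewrite -sum1_card big_mkcond.
  rewrite exchange_big /= -sum1_card big_distrl /=; apply: leq_sum => p _.
  rewrite mul1n -big_mkcond sum1_card.
  apply: (@leq_trans #|[pred t | ~~ g (act p t)]|).
    apply: subset_leq_card; apply/fintype.subsetP => t; rewrite !inE; apply: contra => gt.
    apply/existsP; exists (act p t); rewrite gt im_act imsetS //.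
    by case/andP: (supP t).
  rewrite -(fintype.card_image (@act_inj p)) subset_leq_card //.
  by apply/fintype.subsetP => _ /fintype.imageP[t ht ->].
have key2 : (#|T| * B <= 'C(#|I|, m) * #|[pred t | ~~ g t]|)%N.
  have p0 : (0 < #|{perm I}|)%N by apply/card_gt0P; exists 1%g.
  rewrite -(leq_pmul2l p0) mulnCA -[X in (_ <= X)%N]mulnCA.
  apply: leq_trans (leq_mul (leqnn 'C(#|I|, m)) key).
  rewrite big_distrr /= (eq_bigr (fun=> (#|{perm I}| * B)%N)) => [|t _]; last first.
    by rewrite FC //; case/andP: (supP t) => _ /eqP.
  by rewrite sum_nat_const.
have TR : 0 < #|T|%:R :> R by rewrite ltr0n.
rewrite -(ler_pM2l TR) -natrM; apply: (@le_trans _ _ ('C(#|I|, m) * #|[pred t | ~~ g t]|)%:R).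
  by rewrite ler_nat.
by rewrite natrM [leRHS]mulrCA ler_wpM2l ?ler0n.
Qed.

End SubsetSampling.

(** * Permutations of positions acting on batches *)

Section BatchAction.
Variables (I : finType) (k m0 : nat).
Notation batch := {ffun 'I_m0 -> I}.

Definition batches_act (p : {perm I}) (t : k.-tuple batch) : k.-tuple batch :=
  [tuple of map (fun w : batch => [ffun s => p (w s)]) t].

Definition batches_im (t : k.-tuple batch) : {set I} :=
  [set tnth t x.1 x.2 | x : 'I_k * 'I_m0].

Lemma batches_act_inj p : injective (batches_act p).
Proof.
move=> t t' e; apply: val_inj; have /(congr1 val) /= := e.
apply: inj_map => w w' /ffunP h; apply/ffunP => s.
by have := h s; rewrite !ffunE => /perm_inj.
Qed.

Lemma batches_im_act p t : batches_im (batches_act p t) = p @: batches_im t.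
Proof.
rewrite /batches_im -imset_comp; apply: eq_imset => x /=.
by rewrite tnth_map ffunE.
Qed.

Lemma batches_im_card t : (#|batches_im t| <= k * m0)%N.
Proof.
apply: leq_trans (leq_imset_card _ _) _.
by rewrite card_prod !card_ord.
Qed.

Lemma mem_batches_im (t : k.-tuple batch) (w : batch) s : w \in tval t -> w s \in batches_im t.
Proof. by move=> /tnthP[i ->]; apply/imsetP; exists (i, s). Qed.

End BatchAction.

(** * Duality for the nuclear norm *)

Lemma sqn_col_orth (R : rcfType) n r (W : 'M[R]_(n, r)) k :
  W^T *m W = 1%:M -> sqn (col k W) = 1.
Proof.
move=> oW; have := congr1 (fun M : 'M[R]_r => M k k) oW; rewrite !mxE eqxx mulr1n => <-.
by rewrite sqn_colE; apply: eq_bigr => i _; rewrite mxE expr2.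
Qed.

Section SVDDuality.
Variables (R : rcfType) (m n : nat).
Variables (U : 'M[R]_m) (D : 'M[R]_(m, n)) (V : 'M[R]_n).
Hypotheses (oU : U^T *m U = 1%:M) (oV : V^T *m V = 1%:M).
Hypothesis D_diag : forall (i : 'I_m) (j : 'I_n), nat_of_ord i <> nat_of_ord j -> D i j = 0.
Hypothesis D_ge0 : forall i j, 0 <= D i j.

(** After conjugation by [U] and [V] the entries of [W] are its values on pairs of unit columns,
    hence at most one, and they are weighted by the nonnegative entries of [D]. *)
Lemma opn_le_svd (W : 'M[R]_(m, n)) : opn_le W 1 -> ip W (U *m D *m V^T) <= \sum_i \sum_j D i j.
Proof.
move=> hW; rewrite ipC ip_mulr trmxK ip_mull.
rewrite /ip; apply: ler_sum => i _; apply: ler_sum => j _.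
rewrite ler_piMr //.
have -> : (U^T *m (W *m V)) i j = ip (col i U) (W *m col j V).
  have -> : W *m col j V = col j (W *m V) by rewrite !colE mulmxA.
  rewrite mxE /ip; apply: eq_bigr => a _.
  by rewrite big_ord1 [in RHS]mxE [col j _ _ _]mxE [U^T _ _]mxE.
have := hW (col i U) (col j V); rewrite !sqn_col_orth //; lra.
Qed.

Definition diag_ones : 'M[R]_(m, n) := \matrix_(i, j) (nat_of_ord i == nat_of_ord j)%:R.

Lemma ip_svd_ones : ip (U *m diag_ones *m V^T) (U *m D *m V^T) = \sum_i \sum_j D i j.
Proof.
rewrite ip_mulr trmxK -[U *m D *m V^T *m V]mulmxA oV mulmx1 ip_mull mulmxA oU mul1mx.
rewrite /ip; apply: eq_bigr => i _; apply: eq_bigr => j _; rewrite mxE.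
by case: eqP => [_|/D_diag ->]; rewrite ?mul1r ?mulr0.
Qed.

(** Every row and column of [diag_ones] has at most one nonzero entry, so
    [2 * a * b <= a ^+ 2 + b ^+ 2] can be summed without repetition. *)
Lemma opn_ones : opn_le (U *m diag_ones *m V^T) 1.
Proof.
move=> x y; rewrite mul1r.
have sqT k (W : 'M[R]_k) (z : 'cV[R]_k) : W^T *m W = 1%:M -> sqn (W^T *m z) = sqn z.
  by move=> /mulmx1C oW; rewrite /sqn ip_mull trmxK mulmxA oW mul1mx.
rewrite -(sqT _ U x oU) -(sqT _ V y oV).
set a := U^T *m x; set b := V^T *m y.
have -> : ip x (U *m diag_ones *m V^T *m y) = ip a (diag_ones *m b).
  by rewrite -!mulmxA ipC ip_mull ipC.
clearbody a b.
have leq_sum1 k (i : nat) : \sum_(j < k) (i == j :> nat)%:R <= (1 : R).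
  have [ik|ik] := ltnP i k.
    rewrite (bigD1 (Ordinal ik)) //= eqxx big1 ?addr0 // => j /eqP nj.
    by case: eqP => // e; case: nj; apply: val_inj.
  rewrite big1 ?ler01 // => j _; case: eqP => // e.
  by have := ltn_ord j; rewrite -e ltnNge ik.
have e1 : 2 * ip a (diag_ones *m b) = \sum_i \sum_j (nat_of_ord i == nat_of_ord j)%:R * (2 * (a i 0 * b j 0)).
  rewrite /ip mulr_sumr; apply: eq_bigr => i _; rewrite big_ord1 mxE. rewrite !mulr_sumr.
  by apply: eq_bigr => j _; rewrite mxE; ring.
rewrite e1; apply: (@le_trans _ _ (\sum_i \sum_j (nat_of_ord i == nat_of_ord j)%:R * (a i 0 ^+ 2 + b j 0 ^+ 2))).
  apply: ler_sum => i _; apply: ler_sum => j _; rewrite ler_wpM2l ?ler0n //.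
  by have := sqr_ge0 (a i 0 - b j 0); rewrite sqrrB; lra.
under eq_bigr do under eq_bigr do rewrite mulrDr.
under eq_bigr do rewrite big_split; rewrite big_split /=; apply: lerD.
  rewrite sqnE; apply: ler_sum => i _; rewrite big_ord1 -mulr_suml.
  by rewrite ler_piMl ?sqr_ge0 //; apply: leq_sum1.
rewrite exchange_big sqnE; apply: ler_sum => j _; rewrite big_ord1 -mulr_suml.
rewrite ler_piMl ?sqr_ge0 //; under eq_bigr do rewrite eq_sym.
exact: leq_sum1.
Qed.

End SVDDuality.

(** * Pairings with the matrix to be recovered *)

Section LowRank.
Variables (R : rcfType) (n1 n2 r : nat) (U : 'M[R]_(n1, r)) (V : 'M[R]_(n2, r)) (sigma : 'I_r -> R).
Hypotheses (oU : U^T *m U = 1%:M) (oV : V^T *m V = 1%:M) (sigma_ge0 : forall k, 0 <= sigma k).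

Notation L := (\sum_(k < r) sigma k *: (col k U *m (col k V)^T)).

Lemma tanproj_rom : tanproj U V L = L.
Proof.
rewrite linear_sum; apply: eq_bigr => k _; rewrite linearZ /=; congr (_ *: _).
by rewrite colE -mulmxA tanproj_UX.
Qed.

Lemma ip_UVt_rom : ip (U *m V^T) L = \sum_k sigma k.
Proof.
rewrite ip_sumr; apply: eq_bigr => k _; rewrite ipZr.
rewrite ipC ip_mulr trmxK -mulmxA [col k V]colE (mulmxA V^T) oV mul1mx -colE.
by rewrite -/(sqn _) sqn_col_orth ?mulr1.
Qed.

Lemma opn_le_rom (W : 'M[R]_(n1, n2)) : opn_le W 1 -> ip W L <= \sum_k sigma k.
Proof.
move=> hW; rewrite ip_sumr; apply: ler_sum => k _; rewrite ipZr ler_piMr //.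
have := hW (col k U) (col k V); rewrite !sqn_col_orth //.
have -> : ip W (col k U *m (col k V)^T) = ip (col k U) (W *m col k V).
  by rewrite ipC ip_mulr trmxK.
lra.
Qed.

End LowRank.

(** * Random signs *)

Section RandomSigns.
Variables (R : rcfType) (n r : nat).
Notation signs := {ffun 'I_n -> bool}.

Definition sign_vec (e : signs) : 'cV[R]_n := \col_i (-1) ^+ e i.

Lemma sqn_sign_vec e : sqn (sign_vec e) = n%:R.
Proof.
rewrite sqnE (eq_bigr (fun=> 1)) => [|i _]; first by rewrite sumr_const card_ord.
by rewrite big_ord1 mxE -exprM mulnC exprM sqrrN !expr1n.
Qed.

(** A sign vector is a sample from [bool]: the terms [B s b], equal to row [s] of [A] or its
    opposite, have mean zero, so [csum] is the signed sum of rows and [vector_moment] applies. *)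
Lemma sign_count (A : 'M[R]_(n, r)) (t : R) q : 0 < t ->
  #|[pred e : signs | ~~ (sqn ((sign_vec e)^T *m A) <= t * sqn A)]|%:R <=
  #|{: signs}|%:R * vec_const R q.+1 * t ^- q.+1.
Proof.
move=> t0.
have b0 : (0 < #|{: bool}|)%N by rewrite card_bool.
pose B (s : 'I_n) (b : bool) : 'rV[R]_r := (-1) ^+ b *: row s A.
have sqB s b : sqn (B s b) = sqn (row s A).
  by rewrite sqnZ -exprM mulnC exprM sqrrN !expr1n mul1r.
have hc (e : signs) : csum B e = (sign_vec e)^T *m A.
  apply/rowP => j; rewrite /csum summxE mxE; apply: eq_bigr => s _.
  have -> : \sum_b B s b = 0.
    by rewrite big_bool /B /= expr0 expr1 scaleN1r scale1r addNr.
  by rewrite scaler0 subr0 !mxE.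
apply: (@markov_count _ _ _ (fun e => sqn ((sign_vec e)^T *m A)) q) => //.
- by move=> e; apply: sqn_ge0.
- by rewrite mulr_ge0 ?exprn_ge0 ?ler0n.
- exact: sqn_ge0.
under eq_bigr do rewrite -hc.
apply: vector_moment => //; first by move=> s b; rewrite sqB sqn_row_le.
have -> : \sum_s \sum_b sqn (B s b) = #|{: bool}|%:R * sqn A.
  rewrite sqn_row mulr_sumr; apply: eq_bigr => s _.
  by rewrite (eq_bigr (fun=> sqn (row s A))) // sumr_const mulr_natl.
by rewrite mulKf // pnatr_eq0 card_bool.
Qed.

(** The sign vector divided by the square root of [n] is a unit vector, hence row [i] of some
    orthogonal matrix. *)
Lemma sign_rotation (i : 'I_n) (e : signs) : exists Q : 'M[R]_n,
  Q^T *m Q = 1%:M /\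
  forall X : 'M[R]_(n, r), n%:R * sqn (row i (Q *m X)) = sqn ((sign_vec e)^T *m X).
Proof.
have n0 : 0 < n%:R :> R by rewrite ltr0n; case: (n) i => [[]|].
pose s := Num.sqrt (n%:R : R).
have s2 : s ^+ 2 = n%:R by rewrite sqr_sqrtr // ltW.
have sn : s != 0 by rewrite gt_eqF // sqrtr_gt0.
have [|Q [oQ cQ]] := @householder R n i (s^-1 *: sign_vec e).
  by rewrite sqnZ sqn_sign_vec exprVn s2 mulVf // gt_eqF.
exists Q^T; split; first by rewrite trmxK; apply: mulmx1C.
move=> X; rewrite row_mul -tr_col cQ linearZ /= -scalemxAl sqnZ exprVn s2 mulrA divff ?mul1r //.
by rewrite gt_eqF.
Qed.

End RandomSigns.

(** * Nuclear norm duality and exact recovery *)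

Section NuclearNorm.
Variable R : realType.

(** An SVD exists, so the choice operator [get] returns the sum attached to some SVD rather than its
    default. The next two lemmas identify this value as the maximum of [ip W X] over
    [opn_le W 1]. *)
Lemma nucnorm_svd m n (X : 'M[R]_(m, n)) :
  exists U D V, is_svd X U D V /\ nucnorm X = \sum_i \sum_j D i j.
Proof.
have [U [D [V [oU oV dD D0 eX]]]] := svd_exists X.
rewrite /nucnorm; case: xgetP => [y _ [U' [D' [V' [h ->]]]]|/(_ (\sum_i \sum_j D i j))[]].
  by exists U', D', V'.
by exists U, D, V.
Qed.

Lemma nucnorm_ge m n (X W : 'M[R]_(m, n)) : opn_le W 1 -> ip W X <= nucnorm X.
Proof.
move=> hW; have [U [D [V [[oU oV _ D0 ->] ->]]]] := nucnorm_svd X.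
exact: opn_le_svd.
Qed.

Lemma nucnorm_attained m n (X : 'M[R]_(m, n)) : exists W, opn_le W 1 /\ nucnorm X = ip W X.
Proof.
have [U [D [V [[oU oV dD D0 eX] ->]]]] := nucnorm_svd X.
exists (U *m diag_ones R m n *m V^T); split; first exact: opn_ones.
by rewrite [in ip _ X]eX ip_svd_ones.
Qed.

(** [W] acts as a subgradient at [M]. It pairs with [M] to the sum of the [sigma k], which bounds
    [nucnorm M], while [nucnorm X >= ip W X = ip W (X - M) + ip W M] with the first term
    positive. *)
Lemma exact_recovery_dual n1 n2 r (U : 'M[R]_(n1, r)) (V : 'M[R]_(n2, r)) (sigma : 'I_r -> R) (S : {set 'I_n1 * 'I_n2}) :
  U^T *m U = 1%:M -> V^T *m V = 1%:M -> (forall k, 0 < sigma k) ->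
  (forall D : 'M[R]_(n1, n2), (forall i j, (i, j) \in S -> D i j = 0) -> D != 0 ->
    exists W, [/\ opn_le W 1,
      forall A, tanproj U V A = A -> ip W A = ip (U *m V^T) A & 0 < ip W D]) ->
  exact_recovery S (rom_matrix sigma U V).
Proof.
move=> oU oV s0 h X hX /eqP nX; set M := rom_matrix sigma U V.
have s0' k : 0 <= sigma k by rewrite ltW.
have hD i j : (i, j) \in S -> (X - M) i j = 0 by move=> ij; rewrite mxE [X in _ + X]mxE hX // subrr.
have [|W [W1 WT W0]] := h (X - M) hD; first by rewrite subr_eq0.
have [W' [W'1 ->]] := nucnorm_attained M.
have h1 := opn_le_rom oU oV s0' W'1.
have h2 := nucnorm_ge X W1.
have h3 : ip W X = ip W (X - M) + ip W M by rewrite -ipDr subrK.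
have h4 : ip W M = \sum_k sigma k by rewrite WT ?tanproj_rom ?ip_UVt_rom.
by rewrite -/(rom_matrix sigma U V) -/M in h1; lra.
Qed.

End NuclearNorm.

(** * Probabilities as integrals of counts *)

Section IndicatorSums.
Local Open Scope ereal_scope.
Context d (T : measurableType d) (R : realType) (P : probability T R).
Variables (J : finType) (F : J -> set T).
Hypothesis mF : forall j, measurable (F j).

Lemma integral_count :
  \int[P]_t ((\sum_j \1_(F j) t)%R%:E) = (\sum_j fine (P (F j)))%R%:E.
Proof.
under eq_integral do rewrite -sumEFin.
rewrite ge0_integral_sum //=.
- rewrite -sumEFin; apply: eq_bigr => j _.
  by rewrite integral_indic // setIT fineK // fin_num_measure.
- by move=> j; apply/measurable_EFinP; exact: measurable_indic.
Qed.

Let count_measurable : measurable_fun setT (fun t => (\sum_j \1_(F j) t)%R%:E : \bar R).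
Proof.
apply/measurable_EFinP; apply: measurable_sum => j; exact: measurable_indic.
Qed.

(** The number of events [F j] occurring at [t] is integrated over [t]; this exchanges the
    randomness of [t] with the counting over [j]. *)
Lemma sum_prob_ge (G : set T) (kappa : R) : measurable G -> (0 <= kappa)%R ->
  (forall t, G t -> (kappa <= \sum_j \1_(F j) t)%R) ->
  (kappa * fine (P G) <= \sum_j fine (P (F j)))%R.
Proof.
move=> mG k0 h; rewrite -lee_fin -integral_count EFinM fineK ?fin_num_measure //.
have -> : kappa%:E * P G = \int[P]_t (kappa * \1_G t)%:E.
  rewrite (@integralZl_indic _ _ _ P setT _ (fun=> G)) // ?integral_indic ?setIT //.
  by move/lt_geF; rewrite k0.
apply: ge0_le_integral => //=.
- by move=> t _; rewrite lee_fin mulr_ge0.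
- apply/measurable_EFinP; apply: measurable_funM => //; exact: measurable_indic.
move=> t _; rewrite lee_fin; have [Gt|nGt] := pselect (G t).
  by rewrite indicE mem_set // mulr1 h.
by rewrite indicE memNset // mulr0 sumr_ge0.
Qed.

Lemma sum_prob_le (kappa : R) :
  (forall t, (\sum_j \1_(F j) t <= kappa)%R) -> (\sum_j fine (P (F j)) <= kappa)%R.
Proof.
move=> h; rewrite -lee_fin -integral_count.
have -> : kappa%:E = \int[P]_t (cst kappa%:E t) :> \bar R.
  rewrite integral_cst // -[LHS]mule1; congr (_ * _); apply: esym.
  exact: probability_setT.
by apply: ge0_le_integral => //= t _; rewrite lee_fin // sumr_ge0.
Qed.

End IndicatorSums.

(** * Measurability and the uniform frame *)

Section MatrixMeasurability.
Context d (T : measurableType d) (R : realType).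

Definition mxm (m n : nat) (A : T -> 'M[R]_(m, n)) : Prop :=
  forall i j, measurable_fun setT (fun t => A t i j).

Lemma mxm_cst m n (A : 'M[R]_(m, n)) : mxm (fun=> A).
Proof. by move=> i j; exact: measurable_cst. Qed.

Lemma mxm_add m n (A B : T -> 'M[R]_(m, n)) : mxm A -> mxm B -> mxm (fun t => A t + B t).
Proof.
move=> hA hB i j; under eq_fun do rewrite mxE.
exact: measurable_funD.
Qed.

Lemma mxm_opp m n (A : T -> 'M[R]_(m, n)) : mxm A -> mxm (fun t => - A t).
Proof.
move=> hA i j; under eq_fun do rewrite mxE.
exact: measurable_funN.
Qed.

Lemma mxm_sub m n (A B : T -> 'M[R]_(m, n)) : mxm A -> mxm B -> mxm (fun t => A t - B t).
Proof. by move=> hA hB; apply: mxm_add => //; apply: mxm_opp. Qed.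

Lemma mxm_mul m n p (A : T -> 'M[R]_(m, n)) (B : T -> 'M[R]_(n, p)) :
  mxm A -> mxm B -> mxm (fun t => A t *m B t).
Proof.
move=> hA hB i j; under eq_fun do rewrite mxE.
by apply: measurable_sum => k; exact: measurable_funM.
Qed.

Lemma mxm_tr m n (A : T -> 'M[R]_(m, n)) : mxm A -> mxm (fun t => (A t)^T).
Proof. by move=> hA i j; under eq_fun do rewrite mxE; exact: hA. Qed.

Lemma mxm_scale m n (f : T -> R) (A : T -> 'M[R]_(m, n)) :
  measurable_fun setT f -> mxm A -> mxm (fun t => f t *: A t).
Proof.
move=> hf hA i j; under eq_fun do rewrite mxE.
exact: measurable_funM.
Qed.

Lemma mxm_sum m n (J : Type) (s : seq J) (A : J -> T -> 'M[R]_(m, n)) :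
  (forall k, mxm (A k)) -> mxm (fun t => \sum_(k <- s) A k t).
Proof.
move=> hA i j; under eq_fun do rewrite summxE.
by apply: measurable_sum => k; exact: hA.
Qed.

Lemma mxm_dil m n (A : T -> 'M[R]_(m, n)) : mxm A -> mxm (fun t => dil (A t)).
Proof.
move=> hA i j; case: (split_ordP i) => i' ->; case: (split_ordP j) => j' ->.
- by under eq_fun do rewrite /dil block_mxEul mxE; exact: measurable_cst.
- by under eq_fun do rewrite /dil block_mxEur; exact: hA.
- by under eq_fun do rewrite /dil block_mxEdl mxE; exact: hA.
by under eq_fun do rewrite /dil block_mxEdr mxE; exact: measurable_cst.
Qed.

Lemma mxm_exp n (A : T -> 'M[R]_n) k : mxm A -> mxm (fun t => A t ^+ k).
Proof.
move=> hA; elim: k => [|k IH]; first exact: mxm_cst.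
under eq_fun do rewrite exprS.
exact: (mxm_mul hA IH).
Qed.

Lemma measurable_trace n (A : T -> 'M[R]_n) : mxm A -> measurable_fun setT (fun t => \tr (A t)).
Proof. by move=> hA; apply: measurable_sum => i; exact: hA. Qed.

Lemma measurable_sqn m n (A : T -> 'M[R]_(m, n)) : mxm A -> measurable_fun setT (fun t => sqn (A t)).
Proof.
move=> hA; apply: measurable_sum => i; apply: measurable_sum => j.
exact: measurable_funM.
Qed.

Lemma mxm_row m n (A : T -> 'M[R]_(m, n)) i : mxm A -> mxm (fun t => row i (A t)).
Proof. by move=> hA k j; under eq_fun do rewrite mxE; exact: hA. Qed.

Lemma measurable_all (J : Type) (s : seq J) (b : J -> T -> bool) :
  (forall j, measurable_fun setT (b j)) -> measurable_fun setT (fun t => all (fun j => b j t) s).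
Proof.
move=> h; elim: s => [|j s IH] /=; first exact: measurable_cst.
exact: measurable_and.
Qed.

Lemma measurable_forall (J : finType) (b : J -> T -> bool) :
  (forall j, measurable_fun setT (b j)) -> measurable_fun setT (fun t => [forall j, b j t]).
Proof.
move=> h; rewrite (_ : (fun t => _) = (fun t => all (fun j => b j t) (enum J))).
  exact: measurable_all.
apply/funext => t; apply/forallP/allP => [h1 j _|h1 j]; first exact: h1.
by apply: h1; rewrite mem_enum.
Qed.

Lemma measurable_exists (J : finType) (b : J -> T -> bool) :
  (forall j, measurable_fun setT (b j)) -> measurable_fun setT (fun t => [exists j, b j t]).
Proof.
move=> h; under eq_fun do rewrite -[[exists j, _]]negbK negb_exists.
apply: measurable_neg; apply: measurable_forall => j; exact: measurable_neg.
Qed.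

Lemma measurable_bool_set (b : T -> bool) : measurable_fun setT b -> measurable [set t | b t].
Proof.
move=> hb; rewrite (_ : [set t | b t] = setT `&` b @^-1` [set true]).
  exact: hb.
by rewrite setTI; apply/seteqP; split => t.
Qed.

Section Golf.
Variables (n1 n2 r m0 : nat) (h tau : R) (q : nat).
Variables (U : T -> 'M[R]_(n1, r)) (V : T -> 'M[R]_(n2, r)).
Hypotheses (mU : mxm U) (mV : mxm V).

Lemma mxm_tanproj (Z : T -> 'M[R]_(n1, n2)) : mxm Z -> mxm (fun t => tanproj (U t) (V t) (Z t)).
Proof.
move=> hZ; have hU := mxm_mul mU (mxm_tr mU); have hV := mxm_mul mV (mxm_tr mV).
apply: mxm_sub; first by apply: mxm_add; apply: mxm_mul.
by apply: mxm_mul => //; apply: mxm_mul.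
Qed.

Lemma mxm_samp (w : {ffun 'I_m0 -> 'I_n1 * 'I_n2}) (Z : T -> 'M[R]_(n1, n2)) :
  mxm Z -> mxm (fun t => samp w (Z t)).
Proof.
move=> hZ; apply: mxm_sum => s; apply: mxm_scale; last exact: mxm_cst.
by apply: measurable_funM; [exact: measurable_cst|exact: hZ].
Qed.

Lemma mxm_next w (Z : T -> 'M[R]_(n1, n2)) :
  mxm Z -> mxm (fun t => @golf_step R n1 n2 r m0 (U t) (V t) (Z t) w).
Proof. by move=> hZ; apply: mxm_sub => //; apply: mxm_tanproj; apply: mxm_samp. Qed.

Lemma measurable_frob_golf ws (Z : T -> 'M[R]_(n1, n2)) : mxm Z ->
  measurable_fun setT (fun t =>
    golf (@golf_step R n1 n2 r m0 (U t) (V t)) (@frob_ok R n1 n2 r m0 (U t) (V t) h) (Z t) ws).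
Proof.
elim: ws Z => [|w ws IH] Z hZ /=; first exact: measurable_cst.
have hn := mxm_next w hZ.
apply: measurable_and; last exact: IH hn.
apply: measurable_fun_ler; first exact: measurable_sqn.
by apply: measurable_funM; [exact: measurable_cst|exact: measurable_sqn].
Qed.

Lemma measurable_main_golf ws (Z : T -> 'M[R]_(n1, n2)) : mxm Z ->
  measurable_fun setT (fun t =>
    golf (@golf_step R n1 n2 r m0 (U t) (V t)) (@main_ok R n1 n2 r m0 (U t) (V t) h tau q) (Z t) ws).
Proof.
elim: ws Z => [|w ws IH] Z hZ /=; first exact: measurable_cst.
have hn := mxm_next w hZ.
apply: measurable_and; last exact: IH hn.
apply: measurable_and.
  apply: measurable_fun_ler; last exact: measurable_cst.
  apply: measurable_trace; apply: mxm_exp; apply: mxm_dil; apply: mxm_sub => //.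
  exact: mxm_samp.
apply: measurable_fun_ler; first exact: measurable_sqn.
by apply: measurable_funM; [exact: measurable_cst|exact: measurable_sqn].
Qed.

End Golf.
End MatrixMeasurability.

(** * Row norms of a uniform frame *)

Section UniformFrame.
Context d (T : measurableType d) (R : realType) (P : probability T R).
Variables (n r : nat) (U : T -> 'M[R]_(n, r)).
Hypothesis unifU : uniform_frame P U.

Lemma uniform_frame_mxm : mxm U.
Proof.
case: unifU => _ mU _ i j _ B mB; rewrite setTI.
by apply: (mU [set X | B (X i j)]); apply: sub_sigma_algebra; exists i, j, B.
Qed.

(** The matrices are equipped with the sigma-algebra generated by the entries. The identity map is
    then entrywise measurable, and the general lemmas apply to it. *)
Lemma mx_borel_sqn_row (i : 'I_n) (c : R) :
  mx_borel [set X : 'M[R]_(n, r) | ~~ (sqn (row i X) <= c)].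
Proof.
rewrite /mx_borel; set G := (X in <<s X >>).
pose MT : pointedType := HB.pack 'M[R]_(n, r) (isPointed.Build 'M[R]_(n, r) 0).
pose GT := @g_sigma_algebraType MT G : measurableType (@sigma_display MT G).
have mid : @mxm _ GT R n r id.
  by move=> k l _ B mB; rewrite setTI; apply: sub_sigma_algebra; exists k, l, B.
have := @measurable_bool_set _ GT
   (fun X => ~~ (sqn (row i (X : 'M[R]_(n, r))) <= c)).
apply; apply: measurable_neg; apply: measurable_fun_ler; last exact: measurable_cst.
apply: measurable_sqn; exact: (mxm_row i mid).
Qed.

(* By invariance, row [i] may be replaced by a sign combination of all the rows, for
   every choice of the signs; for a fixed frame few choices exceed the bound. *)
Lemma uniform_row_tail (i : 'I_n) (t : R) q : 0 < t ->
  fine (P [set x | ~~ (sqn (row i (U x)) <= t * (r%:R / n%:R))]) <= vec_const R q.+1 * t ^- q.+1.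
Proof.
move=> t0; set c := t * _.
have n0 : 0 < n%:R :> R by rewrite ltr0n; case: (n) i => [[]|].
pose B := [set X : 'M[R]_(n, r) | ~~ (sqn (row i X) <= c)].
have sqU x : sqn (U x) = r%:R.
  by case: unifU => oU _ _; rewrite /sqn ip_tr oU mxtrace1.
pose F (e : {ffun 'I_n -> bool}) : set T := [set x | ~~ (sqn ((sign_vec R e)^T *m U x) <= t * r%:R)].
have mF e : measurable (F e).
  apply: measurable_bool_set; apply: measurable_neg; apply: measurable_fun_ler; last exact: measurable_cst.
  by apply: measurable_sqn; apply: mxm_mul; [exact: mxm_cst|exact: uniform_frame_mxm].
have PF e : P (F e) = P [set x | ~~ (sqn (row i (U x)) <= c)].
  have [Q [oQ hQ]] := @sign_rotation R n r i e.
  case: unifU => _ _ /(_ Q B oQ (mx_borel_sqn_row i c)) eP.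
  have eqF x : (sqn ((sign_vec R e)^T *m U x) <= t * r%:R) = (sqn (row i (Q *m U x)) <= c).
    by rewrite -hQ /c mulrA ler_pdivlMr // mulrC.
  rewrite [RHS]eP; congr (P _); apply/seteqP; split => x; rewrite /F /= eqF //.
have : \sum_e fine (P (F e)) <= #|{: {ffun 'I_n -> bool}}|%:R * vec_const R q.+1 * t ^- q.+1.
  apply: sum_prob_le => // x; apply: le_trans (sign_count (U x) q t0).
  rewrite sqU -sum1_card natr_sum [leRHS]big_mkcond; apply: ler_sum => e _ /=.
  rewrite indicE inE; case: ifPn => he; first by case: (_ \in _).
  by have -> : (x \in F e) = false by apply: memNset; rewrite /F /= => h; rewrite h in he.
under eq_bigr do rewrite PF.
rewrite sumr_const -[X in X <= _]mulr_natl -mulrA ler_pM2l //.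
by rewrite ltr0n; apply/card_gt0P; exists [ffun=> true].
Qed.

End UniformFrame.

(** * Probability of recovery *)

Section GoodBatches.
Variables (R : realType) (n1 n2 r m0 k : nat) (h tau : R) (q : nat).
Notation I := ('I_n1 * 'I_n2)%type.
Notation batch := {ffun 'I_m0 -> I}.

(* The run from [U V^T] produces the dual certificate; the runs from the [PT e_ij] give
   the injectivity on the tangent space. *)
Definition good_batches (U : 'M[R]_(n1, r)) (V : 'M[R]_(n2, r)) (ws : k.-tuple batch) : bool :=
  golf (@golf_step R n1 n2 r m0 U V) (@main_ok R n1 n2 r m0 U V h tau q) (U *m V^T) ws &&
  [forall a : I, golf (@golf_step R n1 n2 r m0 U V) (@frob_ok R n1 n2 r m0 U V h)
                   (tanproj U V (delta_mx a.1 a.2)) ws].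

Section Deterministic.
Variables (U : 'M[R]_(n1, r)) (V : 'M[R]_(n2, r)).
Hypotheses (n1_gt0 : (0 < n1)%N) (n2_gt0 : (0 < n2)%N) (m0_gt0 : (0 < m0)%N).
Hypotheses (oU : U^T *m U = 1%:M) (oV : V^T *m V = 1%:M).
Hypotheses (h_ge1 : 1 <= h) (tau_gt0 : 0 < tau).

Lemma sqn_UVt : sqn (U *m V^T) = r%:R.
Proof. by rewrite /sqn ip_mulr trmxK -mulmxA oV mulmx1 ip_tr oU mxtrace1. Qed.

Lemma sqn_tanproj_le (X : 'M[R]_(n1, n2)) : sqn (tanproj U V X) <= sqn X.
Proof.
have -> : sqn X = sqn (tanproj U V X + (X - tanproj U V X)) by rewrite addrC subrK.
by rewrite sqnD ip_tan_perp // mulr0 addr0 lerDl sqn_ge0.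
Qed.

(** [eps] bounds the residual of the run from [U *m V^T], of squared norm [r]; [eps1] bounds those
    of the runs from the projected basis matrices, of norm at most one. The bound on [k%:R * tau]
    keeps the certificate below one half off the tangent space. *)
Lemma good_batches_recover (sigma : 'I_r -> R) (ws : k.-tuple batch) (S : {set I}) (eps eps1 : R) :
  (forall l, 0 < sigma l) -> 0 <= eps -> 0 <= eps1 ->
  h ^- k * r%:R <= eps ^+ 2 -> h ^- k <= eps1 ^+ 2 -> k%:R * tau <= 2^-1 ->
  (n1 * n2)%:R * eps1 <= 2^-1 ->
  eps * (2 * (n1 * n2)%:R * (k%:R * (n1 * n2)%:R)) < 2^-1 ->
  good_batches U V ws -> batches_im ws \subset S ->
  exact_recovery S (rom_matrix sigma U V).
Proof.
move=> s0 eps0 eps10 he he1 htau hN1 hN2 /andP[gm /forallP gf] imS.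
have wsS w : w \in tval ws -> forall s, w s \in S.
  by move=> hw s; apply: (fintype.subsetP imS); apply: mem_batches_im.
apply: exact_recovery_dual => // D hD nD.
have size_ws : size ws = k by rewrite size_tuple.
pose Y := certif U V (U *m V^T) ws.
have gm' := golf_frob gm.
apply: (@dual_recovery R n1 n2 r U V n1_gt0 n2_gt0 oU oV S Y eps eps1 (k%:R * (n1 * n2)%:R)) => //.
- by move=> i j ij; apply: certif_supp ij.
- rewrite nf_le //; have := certif_residual h_ge1 gm'.
  by rewrite size_ws sqn_UVt => /le_trans; apply.
- have := certif_opn oU oV tau_gt0 (PT_UVt V oU) gm; rewrite size_ws => hY x y.
  by apply: le_trans (hY x y) _; rewrite ler_wpM2r // addr_ge0 ?sqn_ge0.
move=> a b; have gab := gf (a, b).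
pose Z := tanproj U V (delta_mx a b).
have nZ : nf Z <= 1.
  rewrite nf_le ?ler01 // expr1n; apply: le_trans (sqn_tanproj_le _) _.
  by rewrite /sqn ip_delta mxE !eqxx.
exists (certif U V Z ws); split.
- by move=> i j ij; apply: certif_supp ij.
- rewrite nf_le //; apply: le_trans he1.
  apply: le_trans (certif_residual h_ge1 gab) _.
  rewrite size_ws ler_piMr ?invr_ge0 ?exprn_ge0 ?(le_trans ler01) //.
  by move: nZ; rewrite nf_le ?ler01 // expr1n.
apply: le_trans (certif_nf n1_gt0 n2_gt0 m0_gt0 h_ge1 gab) _.
by rewrite size_ws ler_wpM2l ?ler0n // ler_piMr ?ler0n.
Qed.

Variables (nu1 nu2 : R).
Hypotheses (hU : forall i, sqn (row i U) <= nu1) (hV : forall j, sqn (row j V) <= nu2).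
Hypothesis h_theta : gam R n1 n2 m0 * (nu1 + nu2) <= h ^- 2.

(** [B] bounds together the three dimension factors: the size of the dilation, the number of vector
    events per step, and the number of runs from basis matrices. *)
Lemma good_batches_count (B : R) :
  (n1 + n2)%:R <= B -> (1 + (n1 * n2 + n1 + n2))%:R <= B -> (n1 * n2)%:R <= B ->
  #|[pred ws : k.-tuple batch | ~~ good_batches U V ws]|%:R <=
  #|{: k.-tuple batch}|%:R *
    (k%:R * (mat_const R q.+1 1 * tau ^- (2 * q.+1) + 2 * vec_const R q.+1) * (B * h ^- q.+1)).
Proof.
move=> hB1 hB2 hB3.
have h0 : 0 < h := lt_le_trans ltr01 h_ge1.
set M := #|{: k.-tuple batch}|%:R; have M0 : 0 <= M :> R by rewrite ler0n.
have v0 : 0 <= vec_const R q.+1 by rewrite mulr_ge0 ?exprn_ge0 ?ler0n.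
have hi0 : 0 <= h ^- q.+1 by rewrite invr_ge0 exprn_ge0 // ltW.
set cv := vec_const R q.+1 * h ^- q.+1.
have cv0 : 0 <= cv by apply: mulr_ge0.
have c1 := main_golf_count q n1_gt0 n2_gt0 m0_gt0 oU oV hU hV h_ge1 h_theta tau_gt0 k
  (PT_UVt V oU) (invb_UVt oU oV hU hV).
have c2 (a : I) := frob_golf_count q n1_gt0 n2_gt0 m0_gt0 oU oV hU hV h_ge1 h_theta k
  (tanproj_idem oU oV (delta_mx a.1 a.2)).
set g1 : pred (k.-tuple batch) := fun ws => golf (@golf_step R n1 n2 r m0 U V)
  (@main_ok R n1 n2 r m0 U V h tau q) (U *m V^T) ws.
set g2 : I -> pred (k.-tuple batch) := fun a ws => golf (@golf_step R n1 n2 r m0 U V)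
  (@frob_ok R n1 n2 r m0 U V h) (tanproj U V (delta_mx a.1 a.2)) ws.
have d1 : #|[pred ws | ~~ good_batches U V ws]|%:R <=
    #|[pred ws | ~~ g1 ws]|%:R + \sum_a #|[pred ws | ~~ g2 a ws]|%:R :> R.
  rewrite -natr_sum -natrD ler_nat.
  apply: leq_trans (card_negb_and g1 (fun ws => [forall a, g2 a ws])) _.
  by rewrite leq_add2l card_negb_forall.
apply: le_trans d1 _.
have d2 : \sum_a #|[pred ws | ~~ g2 a ws]|%:R <= (n1 * n2)%:R * (M * (k%:R * cv)).
  rewrite -(cardI n1 n2) mulr_natl -sumr_const; apply: ler_sum => a _; exact: c2.
apply: le_trans (lerD c1 d2) _; rewrite -/M.
set st := step_const _ _ _ _ _ _ _ _.
have d3 : st <= (mat_const R q.+1 1 * tau ^- (2 * q.+1) + vec_const R q.+1) * (B * h ^- q.+1).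
  rewrite /st /step_const mulrDl; apply: lerD.
    have nu0 : 0 <= gam R n1 n2 m0 * (nu1 + nu2).
      rewrite mulr_ge0 ?(ltW (gam_gt0 _ _ _ _)) // addr_ge0 //.
        exact: le_trans (sqn_ge0 _) (hU (Ordinal n1_gt0)).
      exact: le_trans (sqn_ge0 _) (hV (Ordinal n2_gt0)).
    (* The constant is linear in the dimension, which is split off to be bounded by [B]. *)
    have e1 : mat_const R q.+1 (n1 + n2) = mat_const R q.+1 1 * (n1 + n2)%:R.
      by rewrite /mat_const; ring.
    have mc0 : 0 <= mat_const R q.+1 1 by rewrite /mat_const !mulr_ge0 ?exprn_ge0 ?ler0n.
    rewrite e1 expr_div_n -exprM; move: mc0; set c := mat_const _ _ _ => mc0.
    set y := gam R n1 n2 m0 * _ in nu0 *.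
    have hy : (n1 + n2)%:R * y ^+ q.+1 <= B * h ^- q.+1.
      apply: ler_pM; rewrite ?ler0n ?exprn_ge0 //.
      rewrite -exprVn lerXn2r ?nnegrE ?invr_ge0 ?(ltW h0) //.
      apply: le_trans h_theta _; rewrite lef_pV2 ?posrE ?exprn_gt0 //.
      by rewrite ler_eXnr.
    have -> : c * (n1 + n2)%:R * (y ^+ q.+1 / tau ^+ (2 * q.+1)) =
       c * tau ^- (2 * q.+1) * ((n1 + n2)%:R * y ^+ q.+1) by ring.
    by rewrite ler_wpM2l // mulr_ge0 // invr_ge0 exprn_ge0 // ltW.
  by rewrite mulrCA ler_wpM2l // ler_wpM2r.
have d4 : (n1 * n2)%:R * cv <= vec_const R q.+1 * (B * h ^- q.+1).
  by rewrite /cv mulrCA ler_wpM2l // ler_wpM2r.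
have -> : M * (k%:R * st) + (n1 * n2)%:R * (M * (k%:R * cv)) =
    M * (k%:R * (st + (n1 * n2)%:R * cv)) by ring.
rewrite -[X in _ <= M * X]mulrA ler_wpM2l // ler_wpM2l ?ler0n //.
have -> : (mat_const R q.+1 1 * tau ^- (2 * q.+1) + 2 * vec_const R q.+1) * (B * h ^- q.+1) =
  (mat_const R q.+1 1 * tau ^- (2 * q.+1) + vec_const R q.+1) * (B * h ^- q.+1) +
  vec_const R q.+1 * (B * h ^- q.+1) by ring.
exact: lerD.
Qed.

End Deterministic.

Lemma measurable_good_batches d (T : measurableType d) (U : T -> 'M[R]_(n1, r))
  (V : T -> 'M[R]_(n2, r)) ws : mxm U -> mxm V ->
  measurable_fun setT (fun t => good_batches (U t) (V t) ws).
Proof.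
move=> mU mV; apply: measurable_and.
  by apply: measurable_main_golf => //; apply: mxm_mul => //; apply: mxm_tr.
apply: measurable_forall => a; apply: measurable_frob_golf => //.
by apply: mxm_tanproj => //; exact: mxm_cst.
Qed.

End GoodBatches.

(** * Choice of exponents and probability of recovery *)

Section Assembly.
Variable R : realType.

(** It depends only on the number of batches and the moment exponents. The first term counts bad
    batches, its [4] coming from the dimension bound [4 * h ^+ 40]; the second bounds the
    incoherence failures of the two frames. *)
Definition fail_const (k p pH : nat) : R :=
  4 * (k%:R * (mat_const R p 1 * (2 * k)%:R ^+ (2 * p) + 2 * vec_const R p)) + 2 * vec_const R pH.

Section Recovery.
Variables (n1 n2 r m k m0 q qH : nat) (sigma : 'I_r -> R).
Context d (T : measurableType d) (P : probability T R).
Variables (U : T -> 'M[R]_(n1, r)) (V : T -> 'M[R]_(n2, r)) (h : R).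
Notation I := ('I_n1 * 'I_n2)%type.
Notation batch := {ffun 'I_m0 -> I}.
Hypotheses (r_gt0 : (0 < r)%N) (r_le : (r <= minn n1 n2)%N) (m0_gt0 : (0 < m0)%N).
Hypotheses (m_ge : (k * m0 <= m)%N) (m_le : (m <= n1 * n2)%N).
(** With [n = h ^+ 20], the target [n ^- 3] is [h ^- 60]. The union over entries costs [h ^+ 40], so
    [q.+1 = 40 + 60]. The union over the rows of a frame costs [h ^+ 20], and each row tail uses
    [t = h ^+ 2], so [2 * qH.+1 = 20 + 60]. Of the [k] contractions, [20] pay for [r <= h ^+ 20] and
    [200] remain. *)
Hypotheses (kE : k = (20 + 200)%N) (qE : q.+1 = (40 + 60)%N) (qHE : (2 * qH.+1 = 20 + 60)%N).
Hypotheses (sigma_gt0 : forall l, 0 < sigma l).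
Hypotheses (unifU : uniform_frame P U) (unifV : uniform_frame P V).
Hypotheses (h_ge1 : 1 <= h) (hE : (maxn n1 n2)%:R = h ^+ 20).
Hypotheses (m0_ge : 2 * h ^+ 24 * r%:R <= m0%:R) (h_large : (4 * k)%:R < h ^+ 20).

(** The [k] steps together contribute [k%:R * tau], which is one half. *)
Let tau : R := ((2 * k)%:R)^-1.
Let nu1 : R := h ^+ 2 * (r%:R / n1%:R).
Let nu2 : R := h ^+ 2 * (r%:R / n2%:R).
Let good (t : T) : pred (k.-tuple batch) := good_batches h tau q (U t) (V t).
Let incoherent (t : T) : bool :=
  [forall i, sqn (row i (U t)) <= nu1] && [forall j, sqn (row j (V t)) <= nu2].
(** The test on [#|S|] makes the event empty for other cardinalities, so sums may run over all
    subsets. *)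
Let recset (S : {set I}) : set T :=
  [set t | [&& #|S| == m, incoherent t & covers (@batches_im I k m0) (good t) S]].

Let h_gt0 : 0 < h. Proof. exact: lt_le_trans ltr01 h_ge1. Qed.
Let k_gt0 : (0 < k)%N. Proof. by rewrite kE. Qed.
Let n1_gt0 : (0 < n1)%N. Proof. by apply: leq_trans r_gt0 (leq_trans r_le (geq_minl _ _)). Qed.
Let n2_gt0 : (0 < n2)%N. Proof. by apply: leq_trans r_gt0 (leq_trans r_le (geq_minr _ _)). Qed.
Let tau_gt0 : 0 < tau. Proof. by rewrite invr_gt0 ltr0n muln_gt0. Qed.
Let n1_le : n1%:R <= h ^+ 20. Proof. by rewrite -hE ler_nat leq_maxl. Qed.
Let n2_le : n2%:R <= h ^+ 20. Proof. by rewrite -hE ler_nat leq_maxr. Qed.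
Let r_le_h : r%:R <= h ^+ 20.
Proof. by apply: le_trans n1_le; rewrite ler_nat (leq_trans r_le) ?geq_minl. Qed.
Let N_le : (n1 * n2)%:R <= h ^+ 40.
Proof. by rewrite natrM (exprD h 20 20) ler_pM ?ler0n. Qed.
Let h20 : 2 <= h ^+ 20.
Proof.
apply: ltW; apply: le_lt_trans h_large; rewrite ler_nat.
exact: leq_trans (leq_pmulr 4 k_gt0).
Qed.

Let orthU t : (U t)^T *m U t = 1%:M. Proof. by case: unifU => h1 _ _; exact: h1. Qed.
Let orthV t : (V t)^T *m V t = 1%:M. Proof. by case: unifV => h1 _ _; exact: h1. Qed.

(** The left side equals [h ^+ 2 * (n1 + n2) * r / m0], where [n1 + n2] is at most [2 * h ^+ 20].
    This is the origin of the factor [2 * h ^+ 24] in [m0_ge]. *)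
Let theta_le : gam R n1 n2 m0 * (nu1 + nu2) <= h ^- 2.
Proof.
have p1 : n1%:R != 0 :> R by rewrite pnatr_eq0 -lt0n.
have p2 : n2%:R != 0 :> R by rewrite pnatr_eq0 -lt0n.
have p0 : 0 < m0%:R :> R by rewrite ltr0n.
have -> : gam R n1 n2 m0 * (nu1 + nu2) = h ^+ 2 * (n1%:R + n2%:R) * r%:R / m0%:R.
  by rewrite /gam /nu1 /nu2 natrM; field; rewrite p1 p2 gt_eqF.
rewrite ler_pdivrMr // ler_pdivlMl ?exprn_gt0 //; apply: le_trans m0_ge.
have -> : h ^+ 2 * (h ^+ 2 * (n1%:R + n2%:R) * r%:R) = h ^+ 4 * r%:R * (n1%:R + n2%:R) by ring.
rewrite (exprD h 4 20) (_ : 2 * (h ^+ 4 * h ^+ 20) * r%:R = h ^+ 4 * r%:R * (h ^+ 20 + h ^+ 20)); last by ring.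
by rewrite ler_wpM2l ?lerD // mulr_ge0 ?ler0n // exprn_ge0 // ltW.
Qed.

Lemma recset_recovers (S : {set I}) (t : T) : #|S| = m -> recset S t ->
  exact_recovery S (rom_matrix sigma (U t) (V t)).
Proof.
move=> Sm /= /and3P[_ _ /existsP[ws /andP[gws imS]]].
have hk : k%:R / h ^+ 20 < 4^-1.
  by rewrite ltr_pdivrMr ?exprn_gt0 // -ltr_pdivrMl ?invr_gt0 // invrK -natrM.
have hi j : 0 < h ^- j by rewrite invr_gt0 exprn_gt0.
have e100 : (h ^- 100) ^+ 2 = h ^- 200 by rewrite exprVn -exprM.
have e110 : (h ^- 110) ^+ 2 = h ^- 220 by rewrite exprVn -exprM.
(* [eps ^+ 2 = h ^- 200] dominates [h ^- 220 * r], and [eps1 ^+ 2] is exactly [h ^- k]. The last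
   condition reduces to [2 * k / h ^+ 20 < 1 / 2], which is [h_large]. *)
apply: (good_batches_recover n1_gt0 n2_gt0 m0_gt0 (orthU t) (orthV t) h_ge1 tau_gt0
  (eps := h ^- 100) (eps1 := h ^- 110) sigma_gt0 (ltW (hi _)) (ltW (hi _)) _ _ _ _ _ gws imS).
- rewrite e100 kE exprD invfM mulrAC ler_piMl ?(ltW (hi _)) //.
  by rewrite mulrC ler_pdivrMr ?exprn_gt0 // mul1r.
- by rewrite e110 kE.
- by rewrite /tau natrM invfM mulrCA divff ?mulr1 // pnatr_eq0 -lt0n.
- apply: (@le_trans _ _ (h ^+ 40 * h ^- 110)); first by rewrite ler_wpM2r // ltW.
  rewrite ler_pdivrMr ?exprn_gt0 // (exprD h 70 40) mulrA ler_peMl ?exprn_ge0 ?(ltW h_gt0) //.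
  rewrite -ler_pdivrMl ?invr_gt0 // invrK mulr1; apply: le_trans h20 _.
  by rewrite ler_weXn2l.
have N0 : 0 <= (n1 * n2)%:R :> R by rewrite ler0n.
have k0 : 0 <= k%:R :> R by rewrite ler0n.
have hNN : (n1 * n2)%:R * (n1 * n2)%:R <= h ^+ 80 by rewrite (exprD h 40 40) ler_pM.
apply: (@le_lt_trans _ _ (h ^- 100 * (2 * k%:R * h ^+ 80))).
  rewrite ler_wpM2l ?(ltW (hi _)) //.
  have -> : 2 * (n1 * n2)%:R * (k%:R * (n1 * n2)%:R) = 2 * k%:R * ((n1 * n2)%:R * (n1 * n2)%:R) :> R by ring.
  by rewrite ler_wpM2l ?mulr_ge0.
have -> : h ^- 100 * (2 * k%:R * h ^+ 80) = 2 * (k%:R / h ^+ 20).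
  by rewrite (exprD h 20 80); field; rewrite gt_eqF.
lra.
Qed.

Let eta : R := 4 * (k%:R * (mat_const R q.+1 1 * (2 * k)%:R ^+ (2 * q.+1) + 2 * vec_const R q.+1)) * h ^- 60.

Lemma bad_batches (t : T) : incoherent t ->
  #|[pred ws | ~~ good t ws]|%:R <= #|{: k.-tuple batch}|%:R * eta.
Proof.
move=> /andP[/forallP hU /forallP hV].
have h20ge0 : 0 <= h ^+ 20 by rewrite exprn_ge0 // ltW.
have h2040 : h ^+ 20 <= h ^+ 40 by rewrite ler_weXn2l.
have h1 : 1 <= h ^+ 20 by rewrite exprn_ege1.
have := @good_batches_count R n1 n2 r m0 k h tau q (U t) (V t) n1_gt0 n2_gt0 m0_gt0
  (orthU t) (orthV t) h_ge1 tau_gt0 nu1 nu2 hU hV theta_le (4 * h ^+ 40).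
have a1 : (n1 + n2)%:R <= 4 * h ^+ 40 by rewrite natrD; have := n1_le; have := n2_le; lra.
have a2 : (1 + (n1 * n2 + n1 + n2))%:R <= 4 * h ^+ 40.
  by rewrite !natrD; have := n1_le; have := n2_le; have := N_le; lra.
have a3 : (n1 * n2)%:R <= 4 * h ^+ 40 by have := N_le; lra.
move=> /(_ a1 a2 a3) h3; apply: le_trans h3 _.
rewrite ler_wpM2l ?ler0n // le_eqVlt; apply/orP; left; apply/eqP.
rewrite /eta /tau exprVn invrK; move: (k%:R * _) => x.
by rewrite qE (exprD h 40 60); field; rewrite gt_eqF.
Qed.

Let incoherent_measurable : measurable_fun setT incoherent.
Proof.
have mU := uniform_frame_mxm unifU; have mV := uniform_frame_mxm unifV.
by apply: measurable_and; apply: measurable_forall => i; apply: measurable_fun_ler;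
  try exact: measurable_cst; apply: measurable_sqn; apply: mxm_row.
Qed.

Lemma recset_measurable (S : {set I}) : measurable (recset S).
Proof.
have mU := uniform_frame_mxm unifU; have mV := uniform_frame_mxm unifV.
apply: measurable_bool_set; apply: measurable_and; first exact: measurable_cst.
apply: measurable_and => //; apply: measurable_exists => ws.
by apply: measurable_and; [exact: measurable_good_batches|exact: measurable_cst].
Qed.

Lemma incoherent_prob : 1 - 2 * vec_const R qH.+1 * h ^- 60 <= fine (P [set t | incoherent t]).
Proof.
have mU := uniform_frame_mxm unifU; have mV := uniform_frame_mxm unifV.
have mG : measurable [set t | incoherent t] by exact: measurable_bool_set.
pose B (j : 'I_n1 + 'I_n2) : set T :=
  match j with inl i => [set t | ~~ (sqn (row i (U t)) <= nu1)]
             | inr i => [set t | ~~ (sqn (row i (V t)) <= nu2)] end.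
have mB j : measurable (B j).
  by case: j => i; apply: measurable_bool_set; apply: measurable_neg; apply: measurable_fun_ler;
  try exact: measurable_cst; apply: measurable_sqn; apply: mxm_row.
have h1 : 1 * fine (P (~` [set t | incoherent t])) <= \sum_j fine (P (B j)).
  apply: sum_prob_ge => //; first exact: measurableC.
  move=> t /= /negP; rewrite negb_and => /orP[] /forallPn[i hi].
    rewrite (bigD1 (inl i)) //= indicE mem_set // lerDl.
    by apply: sumr_ge0 => j _; rewrite indicE ler0n.
  rewrite (bigD1 (inr i)) //= indicE mem_set // lerDl.
  by apply: sumr_ge0 => j _; rewrite indicE ler0n.
have hh : (h ^+ 2) ^- qH.+1 = h ^- 80 by rewrite -exprM qHE.
have t0 : 0 < h ^+ 2 by rewrite exprn_gt0.
have v0 : 0 <= vec_const R qH.+1 by rewrite mulr_ge0 ?exprn_ge0 ?ler0n.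
have vh0 : 0 <= vec_const R qH.+1 * h ^- 80 by rewrite mulr_ge0 ?invr_ge0 ?exprn_ge0 ?(ltW h_gt0).
have e80 : h ^+ 20 * (vec_const R qH.+1 * h ^- 80) = vec_const R qH.+1 * h ^- 60.
  by rewrite (exprD h 20 60); field; rewrite gt_eqF.
have h2 : \sum_j fine (P (B j)) <= 2 * vec_const R qH.+1 * h ^- 60.
  rewrite big_sumType /= -mulrA mulr_natl mulr2n; apply: lerD.
    apply: (@le_trans _ _ (\sum_(i < n1) vec_const R qH.+1 * h ^- 80)).
      apply: ler_sum => i _; rewrite -hh; exact: (uniform_row_tail unifU i qH t0).
    by rewrite sumr_const card_ord -[leLHS]mulr_natl -e80 ler_wpM2r.
  apply: (@le_trans _ _ (\sum_(i < n2) vec_const R qH.+1 * h ^- 80)).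
    apply: ler_sum => i _; rewrite -hh; exact: (uniform_row_tail unifV i qH t0).
  by rewrite sumr_const card_ord -[leLHS]mulr_natl -e80 ler_wpM2r.
have h3 : fine (P (~` [set t | incoherent t])) = 1 - fine (P [set t | incoherent t]).
  by rewrite probability_setC // fineB // fin_num_measure.
rewrite h3 mul1r in h1; lra.
Qed.

(** For every incoherent outcome [t], all but a fraction [eta] of the [m]-subsets contain the
    positions of a good sequence of batches. Integrating this count over the incoherent event gives
    the averaged probability. *)
Lemma recovery_prob_bound : recovery_prob_ge P sigma U V m (1 - fail_const k q.+1 qH.+1 * h ^- 60).
Proof.
exists recset; split; first exact: recset_measurable.
split; first by move=> S t Sm; exact: recset_recovers.
have C0 : 0 < 'C(n1 * n2, m)%:R :> R by rewrite ltr0n bin_gt0.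
have i60 : 0 <= h ^- 60 by rewrite invr_ge0 exprn_ge0 // ltW.
have v0 p : 0 <= vec_const R p by rewrite mulr_ge0 ?exprn_ge0 ?ler0n.
have eta0 : 0 <= eta.
  rewrite mulr_ge0 // mulr_ge0 // mulr_ge0 ?ler0n // addr_ge0 ?mulr_ge0 ?exprn_ge0 ?ler0n //.
have failE : fail_const k q.+1 qH.+1 * h ^- 60 = eta + 2 * vec_const R qH.+1 * h ^- 60.
  by rewrite /fail_const mulrDl.
have sumE : \sum_(S : {set I} | #|S| == m) fine (P (recset S)) = \sum_S fine (P (recset S)).
  rewrite [RHS](bigID (fun S : {set I} => #|S| == m)) /= [X in _ = _ + X]big1 ?addr0 // => S hS.
  rewrite (_ : recset S = set0) ?measure0 //; apply/seteqP; split => t //=.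
  by case/andP; rewrite (negPf hS).
have sum_ge0 : 0 <= \sum_S fine (P (recset S)) by apply: sumr_ge0 => S _; exact: fine_ge0.
rewrite sumE ler_pdivlMr //.
(* If [eta >= 1] the claimed lower bound is nonpositive. *)
have [eta1|eta1] := leP 1 eta.
  apply: le_trans sum_ge0; rewrite mulr_le0_ge0 ?(ltW C0) // subr_le0 failE.
  by apply: le_trans eta1 _; rewrite lerDl mulr_ge0 // mulr_ge0.
have key : 'C(n1 * n2, m)%:R * (1 - eta) * fine (P [set t | incoherent t]) <= \sum_S fine (P (recset S)).
  apply: sum_prob_ge; [exact: recset_measurable|exact: measurable_bool_set| |].
    by rewrite mulr_ge0 ?subr_ge0 // ltW.
  move=> t /= inc; have hb := bad_batches inc.
  have cb : (0 < #|{: k.-tuple batch}|)%N.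
    apply/card_gt0P; exists [tuple of nseq k [ffun=> (Ordinal n1_gt0, Ordinal n2_gt0)]].
    by rewrite inE.
  have imc (ws : k.-tuple batch) : (#|batches_im ws| <= m <= #|{: I}|)%N.
    by rewrite (leq_trans (batches_im_card ws) m_ge) cardI.
  have := @subset_sampling R _ _ (@batches_act _ k m0) (@batches_im _ k m0) (good t) m
    (@batches_act_inj _ k m0) (@batches_im_act _ k m0) imc eta hb cb.
  rewrite cardI => hbad.
  have tot : #|[pred S : {set I} | #|S| == m]|%:R = 'C(n1 * n2, m)%:R :> R.
    rewrite -(cardI n1 n2) -card_draws; congr (_%:R); apply: eq_card => S.
    by rewrite !inE.
  have split_card : #|[pred S : {set I} | #|S| == m]|%:R =
    #|[pred S : {set I} | (#|S| == m) && covers (@batches_im I k m0) (good t) S]|%:R +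
    #|[pred S : {set I} | (#|S| == m) && ~~ covers (@batches_im I k m0) (good t) S]|%:R :> R.
    rewrite -natrD; congr (_%:R).
    rewrite -(cardID (fun S : {set I} => covers (@batches_im I k m0) (good t) S) [pred S : {set I} | #|S| == m]).
    congr addn; apply: eq_card => S; rewrite !inE //; exact: andbC.
  have -> : \sum_S \1_(recset S) t =
    #|[pred S : {set I} | (#|S| == m) && covers (@batches_im I k m0) (good t) S]|%:R :> R.
    rewrite -sum1_card natr_sum [RHS]big_mkcond; apply: eq_bigr => S _ /=.
    rewrite indicE inE.
    have -> : (t \in recset S) = (#|S| == m) && covers (@batches_im I k m0) (good t) S.
      apply/idP/idP => [/set_mem /and3P[-> _ ->] //|/andP[h1 h2]].
      by apply: mem_set; apply/and3P.
    by case: ifP.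
  by rewrite mulrBr mulr1 lerBlDr -[X in X <= _]tot [X in X <= _]split_card lerD2l.
apply: le_trans key; rewrite failE.
have hp := incoherent_prob.
have e1 : 0 <= 1 - eta by rewrite subr_ge0 ltW.
have h1 := ler_wpM2l e1 hp.
rewrite mulrC -[X in _ <= X]mulrA ler_pM2l //.
apply: le_trans h1.
have : 0 <= eta * (2 * vec_const R qH.+1 * h ^- 60) by rewrite mulr_ge0 // mulr_ge0 // mulr_ge0.
lra.
Qed.

End Recovery.
End Assembly.

(** * Batch sizes and the final constants *)

Section BatchSizes.
Variable R : realType.

Lemma recovery_prob_le0 d (T : measurableType d) (P : probability T R) n1 n2 r (sigma : 'I_r -> R)
  (U : T -> 'M[R]_(n1, r)) (V : T -> 'M[R]_(n2, r)) m p :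
  p <= 0 -> recovery_prob_ge P sigma U V m p.
Proof.
move=> p0; exists (fun=> set0); split; first by move=> S; exact: measurable0.
split => //; apply: le_trans p0 _; rewrite divr_ge0 ?ler0n //.
by apply: sumr_ge0 => S _; exact: fine_ge0.
Qed.

Lemma powR_root (n x : R) j : 0 <= n -> x = 1 / 20 * j%:R -> powR n x = powR n (1 / 20) ^+ j.
Proof. by move=> n0 ->; rewrite powRrM powR_mulrn // powR_ge0. Qed.

(** Dividing by [ln 2] in the constant makes the logarithmic factor at least one. Rounding in
    [m %/ k] costs at most a factor two because the quotient is positive. *)
Lemma batch_size (m k r : nat) (h L : R) : (0 < r)%N -> (0 < k)%N -> 1 <= h -> ln 2 <= L ->
  4 * k%:R / ln 2 * h ^+ 24 * r%:R * L <= m%:R ->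
  (0 < m %/ k)%N /\ 2 * h ^+ 24 * r%:R <= (m %/ k)%:R.
Proof.
move=> r0 k0 h1 hL hm.
have ln20 : 0 < ln 2 :> R by rewrite ln_gt0 // ltr1n.
have k0' : 0 < k%:R :> R by rewrite ltr0n.
set x := h ^+ 24 * r%:R.
have x1 : 1 <= x.
  have h1' : 1 <= h ^+ 24 by rewrite exprn_ege1.
  have r1 : 1 <= r%:R :> R by rewrite ler1n.
  by rewrite -[leLHS]mulr1 ler_pM.
have x0 : 0 <= x := le_trans ler01 x1.
have h2 : 4 * k%:R * x <= m%:R.
  apply: le_trans hm.
  have -> : 4 * k%:R / ln 2 * h ^+ 24 * r%:R * L = 4 * k%:R * x * (L / ln 2).
    by rewrite /x; field; rewrite gt_eqF.
  have L1 : 1 <= L / ln 2 by rewrite ler_pdivlMr // mul1r.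
  have kx0 : 0 <= 4 * k%:R * x by rewrite mulr_ge0 // mulr_ge0 // ltW.
  by rewrite ler_peMr.
have hmk : (4 * k <= m)%N.
  rewrite -(ler_nat R) natrM; apply: le_trans h2; rewrite ler_peMr // mulr_ge0 // ltW.
have q0 : (0 < m %/ k)%N by rewrite divn_gt0 //; lia.
split => //.
have h3 : (m <= 2 * (k * (m %/ k)))%N.
  have := divn_eq m k; have := ltn_pmod m k0; move: q0; set y := (m %/ k)%N.
  move=> y0 hmod hdiv; have : (k <= k * y)%N by rewrite leq_pmulr.
  by rewrite [(y * k)%N]mulnC in hdiv; lia.
move: h3; rewrite -(ler_nat R) !natrM => h3.
have h4 : k%:R * (2 * h ^+ 24 * r%:R) <= k%:R * (m %/ k)%:R :> R.
  have -> : k%:R * (2 * h ^+ 24 * r%:R) = k%:R * (2 * x) by rewrite /x; ring.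
  move: h2 h3; lra.
by move: h4; rewrite ler_pM2l.
Qed.

End BatchSizes.

Unset Implicit Arguments.

Theorem theorem1p1 (R : realType) :
  exists C c : R, 0 < C /\ 0 < c /\
  forall (n1 n2 r m : nat) (sigma : 'I_r -> R)
         (d : measure_display) (T : measurableType d) (P : probability T R)
         (U : T -> 'M[R]_(n1, r)) (V : T -> 'M[R]_(n2, r)),
    (0 < r)%N -> (r <= minn n1 n2)%N -> (m <= n1 * n2)%N ->
    (forall k, 0 < sigma k) ->
    uniform_frame P U -> uniform_frame P V ->
    let n := (maxn n1 n2)%:R : R in
    (C * powR n (5 / 4) * r%:R * ln n <= m%:R ->
       recovery_prob_ge P sigma U V m (1 - c * n ^- 3)) /\
    (r%:R <= powR n (1 / 5) -> C * powR n (6 / 5) * r%:R * ln n <= m%:R ->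
       recovery_prob_ge P sigma U V m (1 - c * n ^- 3)).
Proof.
(* [k], [q] and [qH] stay abstract: [fail_const] must not be evaluated on unary numerals. *)
have [k kE] : exists k, k = (20 + 200)%N by exists (20 + 200)%N.
have [q qE] : exists q, q.+1 = (40 + 60)%N by exists (39 + 60)%N.
have [qH qHE] : exists qH, (2 * qH.+1 = 20 + 60)%N by exists 39%N.
have k_gt0 : (0 < k)%N by rewrite kE.
have ln20 : 0 < ln 2 :> R by rewrite ln_gt0 // ltr1n.
pose C : R := 4 * k%:R / ln 2.
pose Fc := fail_const R k q.+1 qH.+1.
(* The added cube makes the bound [1 - c * n ^- 3] nonpositive, hence trivial, when [n <= 4 * k]. *)
pose c : R := Fc + (4 * k)%:R ^+ 3.
have v0 p : 0 <= vec_const R p by rewrite mulr_ge0 ?exprn_ge0 ?ler0n.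
have mc0 : 0 <= mat_const R q.+1 1 by rewrite /mat_const !mulr_ge0 ?exprn_ge0 ?ler0n.
have Fc0 : 0 <= Fc.
  apply: addr_ge0; last by rewrite mulr_ge0.
  rewrite mulr_ge0 // mulr_ge0 ?ler0n // addr_ge0 //; last by rewrite mulr_ge0.
  by rewrite mulr_ge0 // exprn_ge0 // ler0n.
have C0 : 0 < C by rewrite divr_gt0 // mulr_gt0 // ltr0n.
have k30 : 0 < (4 * k)%:R ^+ 3 :> R by rewrite exprn_gt0 // ltr0n muln_gt0.
exists C, c; split => //; split; first by rewrite ltr_wpDl.
move=> n1 n2 r m sigma d T P U V r0 rle mle s0 uU uV n.
have n1_1 : (0 < n1)%N by apply: leq_trans r0 (leq_trans rle (geq_minl _ _)).
have n_ge1 : 1 <= n by rewrite ler1n (leq_trans n1_1) ?leq_maxl.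
have n_gt0 : 0 < n := lt_le_trans ltr01 n_ge1.
have n3 : 0 < n ^+ 3 by rewrite exprn_gt0.
(* As [n >= 1], the sample bound with exponent [5 / 4] implies the one with exponent [6 / 5]. *)
suff main : C * powR n (6 / 5) * r%:R * ln n <= m%:R ->
    recovery_prob_ge P sigma U V m (1 - c * n ^- 3).
  split => [hm|_]; last exact: main.
  apply: main; apply: le_trans hm.
  rewrite ler_wpM2r ?ln_ge0 // ler_wpM2r ?ler0n // ler_wpM2l ?(ltW C0) //.
  by rewrite ler_powR //; lra.
move=> hm; have [small|large] := leP n (4 * k)%:R.
  apply: recovery_prob_le0; rewrite subr_le0 ler_pdivlMr // mul1r.
  apply: (@le_trans _ _ ((4 * k)%:R ^+ 3)); last by rewrite lerDr.
  by rewrite lerXn2r ?nnegrE ?ler0n // ltW.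
(* The twentieth root makes every power of [n] in use an integral power of [h]: [n = h ^+ 20],
   [n ^- 3 = h ^- 60], and exponent [6 / 5] becomes [24]. *)
pose h := powR n (1 / 20).
have h20 : n = h ^+ 20.
  by rewrite -[LHS]powRr1 ?(ltW n_gt0) // (@powR_root R n 1 20) ?(ltW n_gt0) //; field.
have h_ge1 : 1 <= h.
  by rewrite -[leLHS](powRr0 n) ler_powR // divr_ge0.
have h24 : powR n (6 / 5) = h ^+ 24 by apply: powR_root; [exact: ltW|field].
have hln : ln 2 <= ln n.
  rewrite ler_ln ?posrE //; apply: le_trans (ltW large); rewrite ler_nat.
  by rewrite (leq_trans _ (leq_pmulr 4 k_gt0)).
rewrite h24 in hm.
have [m0_gt0 m0_ge] := batch_size r0 k_gt0 h_ge1 hln hm.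
have hmk : (k * (m %/ k) <= m)%N by rewrite mulnC leq_trunc_div.
have hlarge : (4 * k)%:R < h ^+ 20 by rewrite -h20.
have := recovery_prob_bound r0 rle m0_gt0 hmk mle kE qE qHE s0 uU uV h_ge1 h20 m0_ge hlarge.
have -> : h ^- 60 = n ^- 3 by rewrite h20 -exprM.
case=> F [mF [rF hF]]; exists F; split => //; split => //.
apply: le_trans hF; rewrite lerD2l lerN2 ler_wpM2r ?invr_ge0 ?(ltW n3) //.
by rewrite /c lerDl ltW.
Qed.
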